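(* Let $(M_+,g_+)$ be a geodesically complete pseudo-Riemannian manifold, let $i:M_+\to M$ be an embedding of $M_+$ as an open submanifold in a closed connected conformal manifold $(M,\boldsymbol{c})$ of dimension at least $3$, and let $\sigma$ be a smooth section of $\mathcal{E}[1]$ on $M$ such that on the image $i(M_+)$, identified with $M_+$, one has $g_+=\sigma^{-2}\mathbf{g}$, where $\mathbf{g}$ is the conformal metric on $M$. If the scalar curvature of $g_+$ is bounded away from zero, then either $M_+=M$ or the boundary points of $M_+$ in $M$ form a smooth embedded hypersurface in $M$. This hypersurface has a timelike normal field if $\mathrm{Sc}^{g_+}>0$ and a spacelike normal field if $\mathrm{Sc}^{g_+}<0$.
   Context: All objects are smooth. A conformal manifold $(M^d,\boldsymbol{c})$, $d\ge 3$, is a $d$-manifold with an equivalence class $\boldsymbol{c}$ of metrics of signature $(p,q)$ ($p$ positive and $q$ negative directions), where $\widehat g\sim g$ iff $\widehat g=\Omega^2 g$ for a smooth function $\Omega>0$. Closed means compact without boundary. $\mathcal{E}[w]$ is the line bundle of conformal densities of weight $w$: a section is equivalently a family of functions $(f^g)_{g\in\boldsymbol{c}}$ with $f^{\Omega^2g}=\Omega^w f^g$. For $g\in\boldsymbol{c}$ let $\sigma_g\in\Gamma(\mathcal{E}[1])$ be the density represented by the constant $1$ in the scale $g$; the conformal metric $\mathbf{g}:=\sigma_g^2\,g\in\Gamma(S^2T^*M\otimes\mathcal{E}[2])$ is independent of $g\in\boldsymbol{c}$. Where $\sigma\in\Gamma(\mathcal{E}[1])$ is nonzero, $\sigma^{-2}\mathbf{g}$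 is a metric in the conformal class. ''Bounded away from zero'' means $|\mathrm{Sc}^{g_+}|\ge\epsilon$ for some constant $\epsilon>0$. A normal $n$ is spacelike (timelike) if $\mathbf{g}(n,n)>0$ ($<0$). Scalar curvature has the sign convention in which round spheres have positive scalar curvature. *)

(* Defs.v *)
From HB Require Import structures.
From mathcomp Require Import all_boot all_order all_algebra.
From mathcomp Require Import all_classical all_reals all_analysis.

Set Implicit Arguments.
Unset Strict Implicit.
Unset Printing Implicit Defensive.

Import Order.TTheory GRing.Theory Num.Theory.
Import numFieldNormedType.Exports.

Local Open Scope classical_set_scope.
Local Open Scope ring_scope.

(* Smoothness is only ever used on open sets A.  For finite-dimensional V, f is
   of class C^(k+1) iff it is differentiable and all the directional
   derivatives 'D_v f are of class C^k. *)
Fixpoint Ck_on (R : realType) (V W : normedModType R) (k : nat) (A : set V)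
    (f : V -> W) : Prop :=
  match k with
  | 0%N => forall x, A x -> {for x, continuous f}
  | k'.+1 => (forall x, A x -> differentiable f x) /\
             (forall v : V, Ck_on k' A (fun x => 'D_v f x))
  end.

Definition smooth_on (R : realType) (V W : normedModType R) (A : set V)
    (f : V -> W) : Prop :=
  forall k, Ck_on k A f.

(* A chart is a homeomorphism cphi from the open set cdom onto an open subset of
   R^d, with inverse cpsi; the values of cphi outside cdom, and of cpsi outside
   the image, are irrelevant. *)
Record chart (R : realType) (d : nat) (T : topologicalType) := Chart {
  cdom : set T;
  cphi : T -> 'rV[R]_d;
  cpsi : 'rV[R]_d -> T;
  cdom_open : open cdom;
  cimg_open : open (cphi @` cdom);
  cphiK : forall x, cdom x -> cpsi (cphi x) = x;
  cphi_continuous : forall x, cdom x -> {for x, continuous cphi};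
  cpsi_continuous : forall y, (cphi @` cdom) y -> {for y, continuous cpsi}
}.

Definition smooth_transition (R : realType) (d : nat) (T : topologicalType)
    (a b : chart R d T) : Prop :=
  smooth_on (cphi a @` (cdom a `&` cdom b)) (cphi b \o cpsi a).

Definition smooth_compat (R : realType) (d : nat) (T : topologicalType)
    (a b : chart R d T) : Prop :=
  smooth_transition a b /\ smooth_transition b a.

(* Smooth d-manifolds without boundary.  The atlas need not be maximal. *)
Record manifold (R : realType) (d : nat) := Manifold {
  mcarrier :> topologicalType;
  midx : Type;
  atlas : midx -> chart R d mcarrier;
  atlas_cover : forall x : mcarrier, exists a, cdom (atlas a) x;
  atlas_compat : forall a b, smooth_compat (atlas a) (atlas b);
  mhausdorff : hausdorff_space mcarrier;
  msecond_countable : @second_countable mcarrier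
}.

Section Manifolds.
Context {R : realType} {d : nat}.
Implicit Types M N : manifold R d.

Definition dom M (a : midx M) : set M := cdom (atlas a).
Definition phi M (a : midx M) : M -> 'rV[R]_d := cphi (atlas a).
Definition psi M (a : midx M) : 'rV[R]_d -> M := cpsi (atlas a).

Definition smooth_fun M (f : M -> R) : Prop :=
  forall a, smooth_on (phi a @` dom a) (f \o psi a).

Definition local_rep M N (f : M -> N) (a : midx M) (b : midx N) :
    'rV[R]_d -> 'rV[R]_d :=
  phi b \o f \o psi a.

Definition smooth_map M N (f : M -> N) : Prop :=
  continuous f /\
  forall a b, smooth_on (phi a @` (dom a `&` f @^-1` dom b)) (local_rep f a b).

(* Tangent vectors are rows, so that the differential of f at x sends the
   components v (in the chart a) to v *m dmap f a b x (in the chart b). *)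
Definition dmap M N (f : M -> N) (a : midx M) (b : midx N) (x : M) : 'M[R]_d :=
  jacobian (local_rep f a b) (phi a x).

(* Embedding as an open submanifold: an immersion (between manifolds of the
   same dimension) which is a homeomorphism onto an open image. *)
Definition open_embedding M N (f : M -> N) : Prop :=
  [/\ smooth_map f, injective f, (forall U : set M, open U -> open (f @` U)) &
      forall a b x, dom a x -> dom b (f x) -> dmap f a b x \in unitmx].

(* Sylvester normal form; it entails that G is symmetric and nondegenerate. *)
Definition has_signature (p q : nat) (G : 'M[R]_d) : Prop :=
  (p + q = d)%N /\
  exists2 P : 'M[R]_d, P \in unitmx &
    G = P *m diag_mx (\row_(i < d) (if (i < p)%N then 1 else -1)) *m P^T.

(* Pseudo-Riemannian metrics with p positive and q negative directions, given
   by their component matrices in each chart of the atlas. *)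
Record metric M (p q : nat) := Metric {
  mcomp :> midx M -> M -> 'M[R]_d;
  mcomp_signature : forall a x, dom a x -> has_signature p q (mcomp a x);
  mcomp_smooth : forall a, smooth_on (phi a @` dom a) (mcomp a \o psi a);
  mcomp_change : forall a b x, dom a x -> dom b x ->
    let J := dmap idfun a b x in mcomp a x = J *m mcomp b x *m J^T
}.

Definition inner M p q (g : metric M p q) (a : midx M) (x : M)
    (v w : 'rV[R]_d) : R :=
  (v *m g a x *m w^T) 0 0.

Definition partial (k : 'I_d) (f : 'rV[R]_d -> R) (y : 'rV[R]_d) : R :=
  'D_(delta_mx 0 k) f y.

(* Gamma^k_ij of the metric G on (an open subset of) R^d. *)
Definition christoffel (G : 'rV[R]_d -> 'M[R]_d) (k i j : 'I_d)
    (y : 'rV[R]_d) : R :=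
  2^-1 * \sum_(l < d) invmx (G y) k l *
    (partial i (fun z => G z j l) y + partial j (fun z => G z i l) y
     - partial l (fun z => G z i j) y).

(* Sign convention: round spheres have positive definite Ricci curvature. *)
Definition ricci (G : 'rV[R]_d -> 'M[R]_d) (i j : 'I_d) (y : 'rV[R]_d) : R :=
  \sum_(k < d)
    (partial k (christoffel G k i j) y - partial j (christoffel G k i k) y
     + \sum_(l < d) (christoffel G k k l y * christoffel G l i j y
                     - christoffel G k j l y * christoffel G l i k y)).

(* The scalar curvature at x, computed in the chart a; for x in dom a it does
   not depend on a. *)
Definition scalar_curvature M p q (g : metric M p q) (a : midx M) (x : M) : R :=
  \sum_(i < d) \sum_(j < d)
    invmx (g a x) i j * ricci (g a \o psi a) i j (phi a x).

Definition smooth_curve M (I : set R) (gam : R -> M) : Prop :=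
  (forall t, I t -> {for t, continuous gam}) /\
  forall a, smooth_on (I `&` gam @^-1` dom a) (phi a \o gam).

Definition geodesic M p q (g : metric M p q) (I : set R) (gam : R -> M) : Prop :=
  smooth_curve I gam /\
  forall a t, I t -> dom a (gam t) ->
    let u := phi a \o gam in
    forall k : 'I_d,
      derive1n 2 u t 0 k + \sum_(i < d) \sum_(j < d)
        christoffel (g a \o psi a) k i j (u t) *
          derive1 u t 0 i * derive1 u t 0 j = 0.

Definition geodesically_complete M p q (g : metric M p q) : Prop :=
  forall (I : set R) (gam : R -> M),
    open I -> is_interval I -> I !=set0 -> geodesic g I gam ->
    exists2 gam' : R -> M, geodesic g setT gam' & {in I, gam' =1 gam}.

(* g' = Om^2 g *)
Definition rescaled M p q (Om : M -> R) (g g' : metric M p q) : Prop :=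
  [/\ smooth_fun Om, (forall x, 0 < Om x) &
      forall a x, dom a x -> g' a x = Om x ^+ 2 *: g a x].

Definition conformal_class M p q (c : set (metric M p q)) : Prop :=
  exists g, c = [set g' | exists Om, rescaled Om g g'].

(* Smooth sections of the density bundle E[w] of the conformal class c; the
   values at metrics outside c are irrelevant. *)
Record density M p q (c : set (metric M p q)) (w : R) := Density {
  dens :> metric M p q -> M -> R;
  dens_smooth : forall g, c g -> smooth_fun (dens g);
  dens_change : forall g g' Om, c g -> c g' -> rescaled Om g g' ->
    forall x, dens g' x = Om x `^ w * dens g x
}.

(* The components of s^-2 times the conformal metric, for a density s of weight
   1.  In the scale g, s is (s g) * sigma_g, and the conformal metric is
   sigma_g^2 * g; the result does not depend on g in the conformal class. *)
Definition scale_metric M p q (c : set (metric M p q)) (s : density c 1)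
    (g : metric M p q) (a : midx M) (x : M) : 'M[R]_d :=
  (s g x)^-2 *: g a x.

(* gp = s^-2 (conformal metric) on the image of f, identified with N via f. *)
Definition is_scale_metric M N p q (f : N -> M) (gp : metric N p q)
    (c : set (metric M p q)) (s : density c 1) : Prop :=
  forall g, c g -> forall x : N, s g (f x) != 0 /\
    forall a b, dom a x -> dom b (f x) ->
      let J := dmap f a b x in
      gp a x = J *m scale_metric s g b (f x) *m J^T.

Definition boundary_points M (A : set M) : set M := closure A `\` interior A.

(* Slice charts; k is a chart of the maximal atlas. *)
Definition embedded_hypersurface M (S : set M) : Prop :=
  S !=set0 /\
  forall x, S x -> exists (k : chart R d M) (i : 'I_d),
    [/\ (forall a, smooth_compat (atlas a) k), cdom k x &
        forall y, cdom k y -> (S y <-> cphi k y 0 i = 0)].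

(* v (in the chart a) is the velocity at x of a smooth curve lying in S. *)
Definition tangent_to M (S : set M) (a : midx M) (x : M) (v : 'rV[R]_d) : Prop :=
  exists (e : R) (gam : R -> M),
    [/\ 0 < e, smooth_curve (ball (0 : R) e) gam, gam 0 = x,
        (forall t, ball (0 : R) e t -> S (gam t)) &
        derive1 (phi a \o gam) 0 = v].

(* Smooth sections over S of the tangent bundle of M; smoothness on the subset
   S means having local smooth extensions. *)
Definition vector_field_along M (S : set M) (n : midx M -> M -> 'rV[R]_d) :
    Prop :=
  (forall a b x, S x -> dom a x -> dom b x ->
     n b x = n a x *m dmap idfun a b x) /\
  (forall a x, S x -> dom a x ->
     exists (U : set M) (F : 'rV[R]_d -> 'rV[R]_d),
       [/\ open U, U x, U `<=` dom a, smooth_on (phi a @` U) F &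
           forall y, U y -> S y -> n a y = F (phi a y)]).

Definition normal_field M p q (c : set (metric M p q)) (S : set M)
    (n : midx M -> M -> 'rV[R]_d) : Prop :=
  vector_field_along S n /\
  forall g a x v, c g -> S x -> dom a x -> tangent_to S a x v ->
    inner g a x (n a x) v = 0.

(* The sign of the squared norm is the same for all the metrics in c. *)
Definition spacelike_along M p q (c : set (metric M p q)) (S : set M)
    (n : midx M -> M -> 'rV[R]_d) : Prop :=
  forall g a x, c g -> S x -> dom a x -> 0 < inner g a x (n a x) (n a x).

Definition timelike_along M p q (c : set (metric M p q)) (S : set M)
    (n : midx M -> M -> 'rV[R]_d) : Prop :=
  forall g a x, c g -> S x -> dom a x -> inner g a x (n a x) (n a x) < 0.

End Manifolds.

(* Main.v *)
Require Import Defs.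
From HB Require Import structures.
From mathcomp Require Import all_boot all_order all_algebra.
From mathcomp Require Import all_classical all_reals all_analysis.
From mathcomp Require Import ring lra.
Import Order.TTheory GRing.Theory Num.Theory.
Import numFieldNormedType.Exports.
Local Open Scope classical_set_scope.
Local Open Scope ring_scope.
Set Implicit Arguments.
Unset Strict Implicit.
Unset Printing Implicit Defensive.

(** Write [g_+ = f^-2 g] for a metric [g] of the conformal class.  The conformal
    change of the scalar curvature has the form
    [Sc(f^-2 g) = f * Q - d (d - 1) |df|^2] with [Q] smooth up to the zeros of
    [f].  A boundary point [x] of [M_+] satisfies [f x = 0]: otherwise [f^-2 g]
    is a metric near [x], and a short geodesic (obtained as the solution of a
    boundary value problem) joins a point of [M_+] to [x]; by completeness it
    never leaves [M_+].  Hence [- d (d - 1) |df|^2] is at [x] a limit of values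
    of [Sc], so it is nonzero and has the sign of [Sc].  In particular [df] is
    nonzero, so [f] can be used as a coordinate near [x]; in a convex such chart
    the side of [f = 0] containing a point of [M_+] lies in [M_+], so that the
    boundary is the zero set of [f].  The gradient of [f] is a normal field. *)

(** * Calculus of smooth maps *)

(** In indefinite signature completeness gives no distance argument; all it offers is the extension
    of a geodesic, so a geodesic must be found that starts in [M_+] and reaches the given boundary
    point. Prescribing both end points avoids the exponential map: the acceleration is the fixed
    point of an integral operator, which contracts for close end points because the equation is
    quadratic in the velocity. The equation is solved in a chart of [M], and the part of the curve
    before its first exit is carried to [M_+] by the inverse embedding. Curvature and geodesics must
    therefore be compared between charts of two manifolds. These comparisons and the conformal
    change all rest on the uniqueness of the torsion-free metric connection: a candidate is written
    down and its two properties are checked. The constant [d (d - 1)] comes from two successive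
    traces of the terms of order [f^-2] in the curvature. A bound away from zero is needed because a
    strict inequality alone would not survive the limit at the boundary. *)

Section CkCalculus.
Context {R : realType}.
Implicit Types V W : normedModType R.

Lemma differentiable_near V W (f : V -> W) (x : V) : differentiable f x ->
  forall e, 0 < e -> \forall h \near (0 : V),
    `|f (h + x) - f x - 'd f x h| <= e * `|h|.
Proof.
move=> /diff_locallyP[_ /eqaddoP fE] e e0.
by have /= := fE _ e0; apply: filterS => h; rewrite -[_ h]/(_ - (_ + _)) opprD addrA.
Qed.

Lemma is_diff_near V W (f : V -> W) (L : {linear V -> W}) (x : V) :
  continuous L ->
  (forall e, 0 < e -> \forall h \near (0 : V),
    `|f (h + x) - f x - L h| <= e * `|h|) -> is_diff x f L.
Proof.
move=> cL fL.
have fE : f \o shift x = cst (f x) + L +o_ 0 id.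
  apply/eqaddoP => e e0; have := fL _ e0; apply: filterS => h.
  by rewrite -[(_ - _ : V -> W) h]/(_ - (_ + _)) opprD addrA.
have dE := diff_unique cL fE.
apply: DiffDef => //; apply/diff_locallyP; rewrite dE; split => //.
Qed.

Lemma near_eq_is_diff V W (f g : V -> W) (x : V) :
  (\near x, f x = g x) -> differentiable f x -> is_diff x g ('d f x).
Proof.
move=> fg df; apply: is_diff_near; first exact: diff_continuous.
have fg0 : \forall h \near (0 : V), f (h + x) = g (h + x).
  by move: fg; rewrite (near_shift 0) subr0.
move=> e e0; near=> h.
rewrite -(nbhs_singleton fg); have <- : f (h + x) = g (h + x) by near: h.
near: h; exact: differentiable_near.
Unshelve. all: by end_near. Qed.

Lemma near_eq_differentiable V W (f g : V -> W) (x : V) :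
  (\near x, f x = g x) -> differentiable f x -> differentiable g x.
Proof. by move=> fg /(near_eq_is_diff fg) []. Qed.

Lemma open_near_eq V W (A : set V) (f g : V -> W) : open A ->
  {in A, f =1 g} -> forall x, A x -> \near x, f x = g x.
Proof.
move=> oA fg x Ax; have : \near x, A x by exact: open_nbhs_nbhs.
by apply: filterS => y Ay; apply: fg; rewrite inE.
Qed.

(** Openness of [A] drives the induction: functions that agree on [A] agree near each of its points,
    so their derivatives agree on [A] again. *)
Lemma Ck_ext V W k (A : set V) (f g : V -> W) : open A ->
  {in A, f =1 g} -> Ck_on k A f -> Ck_on k A g.
Proof.
move=> oA; elim: k f g => [|k IH] f g fg /=.
  move=> cf x Ax; have fgx := open_near_eq oA fg Ax.
  rewrite /prop_for /continuous_at -(nbhs_singleton fgx).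
  by apply: cvg_trans (cf x Ax); apply: near_eq_cvg.
move=> [df Df]; split=> [x Ax|v].
  by apply: near_eq_differentiable (df x Ax); exact: open_near_eq Ax.
apply: IH (Df v) => x; rewrite inE => Ax.
by apply: near_eq_derive; exact: open_near_eq Ax.
Qed.

Lemma smooth_ext V W (A : set V) (f g : V -> W) : open A ->
  {in A, f =1 g} -> smooth_on A f -> smooth_on A g.
Proof. by move=> oA fg sf k; exact: Ck_ext fg (sf k). Qed.

Lemma Ck_sub V W k (A B : set V) (f : V -> W) :
  A `<=` B -> Ck_on k B f -> Ck_on k A f.
Proof.
move=> AB; elim: k f => [|k IH] f /=; first by move=> cf x /AB; exact: cf.
by move=> [df Df]; split=> [x /AB|v]; [exact: df|exact: IH].
Qed.

Lemma smooth_sub V W (A B : set V) (f : V -> W) :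
  A `<=` B -> smooth_on B f -> smooth_on A f.
Proof. by move=> AB sf k; exact: Ck_sub AB (sf k). Qed.

Lemma CkS V W k (A : set V) (f : V -> W) : Ck_on k.+1 A f -> Ck_on k A f.
Proof.
elim: k f => [|k IH] f [df Df]; first by move=> x /df /differentiable_continuous.
by split => // v; apply: IH; exact: Df.
Qed.

Lemma smooth_differentiable V W (A : set V) (f : V -> W) x :
  smooth_on A f -> A x -> differentiable f x.
Proof. by move=> sf; case: (sf 1%N) => df _ /df. Qed.

Lemma smooth_continuous V W (A : set V) (f : V -> W) x :
  smooth_on A f -> A x -> {for x, continuous f}.
Proof. by move=> sf; exact: (sf 0%N). Qed.

Lemma smooth_derive V W (A : set V) (f : V -> W) v :
  smooth_on A f -> smooth_on A (fun x => 'D_v f x).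
Proof. by move=> sf k; have [_] := sf k.+1; exact. Qed.

Lemma Ck_cst V W k (A : set V) (c : W) : Ck_on k A (fun=> c : W).
Proof.
elim: k c => [|k IH] c; first by move=> x _; exact: cst_continuous.
split=> [x _|v]; first exact: differentiable_cst.
by rewrite (_ : 'D_v _ = fun=> 0) //; apply/funext => x; rewrite derive_cst.
Qed.

Lemma CkD V W k (A : set V) (f g : V -> W) : open A ->
  Ck_on k A f -> Ck_on k A g -> Ck_on k A (fun x => f x + g x).
Proof.
move=> oA; elim: k f g => [|k IH] f g.
  by move=> cf cg x Ax; apply: cvgD; [exact: cf|exact: cg].
move=> [df Df] [dg Dg]; split=> [x Ax|v].
  by apply: differentiableD; [exact: df|exact: dg].
apply: Ck_ext (IH _ _ (Df v) (Dg v)) => // x; rewrite inE => Ax.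
by rewrite -deriveD //; apply: diff_derivable; [exact: df|exact: dg].
Qed.

(** The Leibniz rule still contains [f] and [g] undifferentiated, so the induction step also uses
    them at the lower class given by [CkS]. *)
Lemma CkM V k (A : set V) (f g : V -> R) : open A ->
  Ck_on k A f -> Ck_on k A g -> Ck_on k A (fun x => f x * g x).
Proof.
move=> oA; elim: k f g => [|k IH] f g.
  by move=> cf cg x Ax; apply: cvgM; [exact: cf|exact: cg].
move=> Cf Cg; have Cf' := CkS Cf; have Cg' := CkS Cg.
move: Cf Cg => [df Df] [dg Dg]; split=> [x Ax|v].
  by apply: differentiableM; [exact: df|exact: dg].
have := CkD oA (IH _ _ Cf' (Dg v)) (IH _ _ Cg' (Df v)).
apply: Ck_ext => // x; rewrite inE => Ax.
by rewrite deriveM //; apply: diff_derivable; [exact: df|exact: dg].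
Qed.

Lemma Ck_sum V W k (A : set V) (I : Type) (r : seq I) (P : pred I)
    (f : I -> V -> W) : open A ->
  (forall i, P i -> Ck_on k A (f i)) -> Ck_on k A (fun x => \sum_(i <- r | P i) f i x).
Proof.
move=> oA sf; elim: r => [|i r IH].
  by under eq_fun do rewrite big_nil; exact: Ck_cst.
have [Pi|Pi] := boolP (P i); last by under eq_fun do rewrite big_cons (negPf Pi).
by under eq_fun do rewrite big_cons Pi; apply: CkD => //; exact: sf.
Qed.

Lemma CkV V k (A : set V) (f : V -> R) : open A -> (forall x, A x -> f x != 0) ->
  Ck_on k A f -> Ck_on k A (fun x => (f x)^-1).
Proof.
move=> oA f0; elim: k => [|k IH].
  by move=> cf x Ax; apply: cvgV; [exact: f0|exact: cf].
move=> Cf; have Cf' := IH (CkS Cf); move: Cf => [df Df].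
split=> [x Ax|v]; first by apply: differentiableV; [exact: df|exact: f0].
have := CkM oA (Ck_cst k A (-1 : R)) (CkM oA (CkM oA Cf' Cf') (Df v)).
apply: Ck_ext => // x; rewrite inE => Ax.
rewrite deriveV ?f0 //; last by apply: diff_derivable; exact: df.
by rewrite /GRing.scale /= mulN1r mulNr -expr2 exprVn.
Qed.

Lemma derive_entry V m n (F : V -> 'M[R]_(m, n)) x v i j : differentiable F x ->
  'D_v F x i j = 'D_v (fun x => F x i j) x.
Proof. by move=> dF; rewrite derive_mx ?mxE //; exact: diff_derivable. Qed.

Lemma differentiable_entry V m n (F : V -> 'M[R]_(m, n)) x i j :
  differentiable F x -> differentiable (fun x => F x i j) x.
Proof.
move=> dF; apply: (@differentiable_comp _ _ _ _ F (fun N => N i j)) => //.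
exact: differentiable_coord.
Qed.

Lemma differentiable_mx V m n (F : V -> 'M[R]_(m, n)) x :
  (forall i j, differentiable (fun x => F x i j) x) -> differentiable F x.
Proof.
move=> dF; have -> : F = \sum_(i < m) \sum_(j < n) fun x => F x i j *: delta_mx i j.
  apply/funext => y; rewrite {1}[F y]matrix_sum_delta fct_sumE.
  by apply: eq_bigr => i _; rewrite fct_sumE.
by apply: differentiable_sum => i; apply: differentiable_sum => j;
   exact: differentiableZl.
Qed.

Lemma Ck_entry V k (A : set V) m n (F : V -> 'M[R]_(m, n)) i j : open A ->
  Ck_on k A F -> Ck_on k A (fun x => F x i j).
Proof.
move=> oA; elim: k F => [|k IH] F.
  move=> cF x Ax; apply: (@continuous_comp _ _ _ F (fun N => N i j)).
    exact: cF.
  exact: coord_continuous.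
move=> [dF DF]; split=> [x Ax|v]; first by apply: differentiable_entry; exact: dF.
apply: Ck_ext (IH _ (DF v)) => // x; rewrite inE => Ax.
by apply: derive_entry; exact: dF.
Qed.

Lemma Ck_mx V k (A : set V) m n (F : V -> 'M[R]_(m, n)) : open A ->
  (forall i j, Ck_on k A (fun x => F x i j)) -> Ck_on k A F.
Proof.
move=> oA; elim: k F => [|k IH] F.
  move=> cF x Ax; have -> : F = fun x => \sum_(i < m) \sum_(j < n) F x i j *: delta_mx i j.
    by apply/funext => y; rewrite {1}[F y]matrix_sum_delta.
  rewrite /prop_for/continuous_at; apply: cvg_big => [|i _]; first exact: add_continuous.
  apply: cvg_big => [|j _]; first exact: add_continuous.
  by apply: cvgZr_tmp; exact: cF.
move=> CF.
have dF x : A x -> differentiable F x.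
  by move=> Ax; apply: differentiable_mx => i j; case: (CF i j) => + _; exact.
split=> // v; apply: IH => i j; have [_ /(_ v)] := CF i j.
apply: Ck_ext => // x; rewrite inE => Ax.
by rewrite derive_entry //; exact: dF.
Qed.

Lemma Ck_prod V k (A : set V) (I : Type) (r : seq I) (P : pred I)
    (f : I -> V -> R) : open A ->
  (forall i, P i -> Ck_on k A (f i)) -> Ck_on k A (fun x => \prod_(i <- r | P i) f i x).
Proof.
move=> oA sf; elim: r => [|i r IH].
  by under eq_fun do rewrite big_nil; exact: Ck_cst.
have [Pi|Pi] := boolP (P i); last by under eq_fun do rewrite big_cons (negPf Pi).
by under eq_fun do rewrite big_cons Pi; apply: CkM => //; exact: sf.
Qed.

Lemma Ck_det V k (A : set V) n (F : V -> 'M[R]_n) : open A ->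
  (forall i j, Ck_on k A (fun x => F x i j)) -> Ck_on k A (fun x => \det (F x)).
Proof.
move=> oA CF; apply: Ck_sum => // s _.
by apply: CkM => //; [exact: Ck_cst|apply: Ck_prod].
Qed.

(** Cramer's rule: the entries of the inverse are cofactors divided by the determinant. *)
Lemma Ck_invmx V k (A : set V) n (F : V -> 'M[R]_n) : open A ->
  (forall x, A x -> F x \in unitmx) ->
  Ck_on k A F -> Ck_on k A (fun x => invmx (F x)).
Proof.
move=> oA uF CF; apply: Ck_mx => // i j.
have : Ck_on k A (fun x => (\det (F x))^-1 * cofactor (F x) j i).
  apply: CkM => //.
    apply: CkV => //; first by move=> x /uF; rewrite unitmxE unitfE.
    by apply: Ck_det => // ? ?; exact: Ck_entry.
  apply: CkM => //; first exact: Ck_cst.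
  by apply: Ck_det => // i' j'; under eq_fun do rewrite !mxE; exact: Ck_entry.
by apply: Ck_ext => // x; rewrite inE => Ax; rewrite /invmx uF // !mxE.
Qed.

Lemma derive_comp_rV V n (F : V -> 'rV[R]_n) (g : 'rV[R]_n -> R) x v :
  differentiable F x -> differentiable g (F x) ->
  'D_v (g \o F) x = \sum_(j < n) 'D_v (fun y => F y 0 j) x * 'D_(delta_mx 0 j) g (F x).
Proof.
move=> dF dg; rewrite deriveE; last exact: differentiable_comp.
rewrite diff_comp //= -(deriveE v) // {1}['D_v F x]row_sum_delta linear_sum /=.
apply: eq_bigr => j _; rewrite linearZ /= -deriveE // derive_entry //.
Qed.

(** [Ck_on] speaks only of derivatives in fixed directions, whereas the chain rule differentiates
    [g] in the moving direction ['D_v F x]. Expanding that direction in the standard basis leaves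
    finitely many fixed ones. *)
Lemma Ck_comp V n k (A : set V) (B : set 'rV[R]_n) (F : V -> 'rV[R]_n)
    (g : 'rV[R]_n -> R) : open A -> (forall x, A x -> B (F x)) ->
  Ck_on k A F -> Ck_on k B g -> Ck_on k A (g \o F).
Proof.
move=> oA AB; elim: k g => [|k IH] g.
  by move=> cF cg x Ax; apply: continuous_comp; [exact: cF|apply: cg; exact: AB].
move=> CF [dg Dg]; have CF' := CkS CF; have [dF DF] := CF; split=> [x Ax|v].
  by apply: differentiable_comp; [exact: dF|apply: dg; exact: AB].
have : Ck_on k A (fun x => \sum_(j < n) ('D_v F x) 0 j * ('D_(delta_mx 0 j) g \o F) x).
  apply: Ck_sum => // j _; apply: CkM => //; last by apply: IH => //; exact: Dg.
  by apply: Ck_entry => //; exact: DF.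
apply: Ck_ext => // x; rewrite inE => Ax.
rewrite derive_comp_rV //; [|exact: dF|by apply: dg; exact: AB].
by apply: eq_bigr => j _; rewrite derive_entry //; exact: dF.
Qed.

Lemma Ck_id V k (A : set V) : Ck_on k A (@id V).
Proof.
case: k => [|k]; first by move=> x _; exact: cvg_id.
split=> [x _|v]; first exact: ex_diff.
by rewrite (_ : 'D_v _ = fun=> v); [exact: Ck_cst|apply/funext => x; exact: derive_id].
Qed.

Lemma smooth_cst V W (A : set V) (c : W) : smooth_on A (fun=> c : W).
Proof. by move=> k; exact: Ck_cst. Qed.

Lemma smooth_id V (A : set V) : smooth_on A (@id V).
Proof. by move=> k; exact: Ck_id. Qed.

Section Open.
Variables (V : normedModType R) (A : set V).
Hypothesis oA : open A.

Lemma smoothD W (f g : V -> W) :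
  smooth_on A f -> smooth_on A g -> smooth_on A (fun x => f x + g x).
Proof. by move=> sf sg k; exact: CkD. Qed.

Lemma smoothM (f g : V -> R) :
  smooth_on A f -> smooth_on A g -> smooth_on A (fun x => f x * g x).
Proof. by move=> sf sg k; exact: CkM. Qed.

Lemma smooth_sum W (I : Type) (r : seq I) (P : pred I) (f : I -> V -> W) :
  (forall i, P i -> smooth_on A (f i)) -> smooth_on A (fun x => \sum_(i <- r | P i) f i x).
Proof. by move=> sf k; apply: Ck_sum => // i Pi; exact: sf. Qed.

Lemma smoothV (f : V -> R) : (forall x, A x -> f x != 0) ->
  smooth_on A f -> smooth_on A (fun x => (f x)^-1).
Proof. by move=> f0 sf k; exact: CkV. Qed.

Lemma smoothN (f : V -> R) : smooth_on A f -> smooth_on A (fun x => - f x).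
Proof.
move=> sf; under eq_fun do rewrite -mulN1r.
by apply: smoothM => //; exact: smooth_cst.
Qed.

Lemma smoothB (f g : V -> R) :
  smooth_on A f -> smooth_on A g -> smooth_on A (fun x => f x - g x).
Proof. by move=> sf sg; apply: smoothD => //; exact: smoothN. Qed.

Lemma smooth_entry m n (F : V -> 'M[R]_(m, n)) i j :
  smooth_on A F -> smooth_on A (fun x => F x i j).
Proof. by move=> sF k; exact: Ck_entry. Qed.

Lemma smooth_mx m n (F : V -> 'M[R]_(m, n)) :
  (forall i j, smooth_on A (fun x => F x i j)) -> smooth_on A F.
Proof. by move=> sF k; apply: Ck_mx => // i j; exact: sF. Qed.

Lemma smooth_invmx n (F : V -> 'M[R]_n) :
  (forall x, A x -> F x \in unitmx) ->
  smooth_on A F -> smooth_on A (fun x => invmx (F x)).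
Proof. by move=> uF sF k; exact: Ck_invmx. Qed.

Lemma smooth_comp n (B : set 'rV[R]_n) (F : V -> 'rV[R]_n) (g : 'rV[R]_n -> R) :
  (forall x, A x -> B (F x)) ->
  smooth_on A F -> smooth_on B g -> smooth_on A (g \o F).
Proof. by move=> AB sF sg k; exact: (Ck_comp oA AB). Qed.

Lemma smooth_comp_mx n m p (B : set 'rV[R]_n) (F : V -> 'rV[R]_n)
    (g : 'rV[R]_n -> 'M[R]_(m, p)) : open B ->
  (forall x, A x -> B (F x)) ->
  smooth_on A F -> smooth_on B g -> smooth_on A (g \o F).
Proof.
move=> oB AB sF sg; apply: smooth_mx => i j.
apply: (smooth_comp (g := fun y => g y i j) AB sF) => k; exact: Ck_entry.
Qed.

Lemma smooth_mulmx m n p (F : V -> 'M[R]_(m, n)) (G : V -> 'M[R]_(n, p)) :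
  smooth_on A F -> smooth_on A G -> smooth_on A (fun x => F x *m G x).
Proof.
move=> sF sG; apply: smooth_mx => i j; under eq_fun do rewrite mxE.
by apply: smooth_sum => k _; apply: smoothM; exact: smooth_entry.
Qed.

Lemma smooth_scale m n (f : V -> R) (F : V -> 'M[R]_(m, n)) :
  smooth_on A f -> smooth_on A F -> smooth_on A (fun x => f x *: F x).
Proof.
move=> sf sF; apply: smooth_mx => i j; under eq_fun do rewrite mxE.
by apply: smoothM => //; exact: smooth_entry.
Qed.

End Open.

Lemma is_derive_line V W (f : V -> W) (x u : V) (t : R) :
  differentiable f (x + t *: u) ->
  is_derive t 1 (fun s => f (x + s *: u)) ('D_u f (x + t *: u)).
Proof.
move=> df.
have dl : is_diff t (fun s : R => x + s *: u) ( *:%R^~ u).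
  by apply: is_diff_eq; rewrite add0r.
have dc : differentiable (f \o (fun s : R => x + s *: u)) t.
  by apply: differentiable_comp => //; exact: ex_diff.
apply: DeriveDef; first exact: diff_derivable.
by rewrite deriveE // diff_comp // ?diff_val /= ?scale1r ?deriveE.
Qed.

Lemma mulmxr_continuous m n p (M : 'M[R]_(n, p)) :
  continuous (fun v : 'M[R]_(m, n) => v *m M).
Proof.
have := @smooth_mulmx _ setT openT _ _ _ _ _ (@smooth_id 'M[R]_(m, n) setT)
  (@smooth_cst _ _ setT M).
by move=> /(_ 0%N) cM x; exact: cM.
Qed.

End CkCalculus.

(** * Mean value theorem, Schwarz theorem, inverse maps *)

Section Schwarz.
Context {R : realType}.
Implicit Types V W : normedModType R.

Lemma is_derive_lineB V (f : V -> R) (x w u : V) (t : R) :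
  differentiable f (x + w + t *: u) -> differentiable f (x + t *: u) ->
  is_derive t 1 (fun s => f (x + w + s *: u) - f (x + s *: u))
    ('D_u f (x + w + t *: u) - 'D_u f (x + t *: u)).
Proof. by move=> df df'; apply: is_deriveB; exact: is_derive_line. Qed.

Lemma MVT_smooth (f df : R -> R) (h : R) : 0 < h ->
  (forall t, 0 <= t <= h -> is_derive t 1 f (df t)) ->
  exists2 t, 0 <= t <= h & f h - f 0 = df t * h.
Proof.
move=> h0 dfE.
have [||t] := @MVT_segment R f df 0 h (ltW h0).
- by move=> t /itvP th; apply: dfE; rewrite !th.
- apply: derivable_within_continuous => t /itvP th.
  by have [] := dfE t; rewrite ?th.
- by rewrite in_itv /= subr0; exists t.
Qed.

(** Mean value theorem twice: in direction [u] for the difference of [f] along two parallel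
    segments, then in direction [v] for ['D_u f]. Up to regrouping, the left side is symmetric in
    [u] and [v]. *)
Lemma second_difference V (f : V -> R) (N : set V) (x u v : V) (h : R) : 0 < h ->
  (forall s t, 0 <= s <= h -> 0 <= t <= h -> N (x + s *: u + t *: v)) ->
  (forall y, N y -> differentiable f y) ->
  (forall y, N y -> differentiable ('D_u f) y) ->
  exists2 y, N y & f (x + h *: v + h *: u) - f (x + h *: u) - (f (x + h *: v) - f x) =
                   'D_v ('D_u f) y * h * h.
Proof.
move=> h0 Nx df dDf.
have hh : 0 <= h <= h by rewrite lexx ltW.
have h00 : 0 <= (0 : R) <= h by rewrite lexx ltW.
have Nx0 s : 0 <= s <= h -> N (x + s *: u).
  by move=> sh; have := Nx s 0 sh h00; rewrite scale0r addr0.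
have Nxh s : 0 <= s <= h -> N (x + h *: v + s *: u).
  by move=> sh; rewrite addrAC; exact: Nx.
have [s sh] := @MVT_smooth (fun s => f (x + h *: v + s *: u) - f (x + s *: u)) _ h h0
  (fun s sh => is_derive_lineB (df _ (Nxh s sh)) (df _ (Nx0 s sh))).
rewrite !scale0r !addr0 => ->.
have [t th] := @MVT_smooth (fun t => 'D_u f (x + s *: u + t *: v)) _ h h0
  (fun t th => is_derive_line (dDf _ (Nx s t sh th))).
rewrite scale0r addr0 [x + _ + _]addrAC => ->.
by exists (x + s *: u + t *: v); [exact: Nx|].
Qed.

Lemma normB_le_split (a b c c' e : R) :
  `|b - c| < e / 2 -> `|a - c'| < e / 2 -> c = c' -> `|a - b| <= e.
Proof.
move=> bc ac cE; rewrite -cE in ac; rewrite (_ : a - b = (a - c) - (b - c)); last by ring.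
by rewrite (le_trans (ler_normB _ _)) // [e]splitr lerD // ltW.
Qed.

(** One second difference is evaluated in both orders. This gives equal values of the two mixed
    derivatives at two nearby points, and continuity brings both points back to [x]. *)
Lemma schwarz V (A : set V) (f : V -> R) (x u v : V) : open A -> A x ->
  smooth_on A f -> 'D_u ('D_v f) x = 'D_v ('D_u f) x.
Proof.
move=> oA Ax sf; apply/eqP; rewrite -subr_eq0 -normr_le0; apply/ler_addgt0Pr => e e0.
rewrite add0r.
have e2 : 0 < e / 2 by rewrite divr_gt0.
have nc w z : \forall y \near x, `|'D_w ('D_z f) x - 'D_w ('D_z f) y| < e / 2.
  have := smooth_continuous (smooth_derive w (smooth_derive z sf)) Ax.
  by move=> /cvgrPdist_lt /(_ _ e2).
have nA : \forall y \near x, A y by exact: open_nbhs_nbhs.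
pose N := [set y | [/\ A y, `|'D_u ('D_v f) x - 'D_u ('D_v f) y| < e / 2 &
                   `|'D_v ('D_u f) x - 'D_v ('D_u f) y| < e / 2]].
have nN : \forall y \near x, N y.
  by apply: filterS3 nA (nc u v) (nc v u) => y *; split.
have /nbhs_ballP[d /= d0 dN] := nN.
pose k := `|u| + `|v| + 1.
have k0 : 0 < k by rewrite ltr_wpDl ?addr_ge0.
(* The parallelogram of sides [h *: u] and [h *: v] stays within [h * k = d / 2] of [x]; the summand
   1 in [k] excludes a division by zero. *)
pose h := d / 2 / k.
have h0 : 0 < h by rewrite !divr_gt0.
have Nh s t : 0 <= s <= h -> 0 <= t <= h -> N (x + s *: u + t *: v).
  move=> /andP[s0 sh] /andP[t0 th]; apply: dN; rewrite -ball_normE /= -addrA opprD addrA subrr sub0r normrN.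
  rewrite (le_lt_trans (ler_normD _ _)) // !normrZ !ger0_norm //.
  rewrite (@le_lt_trans _ _ (h * `|u| + h * `|v|)) ?lerD ?ler_wpM2r //.
  rewrite -mulrDr (@lt_trans _ _ (h * k)) // ?ltr_pM2l // ?ltrDl //.
  by rewrite divfK ?gt_eqF // ltr_pdivrMr // ltr_pMr // ltr1n.
have Nh' s t : 0 <= s <= h -> 0 <= t <= h -> N (x + s *: v + t *: u).
  by move=> *; rewrite addrAC; exact: Nh.
have df y : N y -> differentiable f y by move=> [Ay _ _]; exact: smooth_differentiable Ay.
have dDf w y : N y -> differentiable ('D_w f) y.
  by move=> [Ay _ _]; exact: (smooth_differentiable (smooth_derive w sf)) Ay.
have [y Ny yE] := second_difference h0 Nh df (dDf u).
have [z Nz zE] := second_difference h0 Nh' df (dDf v).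
have hN0 : h != 0 by rewrite gt_eqF.
have yz : 'D_v ('D_u f) y = 'D_u ('D_v f) z.
  have swap (a b c e' : R) : a - b - (c - e') = a - c - (b - e') by ring.
  apply: (mulIf hN0); apply: (mulIf hN0).
  by apply: etrans (esym yE) (etrans _ zE); rewrite (addrAC x (h *: v)); exact: swap.
move: Ny Nz => [_ _ Ny] [_ Nz _].
exact: normB_le_split Ny Nz yz.
Unshelve. all: by end_near. Qed.

End Schwarz.

(** * Regularity of a continuous inverse that is already given *)

Section SmoothInverse.
Context {R : realType} {n : nat}.
Variables (A B : set 'rV[R]_n) (F G : 'rV[R]_n -> 'rV[R]_n).
Hypotheses (oA : open A) (oB : open B) (sF : smooth_on A F).
Hypotheses (GA : forall y, B y -> A (G y)) (FG : forall y, B y -> F (G y) = y).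
Hypothesis cG : forall y, B y -> {for y, continuous G}.
Hypothesis uF : forall x, A x -> 'J F x \in unitmx.

(** With [k = G (y + h) - G y], differentiability of [F] says that [h] is close to [k *m 'J F].
    Applying the inverse Jacobian bounds [k] linearly by [h], and the error becomes small relative
    to [h]. *)
Lemma is_diff_inverse y : B y -> is_diff y G (mulmxr (invmx ('J F (G y)))).
Proof.
move=> By; set x := G y; set K := invmx _.
have Ax : A x by exact: GA.
have cK : continuous (mulmxr K : 'rV[R]_n -> 'rV[R]_n) by exact: mulmxr_continuous.
have dF := smooth_differentiable sF Ax.
have [C C0 CE] := linear_lipschitz cK.
apply: is_diff_near => // e e0.
(* The first bound lets half of the norm of [k] be absorbed, so that [k] is at most [2 * C] times
   [h] in norm. The second turns the resulting error [C * e' * (2 * C)] into at most [e]. *)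
pose e' := Num.min (2^-1 / C) (e / (C * C * 2)).
have e'0 : 0 < e' by rewrite lt_min !divr_gt0 // !mulr_gt0.
have nF := differentiable_near dF e'0.
have tG : (fun h => G (h + y) - x) @ (0 : 'rV[R]_n) --> (0 : 'rV[R]_n).
  have cGs : (G \o shift y) h @[h --> (0 : 'rV[R]_n)] --> x.
    by rewrite cvg_comp_shift add0r; exact: cG.
  rewrite -[X in _ --> X](subrr x); apply: (@cvgB _ _ _ (nbhs (0 : 'rV[R]_n)) _ (fun h => G (h + y)) (cst x)).
    exact: cGs.
  exact: cvg_cst.
have nB : \forall h \near (0 : 'rV[R]_n), B (h + y).
  have : \forall z \near y, B z by exact: open_nbhs_nbhs.
  by rewrite (near_shift 0) subr0.
have nk : \forall h \near (0 : 'rV[R]_n), `|F (G (h + y) - x + x) - F x -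
    'd F x (G (h + y) - x)| <= e' * `|G (h + y) - x|.
  exact: tG _ nF.
near=> h.
have Bh : B (h + y) by near: h.
pose k := G (h + y) - x.
have : `|F (k + x) - F x - 'd F x k| <= e' * `|k|.
  by rewrite /k; near: h.
rewrite subrK FG // FG // addrK -deriveE // deriveEjacobian // => hk.
have hkK : `|h *m K - k| <= C * (e' * `|k|).
  have -> : h *m K - k = mulmxr K (h - k *m 'J F x).
    by rewrite /= mulmxBl mulmxK // uF.
  by rewrite (le_trans (CE _)) // ler_pM2l.
have kh : `|k| <= 2 * C * `|h|.
  have hk2 : C * (e' * `|k|) <= 2^-1 * `|k|.
    rewrite mulrA ler_wpM2r // [C * _]mulrC -ler_pdivlMr //; by rewrite ge_min lexx.
  have : `|k| <= `|h *m K| + 2^-1 * `|k|.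
    rewrite -lerBlDl (le_trans (lerB_dist _ _)) // distrC.
    exact: le_trans hkK hk2.
  have := CE h => /=; lra.
rewrite -/k distrC (le_trans hkK) //.
have : e' <= e / (C * C * 2) by rewrite ge_min lexx orbT.
rewrite ler_pdivlMr ?mulr_gt0 // => ee.
rewrite (@le_trans _ _ (C * (e' * (2 * C * `|h|)))) //.
  by rewrite !ler_pM2l.
rewrite (_ : C * _ = e' * (C * C * 2) * `|h|); last by ring.
by rewrite ler_wpM2r.
Unshelve. all: by end_near. Qed.

Lemma derive_inverse y v : B y -> 'D_v G y = v *m invmx ('J F (G y)).
Proof. by move=> /is_diff_inverse dG; rewrite deriveE ?diff_val. Qed.

Lemma smooth_jacobian : smooth_on A (fun x => 'J F x).
Proof.
apply: smooth_mx => // i j.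
have : smooth_on A (fun x => ('D_(delta_mx 0 i) F x) 0 j).
  by apply: smooth_entry => //; exact: smooth_derive.
apply: smooth_ext => // x; rewrite inE => Ax.
rewrite deriveEjacobian; last exact: smooth_differentiable Ax.
by rewrite -rowE mxE.
Qed.

(** Bootstrap: by [derive_inverse] the derivative of [G] is a smooth function composed with [G], so
    it has the class already known for [G]. *)
Lemma smooth_inverse : smooth_on B G.
Proof.
elim=> [|k IH]; first exact: cG.
split=> [y By|v]; first by have [] := is_diff_inverse By.
have uJ x : A x -> 'J F x \in unitmx by exact: uF.
have sJ := smooth_invmx oA uJ smooth_jacobian.
have : Ck_on k B (fun y => v *m invmx ('J F (G y))).
  apply: Ck_mx => // i j; under eq_fun do rewrite mxE.
  apply: Ck_sum => // l _; apply: CkM => //; first exact: Ck_cst.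
  apply: (Ck_comp (g := fun x => invmx ('J F x) l j) oB GA IH).
  by apply: Ck_entry => //; exact: sJ.
by apply: Ck_ext => // y; rewrite inE => By; rewrite derive_inverse.
Qed.

End SmoothInverse.

(** * Connection, curvature and their behaviour under pullback *)

Fact tensor_key : unit. Proof. exact: tt. Qed.

Section Tensor.
Context {R : realType} {d : nat}.
Local Notation V := 'rV[R]_d.
Implicit Types (A B : set V).

(* Locked: unification between distinct partial derivatives must not unfold them. *)
Definition mxpartial_def m n (k : 'I_d) (F : V -> 'M[R]_(m, n)) (y : V) : 'M[R]_(m, n) :=
  \matrix_(i, j) partial k (fun z => F z i j) y.
Definition mxpartial m n := locked_with tensor_key (@mxpartial_def m n).

Lemma mxpartialE m n k (F : V -> 'M[R]_(m, n)) y i j :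
  mxpartial k F y i j = partial k (fun z => F z i j) y.
Proof. by rewrite /mxpartial unlock mxE. Qed.

Lemma partial_derivable A (f : V -> R) x k : smooth_on A f -> A x ->
  derivable f x (delta_mx 0 k).
Proof. by move=> sf Ax; apply: diff_derivable; exact: smooth_differentiable Ax. Qed.

Lemma smooth_partial A (f : V -> R) k : smooth_on A f -> smooth_on A (partial k f).
Proof. exact: smooth_derive. Qed.

Lemma smooth_mxpartial A m n k (F : V -> 'M[R]_(m, n)) : open A ->
  smooth_on A F -> smooth_on A (mxpartial k F).
Proof.
move=> oA sF; apply: smooth_mx => // i j; under eq_fun do rewrite mxpartialE.
by apply: smooth_partial; exact: smooth_entry.
Qed.

Lemma partialD A (f g : V -> R) k x : smooth_on A f -> smooth_on A g -> A x ->
  partial k (fun z => f z + g z) x = partial k f x + partial k g x.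
Proof. by move=> sf sg Ax; apply: deriveD; exact: partial_derivable Ax. Qed.

Lemma partialM A (f g : V -> R) k x : smooth_on A f -> smooth_on A g -> A x ->
  partial k (fun z => f z * g z) x = partial k f x * g x + f x * partial k g x.
Proof.
move=> sf sg Ax; rewrite /partial deriveM; try exact: partial_derivable Ax.
by rewrite addrC /GRing.scale /= [g x * _]mulrC.
Qed.

Lemma partial_sum A (I : Type) (r : seq I) (P : pred I) (f : I -> V -> R) k x : open A ->
  (forall i, smooth_on A (f i)) -> A x ->
  partial k (fun z => \sum_(i <- r | P i) f i z) x = \sum_(i <- r | P i) partial k (f i) x.
Proof.
move=> oA sf Ax; elim: r => [|i r IH].
  by under [in LHS]eq_fun do rewrite big_nil; rewrite big_nil /partial derive_cst.
have [Pi|Pi] := boolP (P i); last first.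
  by under [in LHS]eq_fun do rewrite big_cons (negPf Pi); rewrite big_cons (negPf Pi).
under [in LHS]eq_fun do rewrite big_cons Pi; rewrite big_cons Pi -IH.
by apply: (partialD (A := A)) => //; apply: smooth_sum.
Qed.

Lemma near_eq_partial (f g : V -> R) k x :
  (\near x, f x = g x) -> partial k f x = partial k g x.
Proof. exact: near_eq_derive. Qed.

Lemma partialC A (f : V -> R) k l x : open A -> A x -> smooth_on A f ->
  partial k (partial l f) x = partial l (partial k f) x.
Proof. exact: schwarz. Qed.

Lemma mxpartialD A m n k (F G : V -> 'M[R]_(m, n)) x : open A ->
  smooth_on A F -> smooth_on A G -> A x ->
  mxpartial k (fun z => F z + G z) x = mxpartial k F x + mxpartial k G x.
Proof.
move=> oA sF sG Ax; apply/matrixP => i j; rewrite mxE !mxpartialE.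
under [in LHS]eq_fun do rewrite mxE.
by apply: (partialD (A := A)) => //; apply: smooth_entry.
Qed.

Lemma mxpartial_scale A m n k (f : V -> R) (F : V -> 'M[R]_(m, n)) x : open A ->
  smooth_on A f -> smooth_on A F -> A x ->
  mxpartial k (fun z => f z *: F z) x = partial k f x *: F x + f x *: mxpartial k F x.
Proof.
move=> oA sf sF Ax; apply/matrixP => i j; rewrite 3!mxE !mxpartialE.
under [in LHS]eq_fun do rewrite mxE.
by rewrite (partialM (A := A)) //; apply: smooth_entry.
Qed.

Lemma mxpartialM A m n p k (F : V -> 'M[R]_(m, n)) (G : V -> 'M[R]_(n, p)) x : open A ->
  smooth_on A F -> smooth_on A G -> A x ->
  mxpartial k (fun z => F z *m G z) x = mxpartial k F x *m G x + F x *m mxpartial k G x.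
Proof.
move=> oA sF sG Ax; apply/matrixP => i j; rewrite mxpartialE 3!mxE.
under [in LHS]eq_fun do rewrite mxE.
rewrite (partial_sum (A := A)) //; last first.
  by move=> l; apply: smoothM => //; apply: smooth_entry.
rewrite -big_split; apply: eq_bigr => l _; rewrite !mxpartialE.
by rewrite (partialM (A := A)) //; apply: smooth_entry.
Qed.

Lemma mxpartial_sum A m n k (I : Type) (r : seq I) (P : pred I)
    (F : I -> V -> 'M[R]_(m, n)) x : open A -> (forall i, smooth_on A (F i)) -> A x ->
  mxpartial k (fun z => \sum_(i <- r | P i) F i z) x =
  \sum_(i <- r | P i) mxpartial k (F i) x.
Proof.
move=> oA sF Ax; apply/matrixP => i j; rewrite summxE mxpartialE.
under [in LHS]eq_fun do rewrite summxE.
rewrite (partial_sum (A := A)) //; first by apply: eq_bigr => l _; rewrite mxpartialE.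
by move=> l; exact: smooth_entry.
Qed.

Lemma mxpartialT m n k (F : V -> 'M[R]_(m, n)) x :
  mxpartial k (fun z => (F z)^T) x = (mxpartial k F x)^T.
Proof. by apply/matrixP => i j; rewrite mxE !mxpartialE; under [in LHS]eq_fun do rewrite mxE. Qed.

Lemma smooth_trmx A m n (F : V -> 'M[R]_(m, n)) : open A ->
  smooth_on A F -> smooth_on A (fun z => (F z)^T).
Proof.
move=> oA sF; apply: smooth_mx => // i j; under eq_fun do rewrite mxE.
exact: smooth_entry.
Qed.

Lemma jacobianE (F : V -> V) x i j : differentiable F x ->
  'J F x i j = partial i (fun z => F z 0 j) x.
Proof.
move=> dF; rewrite /partial -derive_entry // deriveEjacobian //.
by rewrite -rowE [RHS]mxE.
Qed.

Lemma mxpartial_comp A B m n k (F : V -> V) (G : V -> 'M[R]_(m, n)) x : open A -> open B ->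
  (forall x, A x -> B (F x)) -> smooth_on A F -> smooth_on B G -> A x ->
  mxpartial k (fun z => G (F z)) x = \sum_(l < d) 'J F x k l *: mxpartial l G (F x).
Proof.
move=> oA oB AB sF sG Ax; apply/matrixP => i j; rewrite summxE mxpartialE.
have dF := smooth_differentiable sF Ax.
rewrite /partial (derive_comp_rV (g := fun y => G y i j)) //; last first.
  by apply: differentiable_entry; apply: smooth_differentiable sG (AB _ Ax).
by apply: eq_bigr => l _; rewrite [RHS]mxE mxpartialE jacobianE.
Qed.

Lemma mxpartialC A m n k l (F : V -> 'M[R]_(m, n)) x : open A -> smooth_on A F -> A x ->
  mxpartial k (mxpartial l F) x = mxpartial l (mxpartial k F) x.
Proof.
move=> oA sF Ax; apply/matrixP => i j; rewrite !mxpartialE.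
have -> : (fun z => mxpartial l F z i j) = partial l (fun z => F z i j).
  by apply/funext => z; rewrite mxpartialE.
have -> : (fun z => mxpartial k F z i j) = partial k (fun z => F z i j).
  by apply/funext => z; rewrite mxpartialE.
by apply: (partialC _ _ oA Ax); exact: smooth_entry.
Qed.

Lemma eq_mxpartial A m n k (F G : V -> 'M[R]_(m, n)) x : open A -> A x ->
  {in A, F =1 G} -> mxpartial k F x = mxpartial k G x.
Proof.
move=> oA Ax FG; apply/matrixP => i j; rewrite !mxpartialE; apply: near_eq_partial.
by apply: filterS (open_near_eq oA FG Ax) => y ->.
Qed.

(* [conn G k y] is the matrix in row i, column l of the Christoffel symbols Gamma^l_ik. *)
Definition conn_def (G : V -> 'M[R]_d) (k : 'I_d) (y : V) : 'M[R]_d :=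
  \matrix_(i, l) christoffel G l i k y.
Definition conn := locked_with tensor_key conn_def.

Lemma connE G k y i l : conn G k y i l = christoffel G l i k y.
Proof. by rewrite /conn unlock mxE. Qed.

(** Torsion-freeness: row [i] of the [k]-th matrix holds the symbols with lower indices [i] and
    [k]. *)
Definition conn_sym (T : 'I_d -> 'M[R]_d) := forall k, forall i, row i (T k) = row k (T i).

(** The metric is parallel; [T k *m G y] is the [k]-th connection matrix with its upper index
    lowered. *)
Definition conn_compat (G : V -> 'M[R]_d) (y : V) (T : 'I_d -> 'M[R]_d) :=
  forall k, mxpartial k G y = T k *m G y + (T k *m G y)^T.


(** Uniqueness of the Levi-Civita connection at one point. In the three-term combination defining
    the Christoffel symbols, torsion-freeness makes all but one product cancel. Later formulas for
    [conn] are proved by checking the two hypotheses on a candidate. *)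
Lemma koszul (G : V -> 'M[R]_d) y (T : 'I_d -> 'M[R]_d) : G y \in unitmx ->
  (G y)^T = G y -> conn_sym T -> conn_compat G y T -> forall k, conn G k y = T k.
Proof.
move=> uG GT sT cT k; rewrite -[T k](mulmxK uG); apply/matrixP => i l.
rewrite connE [RHS]mxE /christoffel mulr_sumr; apply: eq_bigr => m _.
have tS a b c : (T a *m G y) b c = (T b *m G y) a c.
  have : row b (T a *m G y) = row a (T b *m G y) by rewrite !row_mul sT.
  by move=> /rowP/(_ c); rewrite [LHS]mxE [X in _ = X -> _]mxE.
have dG a b c : partial a (fun z => G z b c) y = (T a *m G y) b c + (T a *m G y) c b.
  transitivity (mxpartial a G y b c); first by rewrite mxpartialE.
  by rewrite cT [LHS]mxE [X in _ + X]mxE.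
rewrite !dG (tS k m i) (tS i k m) (tS i m k).
have -> : invmx (G y) m l = invmx (G y) l m by rewrite -{1}GT -trmx_inv mxE.
have R6 (a b c e : R) : 2^-1 * (e * (a + b + (a + c) - (b + c))) = a * e by field.
exact: R6.
Qed.

Lemma conn_symE (G : V -> 'M[R]_d) A y : open A -> A y ->
  (forall z, A z -> (G z)^T = G z) -> conn_sym (conn G ^~ y).
Proof.
move=> oA Ay GT k i; apply/rowP => l; rewrite 2!mxE !connE /christoffel; congr (_ * _).
apply: eq_bigr => m _; congr (_ * _).
have GTp c : partial c (fun z => G z k i) y = partial c (fun z => G z i k) y.
  apply: near_eq_partial; apply: filterS (open_nbhs_nbhs (conj oA Ay)) => z Az.
  by rewrite -{1}(GT z) // mxE.
by rewrite GTp [X in X - _]addrC.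
Qed.

(** The existence half that matches [koszul]: [S] contains the symbols with lowered upper index, and
    its symmetrisation leaves just the derivative of the metric. *)
Lemma conn_compatE (G : V -> 'M[R]_d) A y : open A -> A y ->
  (forall z, A z -> (G z)^T = G z) -> G y \in unitmx -> conn_compat G y (conn G ^~ y).
Proof.
move=> oA Ay GT uG k.
have GTp c a b : partial c (fun z => G z a b) y = partial c (fun z => G z b a) y.
  apply: near_eq_partial; apply: filterS (open_nbhs_nbhs (conj oA Ay)) => z Az.
  by rewrite -{1}(GT z) // mxE.
pose S : 'M[R]_d := \matrix_(i, m) (2^-1 * (partial i (fun z => G z k m) y +
  partial k (fun z => G z i m) y - partial m (fun z => G z i k) y)).
have -> : conn G k y *m G y = S.
  have -> : conn G k y = S *m invmx (G y); last by rewrite mulmxKV.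
  apply/matrixP => i l; rewrite connE [RHS]mxE /christoffel mulr_sumr.
  apply: eq_bigr => m _; rewrite [S _ _]mxE.
  have -> : invmx (G y) m l = invmx (G y) l m by rewrite -{1}(GT _ Ay) -trmx_inv mxE.
  by rewrite mulrCA mulrC.
apply/matrixP => i j; rewrite mxpartialE !mxE (GTp k j i) (GTp j k i) (GTp i k j).
set a := partial _ _ _; set b := partial _ _ _; set c := partial _ _ _.
by field.
Qed.

Lemma smooth_christoffel A (G : V -> 'M[R]_d) l i k : open A ->
  (forall z, A z -> G z \in unitmx) -> smooth_on A G -> smooth_on A (christoffel G l i k).
Proof.
move=> oA uG sG; apply: smoothM => //; first exact: smooth_cst.
apply: smooth_sum => // m _; apply: smoothM => //.
  by apply: smooth_entry => //; exact: smooth_invmx.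
apply: smoothB => //; first apply: smoothD => //.
all: by apply: smooth_partial; exact: smooth_entry.
Qed.

Lemma smooth_conn A (G : V -> 'M[R]_d) k : open A ->
  (forall z, A z -> G z \in unitmx) -> smooth_on A G -> smooth_on A (conn G k).
Proof.
move=> oA uG sG; apply: smooth_mx => // i j; under eq_fun do rewrite connE.
exact: smooth_christoffel.
Qed.

(* Curvature of the connection: entry (i, l) is R^l_i,kj. *)
Definition riem (G : V -> 'M[R]_d) (k j : 'I_d) (y : V) : 'M[R]_d :=
  mxpartial k (conn G j) y - mxpartial j (conn G k) y
  + (conn G j y *m conn G k y - conn G k y *m conn G j y).

Lemma mxpartial_conn (G : V -> 'M[R]_d) k j i l y :
  mxpartial k (conn G j) y i l = partial k (christoffel G l i j) y.
Proof.
rewrite mxpartialE; have -> // : (fun z => conn G j z i l) = christoffel G l i j.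
by apply/funext => z; rewrite connE.
Qed.

(** [ricci] is written in indices and [riem] in matrices; the symmetry of the lower indices
    reconciles the quadratic terms. *)
Lemma ricciE (G : V -> 'M[R]_d) i j y : conn_sym (conn G ^~ y) ->
  ricci G i j y = \sum_(k < d) riem G k j y i k.
Proof.
move=> sG.
have chr a b c : christoffel G a b c y = conn G c y b a by rewrite connE.
have symG a b c : conn G a y b c = conn G b y a c.
  by have /rowP/(_ c) := sG a b; rewrite [LHS]mxE [X in _ = X -> _]mxE.
apply: eq_bigr => k _; rewrite /riem [RHS]mxE; congr (_ + _).
  rewrite [RHS]mxE [X in _ = _ + X]mxE.
  by rewrite (mxpartial_conn G k j i k y) (mxpartial_conn G j k i k y).
rewrite [RHS]mxE [X in _ = _ + X]mxE [X in _ = X - _]mxE [X in _ = _ - X]mxE -sumrB.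
apply: eq_bigr => l _; rewrite !chr (symG l k k) (symG l j k).
by rewrite [X in X - _]mulrC [X in _ - X]mulrC.
Qed.

Definition scal (G : V -> 'M[R]_d) (y : V) : R :=
  \sum_(i < d) \sum_(j < d) invmx (G y) i j * ricci G i j y.

(** Here [J] stands for a Jacobian, [P k] for its [k]-th derivative and [K] for its inverse, so the
    matrices are those of a transformed connection. The hypothesis on [P] is the symmetry of second
    derivatives. *)
Lemma gauge_sym (P C : 'I_d -> 'M[R]_d) (J K : 'M[R]_d) :
  (forall i j l, P i j l = P j i l) -> conn_sym C ->
  conn_sym (fun k => (P k + J *m \sum_(g < d) J k g *: C g) *m K).
Proof.
move=> sP sC i j; rewrite !row_mul; congr (_ *m _).
have E a b : row a (P b + J *m \sum_(g < d) J b g *: C g) = row a (P b) +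
    \sum_(g < d) \sum_(l < d) (J b g * J a l) *: row l (C g).
  rewrite linearD /= row_mul mulmx_sumr; congr (_ + _); apply: eq_bigr => g _.
  rewrite -scalemxAr mulmx_sum_row scaler_sumr.
  by apply: eq_bigr => l _; rewrite scalerA [row _ _ _ _]mxE.
rewrite !E exchange_big; congr (_ + _).
  by apply/rowP => l; rewrite [LHS]mxE [RHS]mxE sP.
by apply: eq_bigr => g _; apply: eq_bigr => l _; rewrite mulrC sC.
Qed.

(** The left side is the product rule for [J *m G *m J^T], with [P] the derivative of [J] and [A] a
    metric connection for [G]. *)
Lemma gauge_compat (P J A G : 'M[R]_d) : G^T = G ->
  (P *m G + J *m (A *m G + (A *m G)^T)) *m J^T + J *m G *m P^T =
  (P + J *m A) *m G *m J^T + ((P + J *m A) *m G *m J^T)^T.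
Proof.
move=> GT; rewrite !(trmx_mul, trmxK, GT, linearD) /= !(mulmxDl, mulmxDr, trmx_mul).
by rewrite !mulmxA -!addrA; congr (_ + (_ + _)); exact: addrC.
Qed.

(** Tensoriality of curvature as pure algebra: [dk] and [di] stand for the [k]-derivative of [ai]
    and the [i]-derivative of [ak], and the last two hypotheses are the derivatives of the
    transformation law. In the antisymmetric combination [ddJ] and all terms with [dkJ] or [diJ]
    cancel. *)
Lemma gauge_curv (dk di ak ai J dkJ diJ ddJ a'k a'i dk' di' : 'M[R]_d) :
  ak *m J = dkJ + J *m a'k -> ai *m J = diJ + J *m a'i ->
  dk *m J + ai *m dkJ = ddJ + (dkJ *m a'i + J *m dk') ->
  di *m J + ak *m diJ = ddJ + (diJ *m a'k + J *m di') ->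
  (dk - di + (ai *m ak - ak *m ai)) *m J = J *m (dk' - di' + (a'i *m a'k - a'k *m a'i)).
Proof.
move=> ek ei Ek Ei.
have {}Ek : dk *m J = ddJ + (dkJ *m a'i + J *m dk') - ai *m dkJ by rewrite -Ek addrK.
have {}Ei : di *m J = ddJ + (diJ *m a'k + J *m di') - ak *m diJ by rewrite -Ei addrK.
rewrite !(mulmxDl, mulmxBl, mulmxDr, mulmxBr, mulNmx, mulmxN) Ek Ei -!mulmxA ek ei !mulmxDr.
rewrite [ai *m (J *m _)]mulmxA ei [ak *m (J *m _)]mulmxA ek !mulmxDl -!mulmxA.
move: (ai *m dkJ) (ak *m diJ) (dkJ *m a'i) (diJ *m a'k) (J *m dk') (J *m di')
  (J *m (a'i *m a'k)) (J *m (a'k *m a'i)) => x1 x2 x3 x4 x5 x6 x7 x8.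
by apply/matrixP => i j; rewrite !mxE; ring.
Qed.

Lemma mul_sum_scale (a b : 'I_d -> R) (C : 'I_d -> 'M[R]_d) :
  (\sum_(g < d) a g *: C g) *m (\sum_(g < d) b g *: C g) =
  \sum_(g < d) \sum_(h < d) (a g * b h) *: (C g *m C h).
Proof.
rewrite mulmx_suml; apply: eq_bigr => g _; rewrite mulmx_sumr.
by apply: eq_bigr => h _; rewrite -scalemxAl -scalemxAr scalerA.
Qed.

Section ChangeOfCoordinates.
Variables (A B : set V) (F : V -> V) (G Gt : V -> 'M[R]_d).
Hypotheses (oA : open A) (oB : open B) (AB : forall x, A x -> B (F x)).
Hypotheses (sF : smooth_on A F) (uF : forall x, A x -> 'J F x \in unitmx).
Hypotheses (sG : smooth_on B G) (GT : forall z, B z -> (G z)^T = G z).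
Hypothesis (uG : forall z, B z -> G z \in unitmx).
Hypothesis GtE : {in A, Gt =1 fun x => 'J F x *m G (F x) *m ('J F x)^T}.

Let sJ : smooth_on A (fun x => 'J F x) := smooth_jacobian oA sF.

Lemma pullback_sym z : A z -> (Gt z)^T = Gt z.
Proof.
by move=> Az; rewrite GtE ?inE // !trmx_mul trmxK GT ?mulmxA //; exact: AB.
Qed.

Lemma pullback_unit z : A z -> Gt z \in unitmx.
Proof.
move=> Az; rewrite GtE ?inE // !unitmx_mul unitmx_tr uF // uG //; exact: AB.
Qed.

Let sGF : smooth_on A (fun x => G (F x)).
Proof. exact: (smooth_comp_mx (g := G) oA oB AB). Qed.

Lemma pullback_smooth : smooth_on A Gt.
Proof.
have : smooth_on A (fun x => 'J F x *m G (F x) *m ('J F x)^T).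
  by do 2?[apply: smooth_mulmx => //]; exact: smooth_trmx.
by apply: smooth_ext => // x Ax; rewrite GtE.
Qed.

Lemma partial_jacobianC k i j y : A y ->
  partial k (fun z => 'J F z i j) y = partial i (fun z => 'J F z k j) y.
Proof.
move=> Ay.
have JE l : \near y, 'J F y l j = partial l (fun z => F z 0 j) y.
  apply: filterS (open_nbhs_nbhs (conj oA Ay)) => z Az.
  by apply: jacobianE; exact: smooth_differentiable Az.
transitivity (partial k (partial i (fun z => F z 0 j)) y).
  exact: near_eq_partial.
transitivity (partial i (partial k (fun z => F z 0 j)) y).
  by apply: (partialC _ _ oA Ay); exact: smooth_entry.
by apply/esym; exact: near_eq_partial.
Qed.

(** The pullback by [F] of the connection form of [G]. *)
Let Ap (k : 'I_d) (x : V) : 'M[R]_d := \sum_(g < d) 'J F x k g *: conn G g (F x).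

Let sAp k : smooth_on A (Ap k).
Proof.
apply: smooth_sum => // g _; apply: smooth_scale => //; first exact: smooth_entry.
by apply: (smooth_comp_mx oA oB AB sF (g := conn G g)); exact: smooth_conn.
Qed.

(** The candidate [N k *m invmx ('J F y)] passes the test of [koszul] by [gauge_sym] and
    [gauge_compat]. The statement keeps the Jacobian on the left instead of an inverse, ready to be
    differentiated again. *)
Lemma conn_pullback k y : A y ->
  conn Gt k y *m 'J F y = mxpartial k (fun x => 'J F x) y + 'J F y *m Ap k y.
Proof.
move=> Ay; have By := AB Ay.
pose N k := mxpartial k (fun x => 'J F x) y + 'J F y *m Ap k y.
have uJ := uF Ay.
suff -> : conn Gt k y = N k *m invmx ('J F y) by rewrite mulmxKV.
have uGt := pullback_unit Ay.
apply: (koszul (T := fun k => N k *m invmx ('J F y))) => //; first exact: pullback_sym.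
  apply: gauge_sym => [i j l|]; last exact: conn_symE oB By GT.
  by rewrite !mxpartialE; exact: partial_jacobianC.
move=> l.
have GtyE : Gt y = 'J F y *m G (F y) *m ('J F y)^T by rewrite GtE ?inE.
have -> : N l *m invmx ('J F y) *m Gt y = N l *m G (F y) *m ('J F y)^T.
  by rewrite GtyE !mulmxA mulmxKV.
rewrite (eq_mxpartial _ oA Ay GtE).
have sJG : smooth_on A (fun x => 'J F x *m G (F x)) by exact: smooth_mulmx.
rewrite (mxpartialM (A := A)) //; last exact: smooth_trmx.
rewrite (mxpartialM (A := A)) // mxpartialT (mxpartial_comp (A := A) (B := B)) //.
have -> : \sum_(g < d) 'J F y l g *: mxpartial g G (F y) =
    Ap l y *m G (F y) + (Ap l y *m G (F y))^T.
  rewrite [Ap l y in X in X + _]/Ap mulmx_suml linear_sum -big_split.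
  apply: eq_bigr => g _; rewrite (conn_compatE oB By GT (uG By)) /=.
  by rewrite -scalemxAl linearZ /= scalerDr.
exact: gauge_compat (GT By).
Qed.

Lemma mxpartial_Ap k i y : A y -> mxpartial k (Ap i) y =
  \sum_(g < d) partial k (fun z => 'J F z i g) y *: conn G g (F y) +
  \sum_(g < d) \sum_(b < d) ('J F y i g * 'J F y k b) *: mxpartial b (conn G g) (F y).
Proof.
move=> Ay.
have sC g : smooth_on B (conn G g) by exact: smooth_conn.
have sCF g : smooth_on A (fun x => conn G g (F x)).
  exact: (smooth_comp_mx oA oB AB sF (sC g)).
have sJe g : smooth_on A (fun x => 'J F x i g) by exact: smooth_entry.
rewrite (mxpartial_sum (A := A)) //; last by move=> g; exact: smooth_scale.
rewrite -big_split; apply: eq_bigr => g _ /=.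
rewrite (mxpartial_scale (A := A)) //; congr (_ + _).
rewrite (mxpartial_comp (A := A) (B := B)) // scaler_sumr.
by apply: eq_bigr => b _; rewrite scalerA.
Qed.

(** Derivative of [conn_pullback], fed to [gauge_curv]. In the curl of [Ap] the terms with second
    derivatives of [F] are symmetric in [k] and [i] and drop out, so curvature is pulled back as a
    two-form. *)
Lemma riem_pullback k i y : A y ->
  riem Gt k i y *m 'J F y = 'J F y *m
    \sum_(g < d) \sum_(b < d) ('J F y k g * 'J F y i b) *: riem G g b (F y).
Proof.
move=> Ay.
have sGt := pullback_smooth.
have uGt := pullback_unit.
have sCt l : smooth_on A (conn Gt l) by exact: smooth_conn.
have dE a b : mxpartial a (conn Gt b) y *m 'J F y +
    conn Gt b y *m mxpartial a (fun x => 'J F x) y =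
    mxpartial a (mxpartial b (fun x => 'J F x)) y +
    (mxpartial a (fun x => 'J F x) y *m Ap b y + 'J F y *m mxpartial a (Ap b) y).
  rewrite -(mxpartialM (A := A)) //.
  rewrite (@eq_mxpartial A _ _ a _ (fun z => mxpartial b (fun x => 'J F x) z + 'J F z *m Ap b z)) //.
    rewrite (mxpartialD (A := A)) ?(mxpartialM (A := A)) //.
      exact: smooth_mxpartial.
    exact: smooth_mulmx.
  by move=> z; rewrite inE => Az; exact: conn_pullback.
have dE' := dE i k; rewrite (mxpartialC (A := A)) // in dE'.
rewrite /riem (gauge_curv (conn_pullback k Ay) (conn_pullback i Ay) (dE k i) dE').
congr (_ *m _).
have -> : mxpartial k (Ap i) y - mxpartial i (Ap k) y =
    \sum_(g < d) \sum_(b < d) ('J F y k g * 'J F y i b) *: mxpartial g (conn G b) (F y) -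
    \sum_(g < d) \sum_(b < d) ('J F y k g * 'J F y i b) *: mxpartial b (conn G g) (F y).
  rewrite (mxpartial_Ap k i Ay) (mxpartial_Ap i k Ay) opprD addrACA.
  have -> : \sum_(g < d) partial k (fun z => 'J F z i g) y *: conn G g (F y) =
      \sum_(g < d) partial i (fun z => 'J F z k g) y *: conn G g (F y).
    by apply: eq_bigr => g _; rewrite (partial_jacobianC k i g Ay).
  rewrite (subrr (\sum_(g < d) partial i (fun z => 'J F z k g) y *: conn G g (F y))) add0r.
  rewrite exchange_big; congr (_ - _).
  by apply: eq_bigr => g _; apply: eq_bigr => b _; rewrite mulrC.
have -> : Ap i y *m Ap k y = \sum_(g < d) \sum_(b < d)
    ('J F y k g * 'J F y i b) *: (conn G b (F y) *m conn G g (F y)).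
  rewrite [LHS]mul_sum_scale exchange_big.
  by apply: eq_bigr => g _; apply: eq_bigr => b _; rewrite mulrC.
rewrite [Ap k y *m Ap i y]mul_sum_scale -!sumrB -big_split; apply: eq_bigr => g _ /=.
rewrite -!sumrB -big_split; apply: eq_bigr => b _ /=.
by rewrite /riem -!scalerBr -scalerDr.
Qed.

Definition ricmx (H : V -> 'M[R]_d) y : 'M[R]_d := \matrix_(i, j) ricci H i j y.

(** In the contraction over [k], the form index carries a Jacobian and the endomorphism index its
    inverse. Summing over [k] first cancels them and leaves one Jacobian on each free index. *)
Lemma ricci_pullback y : A y ->
  ricmx Gt y = 'J F y *m ricmx G (F y) *m ('J F y)^T.
Proof.
move=> Ay; have uJ := uF Ay; have By := AB Ay.
have symt : conn_sym (conn Gt ^~ y) by exact: conn_symE oA Ay pullback_sym.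
have sym : conn_sym (conn G ^~ (F y)) by exact: conn_symE oB By GT.
have rE := fun k i => riem_pullback k i Ay; move: rE; set J := 'J F y => rE.
have {}rE k i : riem Gt k i y = J *m (\sum_(g < d) \sum_(b < d) (J k g * J i b) *: riem G g b (F y)) *m invmx J.
  by rewrite -(rE k i) mulmxK.
apply/matrixP => i j; rewrite [LHS]mxE (ricciE _ _ symt).
transitivity (\sum_(k < d) \sum_(g < d) \sum_(b < d) \sum_(c < d)
    J j b * J i c * (riem G g b (F y) *m invmx J) c k * J k g).
  apply: eq_bigr => k _; rewrite rE mulmx_sumr mulmx_suml summxE; apply: eq_bigr => g _.
  rewrite mulmx_sumr mulmx_suml summxE; apply: eq_bigr => b _.
  rewrite -scalemxAr -scalemxAl -mulmxA [LHS]mxE [X in _ * X]mxE mulr_sumr.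
  apply: eq_bigr => c _; move: (_ *m _) => X.
  by ring.
transitivity (\sum_(b < d) \sum_(c < d) J j b * J i c * \sum_(g < d) riem G g b (F y) c g).
  rewrite exchange_big; under eq_bigr do rewrite exchange_big.
  rewrite exchange_big /=; apply: eq_bigr => b _.
  under eq_bigr do rewrite exchange_big.
  rewrite exchange_big /=; apply: eq_bigr => c _.
  rewrite mulr_sumr; apply: eq_bigr => g _.
  have -> : riem G g b (F y) c g = (riem G g b (F y) *m invmx J *m J) c g.
    by rewrite mulmxKV.
  by rewrite [X in _ = _ * X]mxE mulr_sumr; apply: eq_bigr => k _; rewrite mulrA.
rewrite [RHS]mxE; apply: eq_bigr => b _.
rewrite [(J^T) _ _]mxE [X in _ = X * _]mxE mulr_suml; apply: eq_bigr => c _.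
by rewrite [ricmx _ _ _ _]mxE (ricciE _ _ sym) mulrAC mulrC [J i c * _]mulrC; ring.
Qed.

Lemma scalE (H : V -> 'M[R]_d) y : scal H y = \tr (invmx (H y) *m (ricmx H y)^T).
Proof.
apply: eq_bigr => i _; rewrite [RHS]mxE; apply: eq_bigr => j _.
by rewrite [(_^T) _ _]mxE [ricmx _ _ _ _]mxE.
Qed.

Lemma scal_pullback y : A y -> scal Gt y = scal G (F y).
Proof.
move=> Ay; rewrite !scalE ricci_pullback // GtE ?inE //.
have uJ := uF Ay; have uGy := uG (AB Ay).
move: ('J F y) (G (F y)) (ricmx G (F y)) uJ uGy => J g r uJ ug.
have -> : invmx (J *m g *m J^T) = (invmx J)^T *m invmx g *m invmx J.
  have uJT : J^T \in unitmx by rewrite unitmx_tr.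
  apply: (can_inj (mulmxK (_ : J *m g *m J^T \in unitmx))).
    by rewrite !unitmx_mul uJ ug.
  rewrite mulVmx ?unitmx_mul ?uJ ?ug //= -!mulmxA mulKmx // mulKmx // trmx_inv mulVmx //.
rewrite !trmx_mul trmxK -!mulmxA mulKmx // mxtrace_mulC -!mulmxA.
by rewrite trmx_inv mulmxV ?unitmx_tr // mulmx1.
Qed.

End ChangeOfCoordinates.
End Tensor.

(** * Conformal change of the scalar curvature *)

Lemma open_preimageI (T U : topologicalType) (A : set T) (f : T -> U) (B : set U) :
  open A -> (forall x, A x -> {for x, continuous f}) -> open B ->
  open (A `&` f @^-1` B).
Proof.
move=> oA cf oB; rewrite openE => x [Ax Bfx]; apply: filterI.
  exact: open_nbhs_nbhs.
by apply: (cf x Ax); exact: open_nbhs_nbhs.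
Qed.

Section Conformal.
Context {R : realType} {d : nat}.
Local Notation V := 'rV[R]_d.
Implicit Types (A B : set V).

Lemma sum_delta_col (v : V) : \sum_(k < d) v 0 k *: delta_mx k 0 = v^T :> 'cV[R]_d.
Proof.
rewrite {2}[v]row_sum_delta linear_sum /=; apply: eq_bigr => k _.
by rewrite linearZ /= trmx_delta.
Qed.

Lemma mul_delta_col (v : V) k : v *m delta_mx k (0 : 'I_1) = (v 0 k)%:M.
Proof. by rewrite -colE [LHS]mx11_scalar mxE. Qed.

(* [confE a G k] is, up to the factor -1/f, the change of the k-th connection
   matrix when the metric G is replaced by f^-2 G, where a = df. *)
Definition confE_def (a : V) (G : 'M[R]_d) (k : 'I_d) : 'M[R]_d :=
  a^T *m delta_mx 0 k + a 0 k *: 1%:M - (G *m delta_mx k 0) *m (a *m invmx G).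
Definition confE := locked_with tensor_key confE_def.

Lemma confEE (a : V) G k : confE a G k =
  a^T *m delta_mx 0 k + a 0 k *: 1%:M - (G *m delta_mx k 0) *m (a *m invmx G).
Proof. by rewrite /confE unlock. Qed.

Lemma confE_entry (a : V) G k i l : confE a G k i l =
  a 0 i * (l == k)%:R + a 0 k * (i == l)%:R - G i k * (a *m invmx G) 0 l.
Proof.
rewrite confEE.
have E1 : (a^T *m delta_mx 0 k) i l = a 0 i * (l == k)%:R by rewrite mxE big_ord1 !mxE eqxx.
have E2 : ((G *m delta_mx k 0) *m (a *m invmx G)) i l = G i k * (a *m invmx G) 0 l.
  by rewrite mxE big_ord1 -colE mxE.
by rewrite mxE [X in X + _]mxE [X in _ + X]mxE E1 E2; congr (_ + _ - _); rewrite !mxE.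
Qed.

(** * Pointwise algebra of the conformal change *)

Section Algebra.
Variables (a : V) (G : 'M[R]_d).
Hypotheses (uG : G \in unitmx) (GT : G^T = G).
Let E := confE a G.
(** The covector [a] with its index raised; [n] is then the squared norm of [a]. *)
Let g := a *m invmx G.
Let n := (g *m a^T) 0 0.

Let iGT : (invmx G)^T = invmx G. Proof. by rewrite trmx_inv GT. Qed.
Let GgT : G *m g^T = a^T. Proof. by rewrite trmx_mul iGT mulmxA mulmxV // mul1mx. Qed.

Let gaT : g *m a^T = n%:M. Proof. by rewrite [LHS]mx11_scalar. Qed.
Let gG : g *m G = a. Proof. by rewrite mulmxKV. Qed.

Let E_aT j : E j *m a^T = (2 * a 0 j) *: a^T - n *: (G *m delta_mx j 0).
Proof.
rewrite /E confEE mulmxBl mulmxDl -!mulmxA -rowE -scalemxAl mul1mx.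
have -> : row j a^T = (a 0 j)%:M by rewrite [LHS]mx11_scalar !mxE.
rewrite mul_mx_scalar [a *m (_ *m _)]mulmxA -/g gaT mul_mx_scalar -scalemxAr.
by rewrite -scalerDl mulr_natl mulr2n.
Qed.

Let S_E : \sum_(k < d) E k *m delta_mx k 0 = d%:R *: a^T :> 'cV[R]_d.
Proof.
transitivity (\sum_(k < d) (a^T + a 0 k *: delta_mx k 0 - G *m (g 0 k *: delta_mx k 0))).
  apply: eq_bigr => k _; rewrite /E confEE mulmxBl mulmxDl -!mulmxA mul_delta_mx.
  rewrite -scalemxAl mul1mx [a *m _]mulmxA -/g mul_delta_col mul_mx_scalar -scalemxAr.
  by congr (_ + _ - _); rewrite [delta_mx _ _]mx11_scalar mxE !eqxx mulmx1.
rewrite sumrB big_split /= sumr_const card_ord sum_delta_col -mulmx_sumr sum_delta_col.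
by rewrite GgT addrK scaler_nat.
Qed.

Let tr_E j : \tr (E j) = d%:R * a 0 j.
Proof.
rewrite /E confEE linearB linearD /= mxtrace_mulC -rowE mxtraceZ mxtrace1.
rewrite mxtrace_mulC mulmxA mulmxKV // mul_delta_col !mxtrace_scalar.
have -> : row j a^T = (a 0 j)%:M by rewrite [LHS]mx11_scalar !mxE.
by rewrite mxtrace_scalar; ring.
Qed.

Let g_E j : g *m E j = n *: delta_mx 0 j.
Proof.
rewrite /E confEE mulmxBr mulmxDr [g *m (a^T *m _)]mulmxA gaT mul_scalar_mx.
rewrite -scalemxAr mulmx1 -/g [g *m (_ *m g)]mulmxA [g *m (G *m _)]mulmxA gG.
rewrite mul_delta_col mul_scalar_mx.
by rewrite addrK.
Qed.

Let S_EE j : \sum_(k < d) E k *m E j *m delta_mx k 0 =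
  (d%:R * a 0 j) *: a^T + E j *m a^T - n *: (G *m delta_mx j 0) :> 'cV[R]_d.
Proof.
transitivity (\sum_(k < d) (E j k k *: a^T + E j *m (a 0 k *: delta_mx k 0) -
    G *m ((g *m E j) 0 k *: delta_mx k 0))).
  apply: eq_bigr => k _; rewrite {1}/E confEE -mulmxA mulmxBl mulmxDl.
  congr (_ + _ - _).
  - rewrite -!mulmxA -colE -rowE; rewrite [row _ _]mx11_scalar !mxE mul_mx_scalar //.
  - by rewrite -scalemxAl mul1mx -scalemxAr.
  - rewrite -!mulmxA [a *m (invmx G *m _)]mulmxA -/g [g *m (E j *m _)]mulmxA.
    by rewrite [a *m (invmx G *m E j)]mulmxA -/g mul_delta_col mul_mx_scalar.
rewrite sumrB big_split /= -!mulmx_sumr !sum_delta_col -scaler_suml -/(\tr (E j)).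
by rewrite tr_E g_E linearZ /= trmx_delta -scalemxAr.
Qed.

(** The Ricci contraction of the terms of order [f^-2] in the rescaled curvature. The contributions
    along [a^T] cancel and only a multiple of the metric is left, which is why nothing but the
    squared norm of [df] remains at the zeros of [f]. *)
Lemma confE_contract j :
  \sum_(k < d) (a 0 k *: E j - a 0 j *: E k + (E j *m E k - E k *m E j)) *m delta_mx k 0
  = ((1 - d%:R) * n) *: (G *m delta_mx j 0) :> 'cV[R]_d.
Proof.
transitivity (E j *m a^T - a 0 j *: (d%:R *: a^T) + (d%:R *: (E j *m a^T) -
  ((d%:R * a 0 j) *: a^T + E j *m a^T - n *: (G *m delta_mx j 0)))).
  have dist (X Y Z W : 'M[R]_d) (c : 'cV[R]_d) :
      (X - Y + (Z - W)) *m c = X *m c - Y *m c + (Z *m c - W *m c).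
    by rewrite mulmxDl !mulmxBl.
  rewrite -S_E -S_EE; under eq_bigr do rewrite dist.
  rewrite big_split !sumrB /=; congr (_ - _ + (_ - _)).
  - by rewrite -sum_delta_col mulmx_sumr; apply: eq_bigr => k _; rewrite -scalemxAl scalemxAr.
  - by rewrite scaler_sumr; apply: eq_bigr => k _; rewrite -scalemxAl.
  - by rewrite scalemxAr -S_E mulmx_sumr; apply: eq_bigr => k _; rewrite mulmxA.
rewrite E_aT; move: (G *m _) => c.
by apply/matrixP => x y; rewrite !mxE; ring.
Qed.

End Algebra.

Lemma confE_sym (a : V) (G : 'M[R]_d) : G^T = G -> conn_sym (confE a G).
Proof.
move=> GT k j; apply/rowP => l; rewrite [LHS]mxE [RHS]mxE !confE_entry.
have -> : G k j = G j k by rewrite -{1}GT mxE.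
by rewrite [a 0 j * _ + _]addrC [j == l]eq_sym [k == l]eq_sym.
Qed.

(** The factor [2 * a 0 k] answers the derivative [- 2 f^-3 df] of [f^-2]: subtracting
    [f^-1 *: confE] from the connection compensates exactly for the varying conformal factor. *)
Lemma confE_compat (a : V) (G : 'M[R]_d) k : G \in unitmx -> G^T = G ->
  confE a G k *m G + (confE a G k *m G)^T = (2 * a 0 k) *: G.
Proof.
move=> uG GT; have -> : confE a G k *m G =
    a^T *m delta_mx 0 k *m G + a 0 k *: G - G *m delta_mx k 0 *m a.
  rewrite confEE mulmxBl mulmxDl -scalemxAl mul1mx; congr (_ - _).
  by rewrite -!mulmxA mulVmx // mulmx1.
rewrite linearB linearD linearZ /= !trmx_mul trmxK !trmx_delta GT !mulmxA.
by apply/matrixP => i j; rewrite !mxE; ring.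
Qed.

Section Rescale.
Variables (B : set V) (f : V -> R) (G : V -> 'M[R]_d).
Hypotheses (oB : open B) (sf : smooth_on B f) (sG : smooth_on B G).
Hypotheses (GT : forall z, B z -> (G z)^T = G z).
Hypothesis (uG : forall z, B z -> G z \in unitmx).

Definition drow y : V := \row_k partial k f y.

Let Gh y := (f y) ^- 2 *: G y.
Let E k y := confE (drow y) (G y) k.
Let B' := B `&` f @^-1` [set x | x != 0].

Lemma smooth_drow : smooth_on B drow.
Proof.
apply: smooth_mx => // i j; under eq_fun do rewrite mxE.
exact: smooth_partial.
Qed.

Lemma rescale_open : open B'.
Proof.
apply: open_preimageI => //; first by move=> x Bx; exact: smooth_continuous Bx.
Qed.

Let BB' : B' `<=` B. Proof. by move=> x []. Qed.
Let sG' : smooth_on B' G := smooth_sub BB' sG.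
Let sf' : smooth_on B' f := smooth_sub BB' sf.

Let sV : smooth_on B' (fun y => (f y)^-1).
Proof. by apply: smoothV => //; [exact: rescale_open|move=> x []]. Qed.

Let sE k : smooth_on B (E k).
Proof.
have sd := smooth_drow; rewrite /E; under eq_fun do rewrite confEE.
apply: smoothD => //; first apply: smoothD => //.
- by apply: smooth_mulmx => //; [exact: smooth_trmx|exact: smooth_cst].
- apply: smooth_scale => //; last exact: smooth_cst.
  exact: smooth_entry.
- under eq_fun do rewrite -scaleN1r; apply: smooth_scale => //; first exact: smooth_cst.
  apply: smooth_mulmx => //; first by apply: smooth_mulmx => //; exact: smooth_cst.
  by apply: smooth_mulmx => //; exact: smooth_invmx.
Qed.

Let partialV k y : B' y -> partial k (fun z => (f z)^-1) y = - (f y) ^- 2 * partial k f y.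
Proof.
move=> [By fy]; rewrite /partial deriveV //; exact: partial_derivable By.
Qed.

Lemma rescale_smooth : smooth_on B' Gh.
Proof.
have oB' := rescale_open.
apply: smooth_scale => //; under eq_fun do rewrite expr2 invfM.
exact: smoothM.
Qed.

Lemma rescale_unit y : B' y -> Gh y \in unitmx.
Proof. by move=> [By fy]; rewrite unitmxZ ?uG // unitfE invr_eq0 expf_neq0. Qed.

Lemma rescale_sym y : B' y -> (Gh y)^T = Gh y.
Proof. by move=> [By fy]; rewrite linearZ /= GT. Qed.

Lemma conn_rescale k y : B' y -> conn Gh k y = conn G k y - (f y)^-1 *: E k y.
Proof.
move=> B'y; have [By fy] := B'y; have oB' := rescale_open.
apply: (koszul (T := fun k => conn G k y - (f y)^-1 *: E k y)).
- exact: rescale_unit.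
- exact: rescale_sym.
- move=> i j; have := conn_symE oB By GT i j; have := confE_sym (drow y) (GT By) i j.
  by rewrite !linearB !linearZ /= /E => -> ->.
move=> l; rewrite {1}/Gh.
have -> : (fun z => (f z) ^- 2 *: G z) = fun z => ((f z)^-1 * (f z)^-1) *: G z.
  by apply/funext => z; rewrite expr2 invfM.
rewrite (mxpartial_scale (A := B')) //; last exact: smoothM.
rewrite (partialM (A := B')) // partialV // (conn_compatE oB By GT (uG By)).
have := confE_compat (drow y) l (uG By) (GT By); rewrite /Gh -!scalemxAr mulmxBl -scalemxAl.
rewrite -/(E l y) [drow y 0 l]mxE.
move: (E l y *m G y) (conn G l y *m G y) (G y) (partial l f y) => X Y Z q XE.
apply/matrixP => i j; have /matrixP/(_ i j) := XE.
rewrite !mxE => /(canRL (addKr _)) ->.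
by field.
Qed.

(* The regular part of f^2 R^_kj, where R^ is the curvature of f^-2 G. *)
Definition confQ k j y : 'M[R]_d := f y *: riem G k j y
  - (mxpartial k (E j) y - mxpartial j (E k) y)
  - (conn G j y *m E k y + E j y *m conn G k y - conn G k y *m E j y - E k y *m conn G j y).

(** The new connection is [conn G - f^-1 E]. Terms of order [f^-2] arise in two ways, from
    differentiating [f^-1] and from the commutator of the [E]; all others have at most one factor
    [f^-1] and go into [confQ]. *)
Lemma riem_rescale k j y : B' y -> f y ^+ 2 *: riem Gh k j y = f y *: confQ k j y +
  (drow y 0 k *: E j y - drow y 0 j *: E k y + (E j y *m E k y - E k y *m E j y)).
Proof.
move=> B'y; have [By fy] := B'y; have oB' := rescale_open.
have sC l : smooth_on B' (conn G l).
  by apply: smooth_sub BB' _; exact: smooth_conn.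
have sE' l : smooth_on B' (E l) by exact: smooth_sub (sE l).
have dC a b : mxpartial a (conn Gh b) y = mxpartial a (conn G b) y -
    (- (f y) ^- 2 * partial a f y *: E b y + (f y)^-1 *: mxpartial a (E b) y).
  rewrite (@eq_mxpartial _ _ B' _ _ a _ (fun z => conn G b z + (- (f z)^-1) *: E b z)) //; last first.
    by move=> z; rewrite inE => B'z; rewrite conn_rescale // scaleNr.
  rewrite (mxpartialD (A := B')) //; last by apply: smooth_scale => //; exact: smoothN.
  rewrite (mxpartial_scale (A := B')) //; last exact: smoothN.
  rewrite scaleNr opprD; congr (_ + (_ + _)).
  rewrite /partial deriveN; last exact: partial_derivable B'y.
  by rewrite -/(partial _ _ _) partialV // scaleNr.
rewrite /riem !dC !conn_rescale // /confQ /riem.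
rewrite !(mulmxBl, mulmxBr) -!(scalemxAl, scalemxAr) !mxE.
move: (mxpartial k (conn G j) y) (mxpartial j (conn G k) y) (mxpartial k (E j) y)
  (mxpartial j (E k) y) (E j y) (E k y) (partial k f y) (partial j f y) (conn G j y) (conn G k y).
move=> x1 x2 x3 x4 ej ek p q aj ak; move: (aj *m ak) (ak *m aj) (aj *m ek) (ej *m ak)
  (ak *m ej) (ek *m aj) (ej *m ek) (ek *m ej) => x5 x6 x7 x8 x9 x10 x11 x12.
by apply/matrixP => u v; rewrite !mxE; field.
Qed.

Definition gradsq y : R := (drow y *m invmx (G y) *m (drow y)^T) 0 0.

Lemma smooth_confQ k j : smooth_on B (confQ k j).
Proof.
have sC l : smooth_on B (conn G l) by exact: smooth_conn.
have sN (F : V -> 'M[R]_d) : smooth_on B F -> smooth_on B (fun y => - F y).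
  by move=> sF; under eq_fun do rewrite -scaleN1r; apply: smooth_scale => //; exact: smooth_cst.
have sd l (F : V -> 'M[R]_d) : smooth_on B F -> smooth_on B (mxpartial l F).
  exact: smooth_mxpartial.
have sMm (F H : V -> 'M[R]_d) : smooth_on B F -> smooth_on B H -> smooth_on B (fun y => F y *m H y).
  exact: smooth_mulmx.
have sR : smooth_on B (riem G k j).
  by do ![apply: sMm => // | apply: sN => // | apply: sd => // | apply: smoothD => //].
have sCE a b : smooth_on B (fun y => conn G a y *m E b y) by apply: sMm.
have sEC a b : smooth_on B (fun y => E a y *m conn G b y) by apply: sMm.
have sB (F H : V -> 'M[R]_d) : smooth_on B F -> smooth_on B H -> smooth_on B (fun y => F y - H y).
  by move=> sF sH; apply: smoothD => //; exact: sN.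
apply/sB; last by apply/sB => //; apply/sB => //; apply: smoothD.
by apply/sB; [exact: smooth_scale|apply/sB; exact: sd].
Qed.

Lemma scal_rescale : exists2 Q : V -> R, smooth_on B Q &
  forall y, B y -> f y != 0 -> scal Gh y = f y * Q y - d%:R * (d%:R - 1) * gradsq y.
Proof.
exists (fun y => \sum_(i < d) \sum_(j < d) invmx (G y) i j * \sum_(k < d) confQ k j y i k).
  apply: smooth_sum => // i _; apply: smooth_sum => // j _; apply: smoothM => //.
    by apply: smooth_entry => //; exact: smooth_invmx.
  by apply: smooth_sum => // k _; apply: smooth_entry => //; exact: smooth_confQ.
move=> y By fy; have B'y : B' y by [].
have sym : conn_sym (conn Gh ^~ y) by exact: conn_symE rescale_open B'y rescale_sym.
pose W k j := drow y 0 k *: E j y - drow y 0 j *: E k y + (E j y *m E k y - E k y *m E j y).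
have WE i j : \sum_(k < d) W k j i k = (1 - d%:R) * gradsq y * G y i j.
  transitivity ((\sum_(k < d) W k j *m delta_mx k 0 : 'cV[R]_d) i 0).
    by rewrite summxE; apply: eq_bigr => k _; rewrite -colE [RHS]mxE.
  have -> : \sum_(k < d) W k j *m delta_mx k 0 =
      ((1 - d%:R) * gradsq y) *: (G y *m delta_mx j 0) :> 'cV[R]_d.
    have cE := confE_contract (drow y) (uG By) (GT By) j.
    by apply: etrans cE; apply: eq_bigr => k _.
  by rewrite -colE [LHS]mxE [X in _ * X]mxE.
transitivity (\sum_(i < d) \sum_(j < d) invmx (G y) i j *
   (f y * \sum_(k < d) confQ k j y i k + (1 - d%:R) * gradsq y * G y i j)).
  apply: eq_bigr => i _; apply: eq_bigr => j _.
  (* The inverse of the rescaled metric supplies the factor [f^2] by which the curvature is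
     multiplied in [riem_rescale]. *)
  have -> : invmx (Gh y) = f y ^+ 2 *: invmx (G y).
    by rewrite invmxZ ?unitmxZ ?uG ?unitfE ?invr_eq0 ?expf_neq0 // invrK.
  rewrite (ricciE _ _ sym) [X in X * _ = _]mxE -[LHS]mulrA [LHS]mulrCA; congr (_ * _).
  rewrite -WE !mulr_sumr -big_split /=; apply: eq_bigr => k _.
  have := congr1 (fun M : 'M[R]_d => M i k) (riem_rescale k j B'y).
  by rewrite [LHS]mxE => ->; rewrite [LHS]mxE [X in X + _]mxE.
(* The second trace contributes [d]; the factor [1 - d] is already in [WE]. *)
have trE : \sum_(i < d) \sum_(j < d) invmx (G y) i j * G y i j = d%:R.
  transitivity (\tr (invmx (G y) *m (G y))); last by rewrite mulVmx ?uG // mxtrace1.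
  apply: eq_bigr => i _; rewrite [RHS]mxE; apply: eq_bigr => j _.
  by congr (_ * _); rewrite -{1}(GT By) mxE.
move: (gradsq y) => n.
rewrite (_ : d%:R * (d%:R - 1) * n = - ((1 - d%:R) * n * d%:R)); last by ring.
rewrite opprK; move: (1 - d%:R : R) => e; rewrite -trE !mulr_sumr -big_split /=; apply: eq_bigr => i _.
rewrite !mulr_sumr -big_split /=; apply: eq_bigr => j _.
by rewrite mulrDr mulrCA; congr (_ + _); ring.
Qed.
End Rescale.
End Conformal.

(** * Geodesics under pullback *)

Section Curves.
Context {R : realType} {d : nat}.
Local Notation V := 'rV[R]_d.

Lemma derive_mulmx (W : normedModType R) m n p (F : W -> 'M[R]_(m, n)) (G : W -> 'M[R]_(n, p)) x v :
  differentiable F x -> differentiable G x ->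
  'D_v (fun z => F z *m G z) x = 'D_v F x *m G x + F x *m 'D_v G x.
Proof.
move=> dF dG.
have dFe i j : differentiable (fun z => F z i j) x by exact: differentiable_entry.
have dGe i j : differentiable (fun z => G z i j) x by exact: differentiable_entry.
have dFG i j k : differentiable (fun z => F z i k * G z k j) x by exact: differentiableM.
have FGE i j : (fun z => (F z *m G z) i j) = \sum_(k < n) (fun z => F z i k * G z k j).
  by apply/funext => z; rewrite mxE fct_sumE.
have dP : differentiable (fun z => F z *m G z) x.
  by apply: differentiable_mx => i j; rewrite FGE; exact: differentiable_sum.
apply/matrixP => i j; rewrite derive_entry // FGE.
rewrite derive_sum; last by move=> k; exact: diff_derivable.
rewrite [RHS]mxE [X in _ = X + _]mxE [X in _ = _ + X]mxE -big_split; apply: eq_bigr => k _.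
rewrite deriveM; try exact: diff_derivable.
by rewrite !derive_entry // addrC /GRing.scale /= [G x k j * _]mulrC.
Qed.

Lemma derive_comp_jacobian (W : normedModType R) (F : V -> V) (u : W -> V) t v :
  differentiable u t -> differentiable F (u t) ->
  'D_v (F \o u) t = 'D_v u t *m 'J F (u t).
Proof.
move=> du dF; rewrite deriveE; last exact: differentiable_comp.
by rewrite diff_comp //= -(deriveE v) // -(deriveE _ dF) deriveEjacobian.
Qed.

(* Left-hand side of the geodesic equation at position u, velocity v, acceleration w. *)
Definition geo (G : V -> 'M[R]_d) (u v w : V) : V :=
  w + \sum_(i < d) v 0 i *: (v *m conn G i u).

Lemma geoE (G : V -> 'M[R]_d) (u v w : V) k : geo G u v w 0 k =
  w 0 k + \sum_(i < d) \sum_(j < d) christoffel G k i j u * v 0 i * v 0 j.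
Proof.
rewrite mxE summxE exchange_big /=; congr (_ + _); apply: eq_bigr => i _.
rewrite [LHS]mxE [X in _ * X]mxE mulr_sumr; apply: eq_bigr => j _.
by rewrite connE; move: (christoffel _ _ _ _ _) => c; ring.
Qed.

Section Pullback.
Variables (A B : set V) (F : V -> V) (G Gt : V -> 'M[R]_d).
Hypotheses (oA : open A) (oB : open B) (AB : forall x, A x -> B (F x)).
Hypotheses (sF : smooth_on A F) (uF : forall x, A x -> 'J F x \in unitmx).
Hypotheses (sG : smooth_on B G) (GT : forall z, B z -> (G z)^T = G z).
Hypothesis (uG : forall z, B z -> G z \in unitmx).
Hypothesis GtE : {in A, Gt =1 fun x => 'J F x *m G (F x) *m ('J F x)^T}.

(** The inhomogeneous term of [conn_pullback] is exactly the second-order term of the chain rule for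
    an acceleration, so the defect in the geodesic equation transforms as a vector. *)
Lemma geo_pullback y v w : A y -> geo Gt y v w *m 'J F y =
  geo G (F y) (v *m 'J F y)
    (w *m 'J F y + \sum_(k < d) v 0 k *: (v *m mxpartial k (fun x => 'J F x) y)).
Proof.
move=> Ay; rewrite /geo mulmxDl -addrA; congr (_ + _).
have E k : conn Gt k y *m 'J F y = mxpartial k (fun x => 'J F x) y +
   'J F y *m (\sum_(g < d) 'J F y k g *: conn G g (F y)).
  exact: (conn_pullback oA oB AB sF uF sG GT uG GtE).
transitivity (\sum_(k < d) (v 0 k *: (v *m mxpartial k (fun x => 'J F x) y) +
   \sum_(g < d) (v 0 k * 'J F y k g) *: (v *m 'J F y *m conn G g (F y)))).
  rewrite mulmx_suml; apply: eq_bigr => k _.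
  rewrite -scalemxAl -mulmxA E mulmxDr scalerDr; congr (_ + _).
  rewrite !mulmx_sumr scaler_sumr; apply: eq_bigr => g _.
  by rewrite -!scalemxAr scalerA mulmxA.
rewrite big_split /=; congr (_ + _); rewrite exchange_big; apply: eq_bigr => g _.
by rewrite -scaler_suml; congr (_ *: _); rewrite [RHS]mxE.
Qed.

Lemma derive2_comp (u : R -> V) (I : set R) t : open I -> I t -> smooth_on I u ->
  (forall s, I s -> A (u s)) ->
  'D_1 ('D_1 (F \o u)) t = 'D_1 ('D_1 u) t *m 'J F (u t) +
    \sum_(k < d) 'D_1 u t 0 k *: ('D_1 u t *m mxpartial k (fun x => 'J F x) (u t)).
Proof.
move=> oI It su IA.
have du s : I s -> differentiable u s by exact: smooth_differentiable.
have sJ : smooth_on A (fun x => 'J F x) by exact: smooth_jacobian.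
have dJ : differentiable (fun x => 'J F x) (u t).
  exact: smooth_differentiable sJ (IA _ It).
transitivity ('D_1 (fun s => 'D_1 u s *m 'J F (u s)) t).
  apply: near_eq_derive; apply: filterS (open_nbhs_nbhs (conj oI It)) => s Is.
  rewrite derive_comp_jacobian //; first exact: du.
  exact: smooth_differentiable sF (IA _ Is).
have dJu : differentiable (fun s => 'J F (u s)) t.
  by apply: (@differentiable_comp _ _ _ _ u (fun x => 'J F x)) => //; exact: du.
have dDu : differentiable (fun s => 'D_1 u s) t.
  by apply: (smooth_differentiable (A := I)) It; exact: smooth_derive.
rewrite (derive_mulmx _ dDu dJu).
congr (_ + _); rewrite -[RHS]mulmx1.
have -> : 'D_1 (fun s => 'J F (u s)) t =
    \sum_(k < d) 'D_1 u t 0 k *: mxpartial k (fun x => 'J F x) (u t).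
  apply/matrixP => i j; rewrite derive_entry //.
  rewrite (derive_comp_rV (g := fun x => 'J F x i j)); [|exact: du|exact: differentiable_entry].
  rewrite summxE; apply: eq_bigr => k _; rewrite [RHS]mxE mxpartialE.
  by rewrite derive_entry //; exact: du.
by rewrite mulmx1 mulmx_sumr; apply: eq_bigr => k _; rewrite -scalemxAr.
Qed.

(** The direction is from the image curve to the original one, because the equation will be solved
    in the target chart; invertibility of the Jacobian removes the last factor. *)
Lemma geodesic_pullback (u : R -> V) (I : set R) t : open I -> I t -> smooth_on I u ->
  (forall s, I s -> A (u s)) ->
  geo G (F (u t)) ('D_1 (F \o u) t) ('D_1 ('D_1 (F \o u)) t) = 0 ->
  geo Gt (u t) ('D_1 u t) ('D_1 ('D_1 u) t) = 0.
Proof.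
move=> oI It su IA; have Aut := IA _ It.
rewrite (derive2_comp oI It) // derive_comp_jacobian; last first.
- exact: smooth_differentiable sF Aut.
- exact: smooth_differentiable su It.
rewrite -geo_pullback // => /(congr1 (mulmxr (invmx ('J F (u t))))) /=.
by rewrite mulmxK ?uF // mul0mx.
Qed.

End Pullback.
End Curves.

(** * Boundary value problems and short geodesics *)

Section Antiderivative.
Context {R : realType}.

(** Integration starts at -1 so that 0 is an interior point and the fundamental theorem yields a
    two-sided derivative there; the subtraction restores the value 0 at 0. *)
Definition prim (w : R -> R) (x : R) : R :=
  \int[lebesgue_measure]_(t in `[-1, x]) w t - \int[lebesgue_measure]_(t in `[-1, 0]) w t.

Lemma prim0 w : prim w 0 = 0. Proof. by rewrite /prim subrr. Qed.

Lemma prim_derive (w : R -> R) (t : R) : continuous w -> 0 <= t <= 1 -> is_derive t 1 (prim w) (w t).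
Proof.
move=> cw /andP[t0 t1].
have t2 : t < 2 by rewrite (le_lt_trans t1) // ltr1n.
have tm : -1 < t by rewrite (lt_le_trans _ t0) // ltrN10.
have iw : lebesgue_measure.-integrable `[-1, (2 : R)] (EFin \o w).
  apply: continuous_compact_integrable; first exact: segment_compact.
  by apply: continuous_subspaceT.
have [dF FE] := continuous_FTC1_closed t2 iw tm (cw t).
rewrite -(subr0 (w t)); apply: is_deriveB.
apply: DeriveDef; first exact: dF.
by rewrite -derive1E.
Qed.

End Antiderivative.

Section VectorCurves.
Context {R : realType} {d : nat}.
Local Notation V := 'rV[R]_d.

(** Rows carry the maximum norm, so estimates made coordinate by coordinate, with separate mean
    value points, cost no constant. *)
Lemma rV_norm_le (x : V) (m : R) : 0 <= m -> (`|x| <= m) <-> (forall j, `|x 0 j| <= m).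
Proof.
move=> m0; split=> [xm j|xm].
  apply: le_trans xm; rewrite /Num.norm /= mx_normrE.
  exact: (le_bigmax _ (fun i => `|x i.1 i.2|) (0, j)).
rewrite /Num.norm /= mx_normrE; apply: bigmax_le => // -[i j] _ /=.
by rewrite (ord1 i).
Qed.

Lemma is_derive_row (f : R -> V) (df : V) (t : R) :
  (forall j, is_derive t 1 (fun s => f s 0 j) (df 0 j)) <-> is_derive t 1 f df.
Proof.
split=> [fE|fE].
  have dvf : derivable f t 1.
    by apply/derivable_mxP => i j; rewrite (ord1 i); have [] := fE j.
  apply: DeriveDef => //; apply/rowP => j; rewrite derive_mx // mxE.
  by have [] := fE j.
move=> j; have [dvf <-] := fE; apply: DeriveDef; last by rewrite derive_mx // mxE.
by move/derivable_mxP: dvf; exact.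
Qed.

Definition vprim (w : R -> V) (x : R) : V := \row_j prim (fun t => w t 0 j) x.

Lemma vprim0 w : vprim w 0 = 0.
Proof. by apply/rowP => j; rewrite !mxE prim0. Qed.

Lemma vprim_derive (w : R -> V) (t : R) : continuous w -> 0 <= t <= 1 -> is_derive t 1 (vprim w) (w t).
Proof.
move=> cw t01; apply/is_derive_row => j.
have -> : (fun s => vprim w s 0 j) = prim (fun t => w t 0 j).
  by apply/funext => s; rewrite mxE.
apply: prim_derive => // s.
by apply: (@continuous_comp _ _ _ w (fun N : V => N 0 j)); [exact: cw|exact: coord_continuous].
Qed.

Lemma MVT_bound (f df : R -> V) (m t : R) : 0 <= m -> 0 <= t <= 1 ->
  (forall s : R, 0 <= s <= 1 -> is_derive s 1 f (df s)) ->
  (forall s, `|df s| <= m) -> `|f t - f 0| <= m.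
Proof.
move=> m0 /andP[t0 t1] fE dfm; apply/rV_norm_le => // j.
have := t0; rewrite le_eqVlt => /predU1P[<-|{}t0]; first by rewrite subrr mxE normr0.
have [|s /andP[s0 st] sE] := @MVT_smooth R (fun s => f s 0 j) (fun s => df s 0 j) t t0.
  move=> s /andP[s0 st]; apply/is_derive_row: j; apply: fE.
  by rewrite s0 (le_trans st).
rewrite !mxE sE normrM -[m]mulr1 ler_pM //.
  by move/rV_norm_le: (dfm s) => /(_ m0); exact.
by rewrite ger0_norm // ltW.
Qed.

Lemma vprim_bound (w : R -> V) (m t : R) : continuous w -> 0 <= t <= 1 ->
  (forall s, `|w s| <= m) -> `|vprim w t| <= m.
Proof.
move=> cw t01 wm; have m0 : 0 <= m by rewrite (le_trans _ (wm 0)).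
rewrite -[vprim w t]subr0 -(vprim0 w); apply: (MVT_bound (df := w)) => // s s01.
exact: vprim_derive.
Qed.

Lemma vprim_dist (w w' : R -> V) (m t : R) : continuous w -> continuous w' -> 0 <= t <= 1 ->
  (forall s, `|w s - w' s| <= m) -> `|vprim w t - vprim w' t| <= m.
Proof.
move=> cw cw' t01 wm; have m0 : 0 <= m by rewrite (le_trans _ (wm 0)).
have -> : vprim w t - vprim w' t = (vprim w t - vprim w' t) - (vprim w 0 - vprim w' 0).
  by rewrite !vprim0 !subr0.
apply: (@MVT_bound (fun s => vprim w s - vprim w' s) (fun s => w s - w' s)) => // s s01.
by apply: is_deriveB; exact: vprim_derive.
Qed.

(** The retraction of the line onto [[0, 1]], with continuity visible from the formula. It turns
    curves on [[0, 1]] into globally continuous functions, so no function space on a segment is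
    needed. *)
Definition clamp (t : R) : R := (`|t| - `|t - 1| + 1) / 2.

Lemma clamp_id t : 0 <= t <= 1 -> clamp t = t.
Proof.
by move=> /andP[t0 t1]; rewrite /clamp ger0_norm // ler0_norm ?subr_le0 //; field.
Qed.

Lemma clamp_itv t : 0 <= clamp t <= 1.
Proof.
rewrite /clamp; have := ler_normD (t - 1) 1; have := ler_normB 1 t.
rewrite subrK normr1 (distrC 1 t) => h1 h2.
have h3 : `|t - 1| <= `|t| + 1 by rewrite (le_trans (ler_normB _ _)) // normr1.
by apply/andP; split; lra.
Qed.

Lemma clamp_continuous : continuous clamp.
Proof.
move=> t; apply: cvgM; last exact: cvg_cst.
apply: cvgD; last exact: cvg_cst.
apply: cvgB; first by apply: cvg_norm; exact: cvg_id.
by apply: cvg_norm; apply: cvgB; [exact: cvg_id|exact: cvg_cst].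
Qed.

Lemma derivable_continuous (f : R -> V) (t : R) df : is_derive t 1 f df -> {for t, continuous f}.
Proof.
by move=> [/derivable1_diffP df' _]; exact: differentiable_continuous.
Qed.

Lemma vprim_clamp_continuous (w : R -> V) : continuous w -> continuous (vprim w \o clamp).
Proof.
move=> cw t; apply: continuous_comp; first exact: clamp_continuous.
by apply: derivable_continuous; apply: vprim_derive => //; exact: clamp_itv.
Qed.

End VectorCurves.

Section BoundaryValueProblem.
Context {R : realType} {d : nat}.
Local Notation V := 'rV[R]_d.

Lemma geometric_le (c e : R) : 0 <= c -> 0 < e -> exists n, c / 2 ^+ n <= e.
Proof.
move=> c0 e0.
have : (fun n => c / 2 ^+ n : R) @ \oo --> (0 : R).
  rewrite -(mulr0 c); under eq_fun do rewrite -exprVn.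
  apply: cvgM; first exact: cvg_cst.
  by apply: cvg_expr; rewrite ger0_norm ?invr_ge0 // invf_lt1 // ltr1n.
move=> /cvgrPdist_lt /(_ _ e0) [N _ /(_ N (leqnn N))] /=.
by rewrite sub0r normrN ger0_norm ?divr_ge0 ?exprn_ge0 // => /ltW; exists N.
Qed.

Lemma geometric_cvg (x : nat -> R) (c : R) : 0 <= c ->
  (forall n, `|x n.+1 - x n| <= c / 2 ^+ n) ->
  exists l, forall n, `|l - x n| <= 2 * c / 2 ^+ n.
Proof.
move=> c0 xS.
have p2 n : 0 < (2 : R) ^+ n by rewrite exprn_gt0.
have cS n : 2 * c / 2 ^+ n - c / 2 ^+ n = 2 * c / 2 ^+ n.+1.
  by rewrite exprS; field; rewrite gt_eqF.
(* The exact tail of the geometric series on the right, not just a bound for it, lets the induction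
   on [k] close. *)
have xD n k : `|x (n + k)%N - x n| <= 2 * c / 2 ^+ n - 2 * c / 2 ^+ (n + k).
  elim: k => [|k IH]; first by rewrite addn0 !subrr normr0.
  rewrite addnS -cS -(subrK (x (n + k)%N) (x (n + k).+1)) -addrA.
  have := lerD (xS (n + k)%N) IH => /(le_trans (ler_normD _ _)); rewrite -/(_ - _).
  by move=> /le_trans; apply; rewrite addrCA lerD2l opprB addrC.
have xm n m : (n <= m)%N -> `|x m - x n| <= 2 * c / 2 ^+ n.
  move=> nm; have := xD n (m - n)%N; rewrite subnKC // => /le_trans; apply.
  by rewrite gerBl divr_ge0 ?mulr_ge0 // ltW.
have cx : cvgn x.
  apply/cauchy_cvgP/cauchy_exP => e e0.
  have [||N Ne] := @geometric_le (2 * c) (e / 2); rewrite ?mulr_ge0 ?divr_gt0 //; exists (x N).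
  exists N => // m /= Nm; rewrite -ball_normE /= distrC.
  by rewrite (le_lt_trans (xm _ _ Nm)) // (le_lt_trans Ne) // ltr_pdivrMr // ltr_pMr // ltr1n.
exists (limn x) => n.
have : (fun m => `|x m - x n|) @ \oo --> `|limn x - x n|.
  by apply: cvg_norm; apply: cvgB; [exact: cx|exact: cvg_cst].
move=> /cvgr_to_le; apply; exists n => // m /= nm; exact: xm.
Qed.

Section FixedPoint.
Variables (T : (R -> V) -> (R -> V)) (eta : R).
Let adm (w : R -> V) := continuous w /\ forall t, `|w t| <= eta.
Hypothesis T_adm : forall w, adm w -> adm (T w).
Hypothesis T_contr : forall w w' m, adm w -> adm w' ->
  (forall t, `|w t - w' t| <= m) -> forall t, `|T w t - T w' t| <= m / 2.

Lemma uniform_continuous_limit (w_ : nat -> R -> V) (w : R -> V) (c : R) : 0 <= c ->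
  (forall n, continuous (w_ n)) -> (forall n t, `|w t - w_ n t| <= c / 2 ^+ n) ->
  continuous w.
Proof.
move=> c0 cw wE t; apply/cvgrPdist_le => e e0.
have e3 : 0 < e / 3 by rewrite divr_gt0.
have [n nE] := geometric_le c0 e3.
have /cvgrPdist_le /(_ (e / 3)) := cw n t.
move=> /(_ e3); apply: filterS => s ts.
have -> : w t - w s = (w t - w_ n t) + (w_ n t - w_ n s) - (w s - w_ n s).
  by rewrite addrA subrK opprB addrA subrK.
rewrite (le_trans (ler_normB _ _)) // (_ : e = e / 3 + e / 3 + e / 3); last by field.
by rewrite lerD // ?(le_trans (wE n s)) // (le_trans (ler_normD _ _)) // lerD // (le_trans (wE n t)).
Qed.

(** Banach's theorem with factor 1/2, run on pointwise limits of the iterates of 0. The bounds are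
    uniform in [t], so the limit is continuous and the contraction property applies to it too. *)
Lemma sup_fixed_point : 0 <= eta -> exists2 w, adm w & forall t, T w t = w t.
Proof.
move=> eta0.
pose w_ n := iter n T (fun=> 0).
have aw n : adm (w_ n).
  elim: n => [|n IH]; last exact: T_adm.
  by split=> [t|t]; [exact: cvg_cst|rewrite normr0].
have wS n t : `|w_ n.+1 t - w_ n t| <= eta / 2 ^+ n.
  elim: n t => [|n IH] t.
    by rewrite expr0 divr1 subr0; have [_] := aw 1%N; exact.
  have := T_contr (aw n.+1) (aw n) IH t.
  by rewrite exprSr invfM mulrA.
have wl t : exists v : V, forall n, `|v - w_ n t| <= 2 * eta / 2 ^+ n.
  have wl j : exists l, forall n, `|l - w_ n t 0 j| <= 2 * eta / 2 ^+ n.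
    apply: geometric_cvg => // n.
    have m0 : 0 <= eta / 2 ^+ n by rewrite divr_ge0 ?exprn_ge0.
    by have /(rV_norm_le _ m0)/(_ j) := wS n t; rewrite !mxE.
  have [l lE] := choice wl; exists (\row_j l j) => n.
  have m0 : 0 <= 2 * eta / 2 ^+ n by rewrite divr_ge0 ?exprn_ge0 ?mulr_ge0.
  by apply/(rV_norm_le _ m0) => j; rewrite !mxE.
have [w wE] := choice wl.
have cw : continuous w.
  by apply: (uniform_continuous_limit (c := 2 * eta) _ _ (fun n t => wE t n));
     [rewrite mulr_ge0|move=> n; case: (aw n)].
have small (a : V) : (forall n, `|a| <= 2 * (2 * eta) / 2 ^+ n) -> a = 0.
  move=> aE; apply/eqP; rewrite -normr_le0; apply/ler_addgt0Pr => e e0.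
  have [|n nE] := @geometric_le (2 * (2 * eta)) _ _ e0; last by rewrite add0r (le_trans (aE n)) //; exact: nE.
  by rewrite !mulr_ge0.
have bw t : `|w t| <= eta.
  apply/ler_addgt0Pr => e e0.
  have [|N Ne] := @geometric_le (2 * eta) _ _ e0; first by rewrite mulr_ge0.
  rewrite -[w t](subrK (w_ N t)) addrC (le_trans (ler_normD _ _)) // lerD //.
    by have [_] := aw N; exact.
  exact: le_trans (wE t N) Ne.
exists w; first by [].
move=> t; apply/eqP; rewrite -subr_eq0; apply/eqP; apply: small => n.
have -> : T w t - w t = (T w t - T (w_ n) t) - (w t - w_ n.+1 t).
  by rewrite opprB addrA subrK.
rewrite (le_trans (ler_normB _ _)) //.
have h1 := T_contr (conj cw bw) (aw n) (fun s => wE s n) t.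
have h2 := wE t n.+1.
have h3 : 2 * eta / 2 ^+ n / 2 = 2 * eta / 2 ^+ n.+1 by rewrite exprSr invfM mulrA.
rewrite h3 in h1; apply: le_trans (lerD h1 h2) _.
have p2 : 0 < (2 : R) ^+ n by rewrite exprn_gt0.
rewrite -subr_ge0 exprS (_ : _ - _ = 2 * eta / 2 ^+ n); last by field; rewrite gt_eqF.
by rewrite divr_ge0 ?mulr_ge0 // ltW.
Qed.

End FixedPoint.

(** * The two-point problem for an equation with quadratic growth in the velocity *)

Section Bvp.
Variables (q : V -> V -> V) (x0 : V) (r C : R).
Hypotheses (r0 : 0 < r) (C0 : 0 < C).
Hypothesis q_bound : forall u v s, s <= 1 -> `|u - x0| <= r -> `|v| <= s ->
  `|q u v| <= C * s ^+ 2.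
Hypothesis q_lip : forall u v u' v' s, s <= 1 -> `|u - x0| <= r -> `|u' - x0| <= r ->
  `|v| <= s -> `|v'| <= s -> `|q u v - q u' v'| <= C * s * (`|v - v'| + `|u - u'|).

Section Fixed.
Variables (del : R) (y0 y1 : V).
Hypotheses (del0 : 0 < del) (del6 : 6 * del <= 1) (del7 : 7 * del <= r) (delC : 48 * C * del <= 1).
Hypotheses (y0x : `|y0 - x0| <= del) (y1x : `|y1 - x0| <= del).

(** The unknown is the acceleration [w]. On [[0, 1]], [pos w] is the curve from [y0] to [y1] with
    second derivative [w], a double primitive corrected by an affine term, and [vel w] is its
    velocity. The boundary values are thus built in, and a fixed point of [q (pos w) (vel w)] solves
    the problem. *)
Let e := y1 - y0.
Let P2 (w : R -> V) := vprim (vprim w \o clamp).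
Let vel (w : R -> V) (t : R) : V := e + vprim w (clamp t) - P2 w 1.
Let pos (w : R -> V) (t : R) : V := y0 + clamp t *: e + P2 w (clamp t) - clamp t *: P2 w 1.

Let eb : `|e| <= 2 * del.
Proof.
rewrite /e (_ : y1 - y0 = (y1 - x0) - (y0 - x0)); last by rewrite opprB addrA subrK.
by rewrite (le_trans (ler_normB _ _)) // mulr_natl mulr2n lerD.
Qed.

Let i01 : 0 <= (1 : R) <= 1. Proof. by rewrite ler01 lexx. Qed.

Let P2_bound w m t : continuous w -> (forall s, `|w s| <= m) -> 0 <= t <= 1 -> `|P2 w t| <= m.
Proof.
move=> cw wm t01; apply: vprim_bound => //; first exact: vprim_clamp_continuous.
by move=> s; apply: vprim_bound => //; exact: clamp_itv.
Qed.

Let P2_dist w w' m t : continuous w -> continuous w' -> (forall s, `|w s - w' s| <= m) ->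
  0 <= t <= 1 -> `|P2 w t - P2 w' t| <= m.
Proof.
move=> cw cw' wm t01; apply: vprim_dist => //; try exact: vprim_clamp_continuous.
by move=> s; apply: vprim_dist => //; exact: clamp_itv.
Qed.

Let clampZ t (x : V) m : `|x| <= m -> `|clamp t *: x| <= m.
Proof.
have /andP[t0 t1] := clamp_itv t => xm.
by rewrite normrZ ger0_norm // (le_trans _ xm) // ler_piMl.
Qed.

Let adm (w : R -> V) := continuous w /\ forall t, `|w t| <= 2 * del.

Let vel_bound w t : adm w -> `|vel w t| <= 6 * del.
Proof.
move=> [cw bw]; rewrite /vel (le_trans (ler_normB _ _)) //.
have h1 : `|e + vprim w (clamp t)| <= 2 * del + 2 * del.
  rewrite (le_trans (ler_normD _ _)) // lerD //.
  by apply: vprim_bound => //; exact: clamp_itv.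
have h2 := P2_bound cw bw i01.
by apply: le_trans (lerD h1 h2) _; lra.
Qed.

Let pos_bound w t : adm w -> `|pos w t - x0| <= r.
Proof.
move=> [cw bw]; rewrite (le_trans _ del7) //.
have -> : pos w t - x0 = (y0 - x0) + clamp t *: e + P2 w (clamp t) - clamp t *: P2 w 1.
  by rewrite /pos [LHS]addrAC; congr (_ - _); rewrite [LHS]addrAC; congr (_ + _); rewrite addrAC.
have h1 := clampZ t eb; have h2 := P2_bound cw bw (clamp_itv t).
have h3 := clampZ t (P2_bound cw bw i01).
rewrite (le_trans (ler_normB _ _)) //.
have h4 := lerD (lerD y0x h1) h2.
have h5 : `|y0 - x0 + clamp t *: e + P2 w (clamp t)| <= del + 2 * del + 2 * del.
  apply: le_trans h4; rewrite (le_trans (ler_normD _ _)) // lerD2r ler_normD //.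
by apply: le_trans (lerD h5 h3) _; lra.
Qed.

Let vel_dist w w' m t : adm w -> adm w' -> (forall s, `|w s - w' s| <= m) ->
  `|vel w t - vel w' t| <= 2 * m.
Proof.
move=> [cw _] [cw' _] wm.
have -> : vel w t - vel w' t = (vprim w (clamp t) - vprim w' (clamp t)) - (P2 w 1 - P2 w' 1).
  rewrite /vel; move: (vprim w _) (vprim w' _) (P2 w _) (P2 w' _) => a b a' b'.
  by apply/rowP => j; rewrite !mxE; ring.
rewrite (le_trans (ler_normB _ _)) // mulr_natl mulr2n lerD //; last exact: P2_dist.
by apply: vprim_dist => //; exact: clamp_itv.
Qed.

Let pos_dist w w' m t : adm w -> adm w' -> (forall s, `|w s - w' s| <= m) ->
  `|pos w t - pos w' t| <= 2 * m.
Proof.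
move=> [cw _] [cw' _] wm.
have -> : pos w t - pos w' t = (P2 w (clamp t) - P2 w' (clamp t)) - clamp t *: (P2 w 1 - P2 w' 1).
  rewrite /pos; move: (P2 w (clamp t)) (P2 w' (clamp t)) (P2 w 1) (P2 w' 1) => a b a' b'.
  by apply/rowP => j; rewrite !mxE; ring.
rewrite (le_trans (ler_normB _ _)) // mulr_natl mulr2n lerD //.
  by apply: P2_dist => //; exact: clamp_itv.
by apply: clampZ; exact: P2_dist.
Qed.

Let P2_continuous w t : continuous w -> 0 <= t <= 1 -> {for t, continuous (P2 w)}.
Proof.
move=> cw t01; apply: derivable_continuous; apply: vprim_derive => //.
exact: vprim_clamp_continuous.
Qed.

Let vel_continuous w : continuous w -> continuous (vel w).
Proof.
move=> cw t; apply: cvgB; last exact: cvg_cst.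
apply: cvgD; first exact: cvg_cst.
exact: vprim_clamp_continuous.
Qed.

Let pos_continuous w : continuous w -> continuous (pos w).
Proof.
move=> cw t; apply: cvgB; last by apply: cvgZr_tmp; exact: clamp_continuous.
apply: cvgD; last first.
  apply: (@continuous_comp _ _ _ clamp (P2 w)); first exact: clamp_continuous.
  by apply: P2_continuous => //; exact: clamp_itv.
apply: cvgD; first exact: cvg_cst.
by apply: cvgZr_tmp; exact: clamp_continuous.
Qed.

Let T (w : R -> V) (t : R) : V := q (pos w t) (vel w t).

Let T_adm w : adm w -> adm (T w).
Proof.
move=> aw; have [cw bw] := aw; split=> [t|t]; last first.
  rewrite (le_trans (q_bound del6 (pos_bound t aw) (vel_bound t aw))) //.
  (* This must be at most [2 * del]; [18 * C * del <= 1] would do and follows from [delC]. *)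
  rewrite (_ : C * _ = 36 * (C * del) * del); last by ring.
  have h : 48 * (C * del) <= 1 by rewrite mulrA.
  by rewrite ler_wpM2r ?(ltW del0) //; move: h (mulr_gt0 C0 del0); move: (C * del) => z; lra.
apply/cvgrPdist_le => eps eps0.
have e1 : 0 < eps / 2 by rewrite divr_gt0.
have /cvgrPdist_le/(_ _ e1) cv := @vel_continuous w cw t.
have /cvgrPdist_le/(_ _ e1) cp := @pos_continuous w cw t.
near=> s.
apply: le_trans (q_lip del6 (pos_bound t aw) (pos_bound s aw) (vel_bound t aw) (vel_bound s aw)) _.
have hv : `|vel w t - vel w s| <= eps / 2 by near: s.
have hp : `|pos w t - pos w s| <= eps / 2 by near: s.
have C1 : C * (6 * del) <= 1.
  have : 0 < C * del by rewrite mulr_gt0.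
  by move: delC; rewrite -mulrA; lra.
apply: le_trans (ler_wpM2r _ C1) _; first by rewrite addr_ge0.
by rewrite mul1r [eps]splitr lerD.
Unshelve. all: by end_near. Qed.

Let T_contr w w' m : adm w -> adm w' ->
  (forall t, `|w t - w' t| <= m) -> forall t, `|T w t - T w' t| <= m / 2.
Proof.
move=> aw aw' wm t; have m0 : 0 <= m by rewrite (le_trans _ (wm 0)).
apply: le_trans (q_lip del6 (pos_bound t aw) (pos_bound t aw') (vel_bound t aw) (vel_bound t aw')) _.
have hv := vel_dist t aw aw' wm; have hp := pos_dist t aw aw' wm.
have C1 : 0 <= C * (6 * del) by rewrite !mulr_ge0 ?ltW.
apply: le_trans (ler_wpM2l C1 (lerD hv hp)) _.
rewrite (_ : C * _ * _ = (48 * C * del) * (m / 2)); last by field.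
by rewrite ler_piMl // divr_ge0.
Qed.

Lemma bvp_small : exists u v : R -> V, [/\ u 0 = y0, u 1 = y1, continuous u,
  (forall t, `|u t - x0| <= r) &
  forall t : R, 0 < t < 1 -> is_derive t 1 u (v t) /\ is_derive t 1 v (q (u t) (v t))].
Proof.
have [|w aw wE] := sup_fixed_point T_adm T_contr; first by rewrite mulr_ge0 ?ltW.
have [cw bw] := aw.
have c0 : clamp (0 : R) = 0 by rewrite clamp_id // lexx ler01.
have c1 : clamp (1 : R) = 1 by rewrite clamp_id // lexx ler01.
exists (pos w), (vel w); split.
- by rewrite /pos c0 !scale0r subr0 addr0 /P2 vprim0 addr0.
- by rewrite /pos c1 !scale1r addrK addrC subrK.
- exact: pos_continuous.
- by move=> t; exact: pos_bound.
move=> t /andP[t0 t1].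
have t01 : 0 <= t <= 1 by rewrite !ltW.
have nt : \forall s \near t, s = clamp s.
  have : \forall s \near t, s \in `]0, 1[ by apply: near_in_itvoo; rewrite in_itv /= t0.
  by apply: filterS => s; rewrite in_itv /= => /andP[s0 s1]; rewrite clamp_id // !ltW.
split.
  have dpos : is_derive t 1 (fun s => y0 + s *: e + P2 w s - s *: P2 w 1) (vel w t).
    have dZ (x : V) : is_derive t 1 (fun s : R => s *: x) x.
      apply/is_derive_row => j; under eq_fun do rewrite mxE.
      by apply: is_derive_eq; rewrite /GRing.scale /= !(mulr0, mulr1, addr0, add0r).
    rewrite /vel; apply: is_deriveB; apply: is_deriveD.
      by rewrite -[e]add0r; apply: is_deriveD; rewrite add0r.
    by apply: vprim_derive => //; exact: vprim_clamp_continuous.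
  apply: near_eq_is_derive dpos.
  by apply: filterS nt => s sE; rewrite /pos -sE.
rewrite -[q _ _]/(T w t) wE.
have dvel : is_derive t 1 (fun s => e + vprim w s - P2 w 1) (w t).
  rewrite -[w t]subr0 -[w t]add0r; apply: is_deriveB; apply: is_deriveD.
  exact: vprim_derive.
apply: near_eq_is_derive dvel.
by apply: filterS nt => s sE; rewrite /vel -sE.
Qed.

End Fixed.

Lemma bvp : exists2 del, 0 < del & forall y0 y1, `|y0 - x0| <= del -> `|y1 - x0| <= del ->
  exists u v : R -> V, [/\ u 0 = y0, u 1 = y1, continuous u,
  (forall t, `|u t - x0| <= r) &
  forall t : R, 0 < t < 1 -> is_derive t 1 u (v t) /\ is_derive t 1 v (q (u t) (v t))].
Proof.
(* The chord and the two integrals of [w] are each at most [2 * del], so velocities are at most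
   [6 * del]; the offset of [y0] makes [7 * del] for positions. The operator has Lipschitz constant
   [C * (6 * del) * (2 + 2)], which is at most 1/2 once [48 * C * del <= 1]. *)
exists (Num.min (6^-1) (Num.min (r / 7) (48 * C)^-1)).
  by rewrite !lt_min; apply/and3P; split; rewrite ?invr_gt0 ?divr_gt0 ?mulr_gt0.
move=> y0 y1 y0x y1x; apply: bvp_small y0x y1x.
- by rewrite !lt_min; apply/and3P; split; rewrite ?invr_gt0 ?divr_gt0 ?mulr_gt0.
- by rewrite mulrC -ler_pdivlMr // mul1r ge_min lexx.
- by rewrite mulrC -ler_pdivlMr // !ge_min lexx orbT.
- rewrite mulrC -ler_pdivlMr ?mulr_gt0 // mul1r !ge_min lexx !orbT //.
Qed.

End Bvp.

(* The geodesic equation is u' = v, v' = quad A u v with A_i the i-th connection matrix. *)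
Definition quad (A : 'I_d -> V -> 'M[R]_d) (u v : V) : V :=
  - \sum_(i < d) v 0 i *: (v *m A i u).

Lemma mulmx_norm_le (v : V) (M : 'M[R]_d) (a m : R) : 0 <= a ->
  `|v| <= a -> (forall i j, `|M i j| <= m) -> `|v *m M| <= d%:R * a * m.
Proof.
move=> a0 va Mm; have [d0|d_gt0] := posnP d.
  rewrite (_ : v *m M = 0) ?normr0; last by apply/rowP => -[j jd]; exfalso; rewrite d0 in jd.
  by rewrite d0 !mul0r.
have m0 : 0 <= m by rewrite (le_trans _ (Mm (Ordinal d_gt0) (Ordinal d_gt0))).
apply/rV_norm_le; first by rewrite !mulr_ge0.
move=> j; rewrite mxE (le_trans (ler_norm_sum _ _ _)) //.
rewrite -mulrA mulr_natl -[d in leRHS]card_ord -sumr_const ler_sum // => i _.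
by rewrite normrM ler_pM //; move/(rV_norm_le _ a0): va; exact.
Qed.

Lemma quad_lip (A : 'I_d -> V -> 'M[R]_d) (N : set V) (K L : R) :
  0 <= K -> 0 <= L ->
  (forall i u j l, N u -> `|A i u j l| <= K) ->
  (forall i u u' j l, N u -> N u' -> `|A i u j l - A i u' j l| <= L * `|u - u'|) ->
  exists2 C, 0 < C &
    (forall u v s, s <= 1 -> N u -> `|v| <= s -> `|quad A u v| <= C * s ^+ 2) /\
    (forall u v u' v' s, s <= 1 -> N u -> N u' -> `|v| <= s -> `|v'| <= s ->
      `|quad A u v - quad A u' v'| <= C * s * (`|v - v'| + `|u - u'|)).
Proof.
move=> K0 L0 AK AL; pose D : R := d%:R.
have D0 : 0 <= D by [].
(* The velocity occurs twice, hence [2 * K]; the change of the matrix costs [L * s ^+ 2], at most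
   [L * s] because [s <= 1]. The final 1 ensures positivity. *)
exists (D * D * (2 * K + L) + 1).
  by rewrite ltr_wpDl // !mulr_ge0 // addr_ge0 // mulr_ge0.
have ent (v : V) s i : 0 <= s -> `|v| <= s -> `|v 0 i| <= s.
  by move=> s0 /(rV_norm_le _ s0); exact.
have sumle (F : 'I_d -> V) m : (forall i, `|F i| <= m) -> `|\sum_(i < d) F i| <= D * m.
  move=> Fm; rewrite (le_trans (ler_norm_sum _ _ _)) // /D.
  by rewrite mulr_natl -[d in leRHS]card_ord -sumr_const ler_sum.
have DD : 0 <= D * D * K by rewrite !mulr_ge0.
have DDL : 0 <= D * D * L by rewrite !mulr_ge0.
split=> [u v s s1 Nu vs|u v u' v' s s1 Nu Nu' vs vs'].
  have s0 : 0 <= s by rewrite (le_trans _ vs).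
  have : `|quad A u v| <= D * (s * (D * s * K)).
    rewrite /quad normrN; apply: sumle => i; rewrite normrZ ler_pM //; first exact: ent.
    by apply: mulmx_norm_le => // j l; exact: AK.
  move=> /le_trans; apply; rewrite -subr_ge0.
  rewrite (_ : _ - _ = (D * D * K + D * D * L + 1) * s ^+ 2); last by ring.
  by rewrite mulr_ge0 // ?addr_ge0 // sqr_ge0.
have s0 : 0 <= s by rewrite (le_trans _ vs).
set a := `|v - v'|; set b := `|u - u'|.
have a0 : 0 <= a by exact: normr_ge0.
have b0 : 0 <= b by exact: normr_ge0.
have : `|quad A u v - quad A u' v'| <= D * (a * (D * s * K) + s * (D * a * K) + s * (D * s * (L * b))).
  rewrite /quad -opprD normrN -sumrB; apply: sumle => i.
  (* One factor changes at a time: the scalar, the row, then the matrix. *)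
  have -> : v 0 i *: (v *m A i u) - v' 0 i *: (v' *m A i u') =
      (v - v') 0 i *: (v *m A i u) + v' 0 i *: ((v - v') *m A i u) + v' 0 i *: (v' *m (A i u - A i u')).
    rewrite mulmxBl mulmxBr !scalerBr mxE [X in (_ + X)*: _]mxE scalerBl addrA.
    by rewrite !addrA !subrK.
  rewrite (le_trans (ler_normD _ _)) // lerD //.
    rewrite (le_trans (ler_normD _ _)) // lerD // normrZ ler_pM //; try exact: ent.
      by apply: mulmx_norm_le => // j l; exact: AK.
    by apply: mulmx_norm_le => // j l; exact: AK.
  rewrite normrZ ler_pM //; first exact: ent.
  by apply: mulmx_norm_le => // j l; rewrite !mxE; exact: AL.
move=> /le_trans; apply; rewrite -subr_ge0.
rewrite (_ : _ - _ = (D * D * L + 1) * s * a + (2 * (D * D * K) + 1) * s * b + (D * D * L) * s * b * (1 - s)); last by ring.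
have s1' : 0 <= 1 - s by rewrite subr_ge0.
move: DD DDL a0 b0; move: (D * D * K) (D * D * L) a b => x1 x2 x3 x4 *.
by apply: addr_ge0; [apply: addr_ge0|]; rewrite !mulr_ge0 // addr_ge0 // mulr_ge0.
Qed.

Lemma derivable_differentiable (f : R -> V) (t : R) df : is_derive t 1 f df -> differentiable f t.
Proof. by move=> [/derivable1_diffP]. Qed.

(** Bootstrap on position and velocity together: their derivatives are expressions in [u], [v] and
    the smooth [A], so class [C^k] of the pair implies class [C^(k+1)]. *)
Lemma quad_smooth (A : 'I_d -> V -> 'M[R]_d) (B : set V) (I : set R) (u v : R -> V) :
  open I -> open B -> (forall t, I t -> B (u t)) -> (forall i, smooth_on B (A i)) ->
  (forall t, I t -> is_derive t 1 u (v t) /\ is_derive t 1 v (quad A (u t) (v t))) ->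
  smooth_on I u.
Proof.
move=> oI oB IB sA uv.
have du t : I t -> differentiable u t by move=> /uv[/derivable_differentiable].
have dv t : I t -> differentiable v t by move=> /uv[_ /derivable_differentiable].
suff H k : Ck_on k I u /\ Ck_on k I v by move=> k; have [] := H k.
elim: k => [|k [IHu IHv]].
  by split=> t It; apply: differentiable_continuous; [exact: du|exact: dv].
have scal (f : R -> V) (g : R -> V) : (forall t, I t -> is_derive t 1 f (g t)) ->
    Ck_on k I g -> forall h, Ck_on k I (fun t => 'D_h f t).
  move=> fg Cg h.
  have : Ck_on k I (fun t => h *: g t).
    apply: Ck_mx => // i j; under eq_fun do rewrite mxE.
    by apply: CkM => //; [exact: Ck_cst|exact: Ck_entry].
  apply: Ck_ext => // t; rewrite inE => It.
  have df := derivable_differentiable (fg _ It).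
  rewrite deriveE // -[h in RHS]mulr1 -[h * 1]/(h *: (1 : R)) linearZ /= -deriveE //.
  by have [_ ->] := fg _ It.
split; split=> //.
  by apply: scal IHv => t /uv[].
apply: (scal _ (fun t => quad A (u t) (v t))); first by move=> t /uv[].
have Cve i : Ck_on k I (fun t => v t 0 i) by exact: Ck_entry.
apply: Ck_mx => // i j; rewrite (ord1 i); under eq_fun do rewrite mxE -mulN1r summxE.
apply: CkM => //; first exact: Ck_cst.
apply: Ck_sum => // l _; under eq_fun do rewrite mxE; apply: CkM => //.
under eq_fun do rewrite mxE; apply: Ck_sum => // m _.
apply: CkM => //; apply: (Ck_comp (g := fun x => A l x m j) oI IB IHu).
by apply: Ck_entry => //; exact: sA.
Qed.

End BoundaryValueProblem.

Section LocalGeodesics.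
Context {R : realType} {d : nat}.
Local Notation V := 'rV[R]_d.

Lemma derive_drow (f : V -> R) x (w : V) : differentiable f x ->
  'D_w f x = \sum_(k < d) w 0 k * drow f x 0 k.
Proof.
move=> df; rewrite deriveE // {1}[w]row_sum_delta linear_sum /=.
by apply: eq_bigr => k _; rewrite linearZ /= -deriveE // [drow _ _ _ _]mxE.
Qed.

(** The gradient is bounded on a small ball, and the segment between two points stays in it by
    convexity. [K] adds the two bounds so that it serves for both values and differences. *)
Lemma smooth_locally_lipschitz (B : set V) (f : V -> R) x0 : open B -> B x0 -> smooth_on B f ->
  exists r K, [/\ 0 < r, 0 <= K, (forall u, `|u - x0| <= r -> B u /\ `|f u| <= K) &
    forall u u', `|u - x0| <= r -> `|u' - x0| <= r -> `|f u - f u'| <= K * `|u - u'|].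
Proof.
move=> oB Bx0 sf.
have cd : {for x0, continuous (drow f)}.
  exact: smooth_continuous (smooth_drow oB sf) Bx0.
have cf : {for x0, continuous f} by exact: smooth_continuous Bx0.
have n1 : \forall u \near x0, `|drow f x0 - drow f u| < 1.
  by move/cvgrPdist_lt: cd; apply.
have n2 : \forall u \near x0, `|f x0 - f u| < 1.
  by move/cvgrPdist_lt: cf; apply.
have n3 : \forall u \near x0, B u by exact: open_nbhs_nbhs.
have n4 : \forall u \near x0, `|drow f x0 - drow f u| < 1 /\ `|f x0 - f u| < 1 /\ B u.
  by apply: filterS3 n1 n2 n3.
have /nbhs_ballP[e /= e0 eB] := n4.
pose M := `|drow f x0| + 1; pose K := `|f x0| + 1 + d%:R * M.
have M0 : 0 <= M by rewrite addr_ge0.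
have ball_e u : `|u - x0| <= e / 2 -> [/\ `|drow f u| <= M, `|f u| <= `|f x0| + 1 & B u].
  move=> ue; have : ball x0 e u.
    rewrite -ball_normE /= distrC (le_lt_trans ue) //.
    by rewrite ltr_pdivrMr // ltr_pMr // ltr1n.
  move=> /eB[h1 [h2 h3]]; split=> //.
    rewrite -[drow f u](subrK (drow f x0)) addrC (le_trans (ler_normD _ _)) // lerD2l.
    by rewrite distrC ltW.
  rewrite -[f u](subrK (f x0)) addrC (le_trans (ler_normD _ _)) // lerD2l.
  by rewrite distrC ltW.
exists (e / 2), K; split.
- by rewrite divr_gt0.
- by rewrite !addr_ge0 // mulr_ge0.
- by move=> u /ball_e[_ h2 h3]; split; rewrite // (le_trans h2) // lerDl mulr_ge0.
move=> u u' hu hu'; pose w := u - u'.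
have line s : 0 <= s <= 1 -> `|u' + s *: w - x0| <= e / 2.
  move=> /andP[s0 s1].
  have -> : u' + s *: w - x0 = (1 - s) *: (u' - x0) + s *: (u - x0).
    by apply/rowP => j; rewrite !mxE; ring.
  rewrite (le_trans (ler_normD _ _)) // !normrZ ger0_norm ?subr_ge0 // ger0_norm //.
  rewrite (_ : e / 2 = (1 - s) * (e / 2) + s * (e / 2)); last by ring.
  by rewrite lerD // ler_wpM2l // subr_ge0.
have df s : 0 <= s <= 1 -> differentiable f (u' + s *: w).
  by move=> /line/ball_e[_ _ ?]; exact: smooth_differentiable sf _.
have [s s01] := @MVT_smooth R (fun s => f (u' + s *: w)) _ 1 ltr01
  (fun s s01 => is_derive_line (df s s01)).
have u'w : u' + w = u by rewrite addrC subrK.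
rewrite scale1r scale0r addr0 u'w mulr1 => ->.
rewrite derive_drow; last exact: df.
have [h1 _ _] := ball_e _ (line _ s01).
rewrite (le_trans (ler_norm_sum _ _ _)) //.
rewrite (@le_trans _ _ (\sum_(k < d) `|w| * M)) //.
  apply: ler_sum => k _; rewrite normrM ler_pM //.
    by move/(rV_norm_le w (normr_ge0 w)): (lexx `|w|); exact.
  by move/(rV_norm_le _ M0): h1; exact.
rewrite sumr_const card_ord -mulr_natl mulrCA [leLHS]mulrC -/w.
by rewrite ler_wpM2r // lerDr addr_ge0.
Qed.

Lemma local_lipschitz_family (I : finType) (B : set V) (f : I -> V -> R) x0 :
  open B -> B x0 -> (forall i, smooth_on B (f i)) ->
  exists r K, [/\ 0 < r, 0 <= K,
    (forall i u, `|u - x0| <= r -> `|f i u| <= K),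
    (forall u, `|u - x0| <= r -> B u) &
    forall i u u', `|u - x0| <= r -> `|u' - x0| <= r -> `|f i u - f i u'| <= K * `|u - u'|].
Proof.
move=> oB Bx0 sf.
have /choice[rK rKE] i : exists rK : R * R, [/\ 0 < rK.1, 0 <= rK.2,
    (forall u, `|u - x0| <= rK.1 -> B u /\ `|f i u| <= rK.2) &
    forall u u', `|u - x0| <= rK.1 -> `|u' - x0| <= rK.1 -> `|f i u - f i u'| <= rK.2 * `|u - u'|].
  by have [r [K ?]] := smooth_locally_lipschitz oB Bx0 (sf i); exists (r, K).
(* A constant function provides a ball inside [B], so that a radius is available even for an empty
   family. *)
have [r0 [K0 [r0_gt0 _ r0B _]]] := smooth_locally_lipschitz oB Bx0 (smooth_cst _ (0 : R)).
pose r := \big[Num.min/r0]_i (rK i).1; pose K := \sum_i (rK i).2.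
have ri i : r <= (rK i).1 by exact: bigmin_le.
have rr0 : r <= r0 by exact: bigmin_le_id.
have Ki i : (rK i).2 <= K.
  rewrite /K (bigD1 i) //= lerDl sumr_ge0 // => j _.
  by have [] := rKE j.
exists r, K; split.
- by apply: lt_bigmin => // i _; have [] := rKE i.
- by apply: sumr_ge0 => i _; have [] := rKE i.
- move=> i u ur; have [_ _ h _] := rKE i.
  by have [_ ] := h u (le_trans ur (ri i)) => /le_trans; apply.
- by move=> u ur; have [] := r0B u (le_trans ur rr0).
move=> i u u' ur ur'; have [_ _ _ h] := rKE i.
apply: le_trans (h u u' (le_trans ur (ri i)) (le_trans ur' (ri i))) _.
by rewrite ler_wpM2r.
Qed.

(** For [A] the connection matrices this is the geodesic equation with prescribed end points. The
    clamped curve is constant outside [[0, 1]], so it stays in [B] at all times, while the equation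
    is asserted only on the open interval. *)
Lemma local_bvp (B : set V) (A : 'I_d -> V -> 'M[R]_d) x0 : open B -> B x0 ->
  (forall i, smooth_on B (A i)) ->
  exists2 del, 0 < del & forall y0 y1, `|y0 - x0| <= del -> `|y1 - x0| <= del ->
  exists u : R -> V, [/\ u 0 = y0, u 1 = y1, continuous u, forall t, B (u t) &
    let I := [set t : R | 0 < t < 1] in
    smooth_on I u /\ forall t, I t -> 'D_1 ('D_1 u) t = quad A (u t) ('D_1 u t)].
Proof.
move=> oB Bx0 sA.
have sAe (i : 'I_d * 'I_d * 'I_d) : smooth_on B (fun u => A i.1.1 u i.1.2 i.2).
  exact: smooth_entry.
have [r [K [r0 K0 AK rB AL]]] := local_lipschitz_family oB Bx0 sAe.
pose N := [set u : V | `|u - x0| <= r].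
have [||C C0 [qb ql]] := @quad_lip R d A N K K K0 K0.
- by move=> i u j l; exact: (AK (i, j, l)).
- by move=> i u u' j l; exact: (AL (i, j, l)).
have [del del0 delE] := bvp r0 C0 qb ql.
exists del => // y0 y1 y0x y1x.
have [u [v [u0 u1 cu ur uv]]] := delE _ _ y0x y1x.
have uB t : B (u t) by apply: rB; exact: ur.
have oI : open [set t : R | 0 < t < 1].
  rewrite (_ : [set t : R | _] = `]0, 1[%classic); first exact: interval_open.
  by apply/seteqP; split => t /=; rewrite in_itv.
exists u; split=> //=; split.
  by apply: (@quad_smooth R d A B _ u v) => //; move=> t It; exact: uB.
move=> t It.
have uE : \forall s \near t, 'D_1 u s = v s.
  apply: filterS (open_nbhs_nbhs (conj oI It)) => s Is.
  by have [[_ ->] _] := uv s Is.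
rewrite (near_eq_derive _ uE); have [_ [_ ->]] := uv t It.
by rewrite (nbhs_singleton uE).
Qed.

End LocalGeodesics.

(** * Charts and open embeddings *)

Section Charts.
Context {R : realType} {d : nat}.
Local Notation V := 'rV[R]_d.

Lemma cpsi_cdom (T : topologicalType) (k : chart R d T) y : (cphi k @` cdom k) y ->
  cdom k (cpsi k y) /\ cphi k (cpsi k y) = y.
Proof. by move=> [x kx <-]; rewrite cphiK. Qed.

Lemma chart_open_image (T : topologicalType) (k : chart R d T) (U : set T) : open U ->
  open (cphi k @` (cdom k `&` U)).
Proof.
move=> oU; rewrite (_ : _ @` _ = (cphi k @` cdom k) `&` cpsi k @^-1` U).
  by apply: open_preimageI => //; [exact: cimg_open|exact: cpsi_continuous].
apply/seteqP; split=> [y [x [kx Ux] <-]|y [[x kx <-]]].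
  by split; [exists x|rewrite /= cphiK].
by rewrite /= cphiK // => Ux; exists x.
Qed.

Definition img (M : manifold R d) (a : midx M) : set V := phi a @` dom a.

Variable M : manifold R d.
Implicit Types a b : midx M.

Lemma img_open a : open (img a). Proof. exact: cimg_open. Qed.

Lemma phiK a x : dom a x -> psi a (phi a x) = x. Proof. exact: cphiK. Qed.

Lemma psi_dom a y : img a y -> dom a (psi a y). Proof. by case/cpsi_cdom. Qed.

Lemma psiK a y : img a y -> phi a (psi a y) = y. Proof. by case/cpsi_cdom. Qed.

Lemma img_phi a x : dom a x -> img a (phi a x). Proof. by exists x. Qed.

Lemma phi_continuous a x : dom a x -> {for x, continuous (phi a)}.
Proof. exact: cphi_continuous. Qed.

Lemma psi_continuous a y : img a y -> {for y, continuous (psi a)}.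
Proof. exact: cpsi_continuous. Qed.

Lemma dom_open a : open (dom a). Proof. exact: cdom_open. Qed.

Lemma has_signature_unit p q (G : 'M[R]_d) : has_signature p q G -> G \in unitmx.
Proof.
move=> [_ [P uP ->]]; rewrite !unitmx_mul unitmx_tr uP andbT /=.
rewrite unitmxE det_diag unitr_prod // => i _.
by rewrite mxE; case: ifP; rewrite ?unitr1 ?unitrN1.
Qed.

Lemma has_signature_sym p q (G : 'M[R]_d) : has_signature p q G -> G^T = G.
Proof.
by move=> [_ [P uP ->]]; rewrite !trmx_mul trmxK tr_diag_mx mulmxA.
Qed.

Section Metric.
Variables (p q : nat) (g : metric M p q) (b : midx M).

Definition local_metric : V -> 'M[R]_d := g b \o psi b.

Lemma local_metric_smooth : smooth_on (img b) local_metric.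
Proof. exact: mcomp_smooth. Qed.

Lemma local_metric_sym y : img b y -> (local_metric y)^T = local_metric y.
Proof. by move=> /psi_dom/(mcomp_signature g)/has_signature_sym. Qed.

Lemma local_metric_unit y : img b y -> local_metric y \in unitmx.
Proof. by move=> /psi_dom/(mcomp_signature g)/has_signature_unit. Qed.

Lemma scalar_curvatureE x : dom b x -> scalar_curvature g b x = scal local_metric (phi b x).
Proof. by move=> bx; rewrite /scal /local_metric /= phiK. Qed.

End Metric.

End Charts.

Section OpenEmbedding.
Context {R : realType} {d : nat} {Mp M : manifold R d}.
Local Notation V := 'rV[R]_d.
Variable i : Mp -> M.
Hypothesis i_emb : open_embedding i.
Variable m0 : Mp.

Let i_cont : continuous i. Proof. by case: i_emb => -[]. Qed.
Let i_inj : injective i. Proof. by case: i_emb. Qed.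
Let i_open U : open U -> open (i @` U). Proof. by case: i_emb => _ _ + _; exact. Qed.

Definition pinv (x : M) : Mp := xget m0 [set m | i m = x].

Lemma pinvK x : range i x -> i (pinv x) = x.
Proof. by move=> [m _ mx]; apply: (xgetPex m0 (P := [set m | i m = x])); exists m. Qed.

Lemma i_pinv m : pinv (i m) = m.
Proof. by apply: i_inj; apply: pinvK; exists m. Qed.

Lemma range_open : open (range i).
Proof. by apply: i_open; exact: openT. Qed.

Lemma pinv_continuous x : range i x -> {for x, continuous pinv}.
Proof.
move=> rx U; rewrite nbhsE => -[W [oW Wx] WU].
have iWx : (i @` W) x by exists (pinv x) => //; exact: pinvK.
have : nbhs x (i @` W) by apply: open_nbhs_nbhs; split=> //; exact: i_open.
by apply: filterS => y [m Wm <-]; apply: WU; rewrite /= i_pinv.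
Qed.

Section Local.
Variables (a : midx Mp) (b : midx M).

Definition src : set V := phi a @` (dom a `&` i @^-1` dom b).
Definition tgt : set V := phi b @` (dom b `&` i @` dom a).
Let F := local_rep i a b.
Let G := phi a \o pinv \o psi b.

Lemma src_open : open src.
Proof. by apply: chart_open_image; apply: open_comp => [x _|]; [exact: i_cont|exact: dom_open]. Qed.

Lemma tgt_open : open tgt.
Proof. by apply: chart_open_image; apply: i_open; exact: dom_open. Qed.

Lemma src_psi y : src y -> [/\ dom a (psi a y), dom b (i (psi a y)), phi a (psi a y) = y &
  F y = phi b (i (psi a y))].
Proof. by move=> [x [ax bx] <-]; rewrite /F /local_rep /= !phiK. Qed.

Lemma src_img y : src y -> img b (F y).
Proof. by move=> /src_psi[_ bi _ ->]; exact: img_phi. Qed.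

Lemma local_rep_smooth : smooth_on src F.
Proof. by case: i_emb => -[_ sm] _ _ _; exact: sm. Qed.

Lemma local_rep_unit y : src y -> 'J F y \in unitmx.
Proof.
move=> /src_psi[ay biy yE _]; case: i_emb => _ _ _ /(_ a b _ ay biy).
by rewrite /dmap yE.
Qed.

Lemma tgt_pinv y : tgt y -> src (G y) /\ F (G y) = y.
Proof.
move=> [x [+ [m am mx]] <-]; rewrite -{x}mx => bim; rewrite /G /= phiK // i_pinv /F /local_rep /= phiK //.
by split=> //; exists m.
Qed.

Lemma pinv_rep_continuous y : tgt y -> {for y, continuous G}.
Proof.
move=> [x [+ [m am mx]] <-]; rewrite -{x}mx => bim.
apply: continuous_comp; first by apply: psi_continuous; exact: img_phi.
rewrite phiK //; apply: continuous_comp; first by apply: pinv_continuous; exists m.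
by rewrite i_pinv; exact: phi_continuous.
Qed.

(** An open embedding directly provides only a continuous inverse; smoothness follows from the
    invertible Jacobian through [smooth_inverse]. *)
Lemma pinv_rep_smooth : smooth_on tgt G.
Proof.
apply: (@smooth_inverse _ _ src tgt F G); first exact: src_open.
- exact: tgt_open.
- exact: local_rep_smooth.
- by move=> y /tgt_pinv[].
- by move=> y /tgt_pinv[].
- exact: pinv_rep_continuous.
- exact: local_rep_unit.
Qed.

End Local.
End OpenEmbedding.

(** * Boundary points are zeros of the conformal factor *)

Section GeodesicStep.
Context {R : realType} {d p q : nat} {Mp M : manifold R d}.
Local Notation V := 'rV[R]_d.
Variables (i : Mp -> M) (gp : metric Mp p q) (m0 : Mp).
Hypotheses (i_emb : open_embedding i) (gp_complete : geodesically_complete gp).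
Variables (g : metric M p q) (f : M -> R).
Hypothesis sf : smooth_fun f.
Hypothesis f0 : forall m, f (i m) != 0.
Hypothesis gpE : forall m a b, dom a m -> dom b (i m) ->
  gp a m = dmap i a b m *m ((f (i m)) ^- 2 *: g b (i m)) *m (dmap i a b m)^T.

Definition local_fun (b : midx M) : V -> R := f \o psi b.

(** A metric wherever [f] is not zero, hence possibly also outside the image of [i]; geodesics can
    therefore be drawn across the edge of [M_+]. *)
Definition local_scaled (b : midx M) (y : V) : 'M[R]_d :=
  (local_fun b y) ^- 2 *: local_metric g b y.

Definition nonzero_img (b : midx M) : set V :=
  img b `&` local_fun b @^-1` [set x | x != 0].

Lemma local_fun_smooth b : smooth_on (img b) (local_fun b).
Proof. exact: sf. Qed.

Lemma nonzero_img_open b : open (nonzero_img b).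
Proof. by apply: rescale_open; [exact: img_open|exact: local_fun_smooth]. Qed.

Lemma local_scaled_smooth b : smooth_on (nonzero_img b) (local_scaled b).
Proof.
by apply: rescale_smooth; [exact: img_open|exact: local_fun_smooth|exact: local_metric_smooth].
Qed.

Lemma local_scaled_sym b y : nonzero_img b y -> (local_scaled b y)^T = local_scaled b y.
Proof. by apply: rescale_sym => z; exact: local_metric_sym. Qed.

Lemma local_scaled_unit b y : nonzero_img b y -> local_scaled b y \in unitmx.
Proof. by apply: rescale_unit => z; exact: local_metric_unit. Qed.

Lemma src_nonzero a b y : src i a b y -> nonzero_img b (local_rep i a b y).
Proof.
move=> ay; split; first exact: src_img.
by have [_ bi _ ->] := src_psi ay; rewrite /local_fun /= phiK.
Qed.

Lemma local_metric_pullback a b : {in src i a b, local_metric gp a =1 fun y =>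
  'J (local_rep i a b) y *m local_scaled b (local_rep i a b y) *m ('J (local_rep i a b) y)^T}.
Proof.
move=> y; rewrite inE => sy; have [ay biy yE FE] := src_psi sy.
rewrite /local_metric /local_scaled /= (gpE ay biy) /dmap yE FE.
by rewrite /local_fun /local_metric /= phiK.
Qed.

(** Moves the curvature from charts of [Mp] to charts of [M], which also cover the boundary
    points. *)
Lemma scalar_curvature_scaled a b m : dom a m -> dom b (i m) ->
  scalar_curvature gp a m = scal (local_scaled b) (phi b (i m)).
Proof.
move=> am bm; have sy : src i a b (phi a m) by exists m.
have [_ _ _ FE] := src_psi sy.
rewrite (scalar_curvatureE gp am); have := (scal_pullback
  (@src_open _ _ _ _ i i_emb a b) (@nonzero_img_open b)
  (@src_nonzero a b) (@local_rep_smooth _ _ _ _ i i_emb a b)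
  (@local_rep_unit _ _ _ _ i i_emb a b) (@local_scaled_smooth b)
  (@local_scaled_sym b) (@local_scaled_unit b) (@local_metric_pullback a b) sy).
by move=> E; apply: etrans E _; rewrite FE phiK.
Qed.

Section Curve.
Variables (b : midx M) (u : R -> V) (ts : R).
Let I := [set t : R | 0 < t < ts].
Hypotheses (ub : forall t, nonzero_img b (u t)) (su : smooth_on I u).
Hypothesis geo_u : forall t, I t -> geo (local_scaled b) (u t) ('D_1 u t) ('D_1 ('D_1 u) t) = 0.
Hypothesis ur : forall t, I t -> range i (psi b (u t)).

Let gam : R -> Mp := pinv i m0 \o psi b \o u.

Let oI : open I.
Proof.
rewrite (_ : I = `]0, ts[%classic); first exact: interval_open.
by apply/seteqP; split => t /=; rewrite in_itv.
Qed.

Let ubI t : img b (u t). Proof. by have [] := ub t. Qed.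

Lemma pulled_curve_continuous t : I t -> {for t, continuous gam}.
Proof.
move=> It; apply: (@continuous_comp _ _ _ u (pinv i m0 \o psi b)).
  exact: smooth_continuous su It.
apply: continuous_comp; first by apply: psi_continuous.
by apply: pinv_continuous => //; exact: ur.
Qed.

Let Ia (a : midx Mp) := I `&` gam @^-1` dom a.

Let oIa a : open (Ia a).
Proof. by apply: open_preimageI => //; [exact: pulled_curve_continuous|exact: dom_open]. Qed.

Let u_tgt a t : Ia a t -> tgt i a b (u t).
Proof.
move=> [It at_]; exists (psi b (u t)); last exact: psiK.
split; first exact: psi_dom.
by exists (gam t) => //; apply: pinvK; exact: ur.
Qed.

Let su' a : smooth_on (Ia a) u. Proof. by apply: smooth_sub su => t []. Qed.

Lemma pulled_curve_smooth a : smooth_on (Ia a) (phi a \o gam).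
Proof.
have sG := @pinv_rep_smooth _ _ _ _ i i_emb m0 a b.
by apply: (smooth_comp_mx (g := phi a \o pinv i m0 \o psi b) (@oIa a) (@tgt_open _ _ _ _ i i_emb a b) (@u_tgt a)).
Qed.

(** The local representative of [i] sends the curve back to [u], so [geodesic_pullback] applies. The
    identity holds only near each time, whence the comparison of first derivatives on a whole
    neighbourhood before differentiating again. *)
Lemma pulled_curve_geodesic : geodesic gp I gam.
Proof.
split; first by split; [exact: pulled_curve_continuous|exact: pulled_curve_smooth].
move=> a t It at_ /= k; set v := phi a \o gam.
have Iat : Ia a t by [].
have vE s : Ia a s -> local_rep i a b (v s) = u s.
  by move=> /u_tgt/(tgt_pinv i_emb m0)[].
have vsrc s : Ia a s -> src i a b (v s).
  by move=> /u_tgt/(tgt_pinv i_emb m0)[].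
have sv := pulled_curve_smooth a.
have Fv : \forall s \near t, (local_rep i a b \o v) s = u s.
  by apply: filterS (open_nbhs_nbhs (conj (@oIa a) Iat)) => s /vE.
have DFv : \forall s \near t, 'D_1 (local_rep i a b \o v) s = 'D_1 u s.
  apply: filterS (open_nbhs_nbhs (conj (@oIa a) Iat)) => s Ias.
  apply: near_eq_derive.
  by apply: filterS (open_nbhs_nbhs (conj (@oIa a) Ias)) => r /vE.
have := geo_u It.
rewrite -(near_eq_derive _ DFv) -(nbhs_singleton DFv) -{1}(nbhs_singleton Fv).
move=> /(geodesic_pullback
  (@src_open _ _ _ _ i i_emb a b) (@nonzero_img_open b)
  (@src_nonzero a b) (@local_rep_smooth _ _ _ _ i i_emb a b)
  (@local_rep_unit _ _ _ _ i i_emb a b) (@local_scaled_smooth b)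
  (@local_scaled_sym b) (@local_scaled_unit b) (@local_metric_pullback a b)
  (@oIa a) Iat sv vsrc).
move=> /(congr1 (fun w : V => w 0 k)); rewrite geoE mxE => E; apply: etrans E.
have D1 : derive1 v = 'D_1 v by apply/funext => s; rewrite derive1E.
by rewrite /derive1n /= D1 derive1E.
Qed.

(** The extended geodesic, mapped by [i], and the curve [psi b \o u] are both continuous at [ts] and
    coincide just before it. As [M] is Hausdorff, they coincide at [ts]. *)
Lemma complete_curve_end : 0 < ts -> {for ts, continuous u} -> range i (psi b (u ts)).
Proof.
move=> ts0 cu.
have itvI : is_interval I.
  rewrite (_ : I = `]0, ts[%classic); first exact: interval_is_interval.
  by apply/seteqP; split => t /=; rewrite in_itv.
have Ine : I !=set0 by exists (ts / 2); rewrite /I /= divr_gt0 // ltr_pdivrMr // ltr_pMr // ltr1n.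
have [gam' [[gc _] _] gamE] := gp_complete oI itvI Ine pulled_curve_geodesic.
suff -> : psi b (u ts) = i (gam' ts) by exists (gam' ts).
apply: (mhausdorff (m := M)) => U W Uts Wts.
have cpsi : {for ts, continuous (psi b \o u)}.
  by apply: continuous_comp => //; exact: psi_continuous.
have cig : {for ts, continuous (i \o gam')}.
  by apply: continuous_comp; [exact: gc|case: i_emb => -[ci _] _ _ _; exact: ci].
have n1 : \forall s \near ts, U (psi b (u s)) by exact: cpsi.
have n2 : \forall s \near ts, W (i (gam' s)) by exact: cig.
have n3 : \forall s \near ts, U (psi b (u s)) /\ W (i (gam' s)) by near=> s; split; near: s.
have /nbhs_ballP[e /= e0 eUW] := n3.
(* A positive time strictly before [ts] and within [e] of it. *)
pose t := ts - Num.min (e / 2) (ts / 2).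
have mpos : 0 < Num.min (e / 2) (ts / 2) by rewrite lt_min !divr_gt0.
have mts : Num.min (e / 2) (ts / 2) < ts.
  by rewrite gt_min (_ : ts / 2 < ts) ?orbT // ltr_pdivrMr // ltr_pMr // ltr1n.
have It : I t by rewrite /I /= /t subr_gt0 mts ltrBlDr ltrDl.
have [] := eUW t.
  rewrite -ball_normE /= /t opprB addrCA subrr addr0 gtr0_norm //.
  by rewrite gt_min (_ : e / 2 < e) // ltr_pdivrMr // ltr_pMr // ltr1n.
rewrite /= gamE ?inE // pinvK; last exact: ur.
by move=> Ut Wt; exists (psi b (u t)).
Unshelve. all: by end_near. Qed.

End Curve.

(** The geodesic towards [x] may leave [M_+] before it reaches [x], so the contradiction is sought
    at the first exit time, where [complete_curve_end] puts the curve back into [M_+]. *)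
Lemma closure_range_zero x : closure (range i) x -> ~ range i x -> f x = 0.
Proof.
move=> cx nx; apply/eqP/negPn/negP => fx.
have [b bx] := atlas_cover x.
have x0 : nonzero_img b (phi b x).
  by split; [exact: img_phi|rewrite /local_fun /= phiK].
have [del del0 delE] := local_bvp (@nonzero_img_open b) x0 (fun k =>
  @smooth_conn _ _ _ _ k (@nonzero_img_open b) (@local_scaled_unit b) (@local_scaled_smooth b)).
have nx' : nbhs x (dom b `&` phi b @^-1` ball (phi b x) del).
  apply: filterI; first by apply: open_nbhs_nbhs; split=> //; exact: dom_open.
  by apply: (phi_continuous bx); exact: nbhsx_ballx.
have [_ [[m _ <-] [bm mx]]] := cx _ nx'.
have [||u [u0 u1 cu uB [su ue]]] := delE (phi b (i m)) (phi b x).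
- by move: mx; rewrite /= -ball_normE /= distrC => /ltW.
- by rewrite subrr normr0 ltW.
(* The nonnegative times spent outside [M_+]; 1 is among them because the curve ends at [x]. *)
pose Z := [set t : R | 0 <= t /\ ~ range i (psi b (u t))].
have oO : open ((psi b \o u) @^-1` range i).
  apply: open_comp => [t _|]; last exact: range_open.
  by apply: continuous_comp; [exact: cu|apply: psi_continuous; have [] := uB t].
have Z1 : Z 1 by split; rewrite // u1 phiK.
have Zinf : has_inf Z by split; [exists 1|exists 0 => t []].
pose ts := inf Z.
have ts_ge0 : 0 <= ts by apply: lb_le_inf; [exists 1|move=> t []].
have ts_le1 : ts <= 1 by apply: ge_inf => //; exact: Zinf.2.
have below t : 0 <= t < ts -> range i (psi b (u t)).
  move=> /andP[t0 tts]; apply: contrapT => nt.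
  by move: tts; rewrite ltNge => /negP; apply; apply: ge_inf; [exact: Zinf.2|split].
(* The infimum is itself an exit time: [M_+] is open, so being inside at [ts] would persist for a
   while, yet there are exit times arbitrarily close after [ts]. *)
have nts : ~ range i (psi b (u ts)).
  move=> rts.
  have : nbhs ts ((psi b \o u) @^-1` range i) by exact: open_nbhs_nbhs.
  move=> /nbhs_ballP[e /= e0 eO].
  have [t [t0 nt] te] := inf_adherent e0 Zinf.
  have tst : ts <= t by apply: ge_inf; [exact: Zinf.2|split].
  apply: nt; apply: (eO t); rewrite -ball_normE /= distrC ger0_norm ?subr_ge0 //.
  by rewrite ltrBlDl.
have ts0 : 0 < ts.
  rewrite lt_neqAle ts_ge0 andbT; apply/eqP => ts0; apply: nts.
  by rewrite -ts0 u0 phiK //; exists m.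
apply: nts; apply: (@complete_curve_end b u ts) => //.
- by apply: smooth_sub su => t /= /andP[t0 tts]; rewrite t0 (lt_le_trans tts).
- move=> t /= /andP[t0 tts]; rewrite ue /=; last by rewrite t0 (lt_le_trans tts).
  by rewrite /geo /quad addNr.
- by move=> t /= /andP[t0 tts]; apply: below; rewrite ltW.
- exact: cu.
Qed.

End GeodesicStep.

(** * Slice coordinates *)

Lemma convex_lt (R : realFieldType) (a b m t : R) : a < m -> b < m -> 0 <= t -> t <= 1 ->
  (1 - t) * a + t * b < m.
Proof.
move=> am bm t0 t1; have [->|tn] := eqVneq t 0; first by rewrite subr0 mul1r mul0r addr0.
have tp : 0 < t by rewrite lt_def tn.
rewrite (_ : m = (1 - t) * m + t * m); last by ring.
by rewrite ler_ltD ?ltr_pM2l // ler_wpM2l ?subr_ge0 // ltW.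
Qed.

Lemma ltr_dist_trans (R : realFieldType) (a a0 e' e : R) :
  a0 - e' < a -> a < a0 + e' -> e' < e -> `|a0 - a| < e.
Proof. by move=> *; rewrite ltr_norml; apply/andP; split; lra. Qed.

Section Slice.
Context {R : realType} {d : nat}.
Local Notation V := 'rV[R]_d.
Variable j : 'I_d.

(** Replacement of the [j]-th coordinate, written additively rather than by cases so that it is
    visibly affine. *)
Definition setj (y : V) (s : R) : V := y + (s - y 0 j) *: delta_mx 0 j.

Lemma setj_j y s : setj y s 0 j = s.
Proof. by rewrite !mxE !eqxx mulr1 addrC subrK. Qed.

Lemma setj_l y s l : l != j -> setj y s 0 l = y 0 l.
Proof. by move=> lj; rewrite !mxE (negPf lj) mulr0 addr0. Qed.

Lemma setj_eq (y z : V) : (forall l, l != j -> y 0 l = z 0 l) -> y 0 j = z 0 j -> y = z.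
Proof.
move=> yz yzj; apply/rowP => l; have [->//|lj] := eqVneq l j; exact: yz.
Qed.

Lemma setj_id y : setj y (y 0 j) = y. Proof. by rewrite /setj subrr scale0r addr0. Qed.

Lemma setjK y s t : setj (setj y s) t = setj y t.
Proof. by apply: setj_eq => [l lj|]; rewrite ?setj_j // !setj_l. Qed.

Lemma setj_line y s t : setj y (s + t) = setj y s + t *: delta_mx 0 j.
Proof. by apply/rowP => l; rewrite !mxE; ring. Qed.

Lemma setj_norm (x0 y : V) s r : `|setj y (x0 0 j) - x0| <= r -> `|s - x0 0 j| <= r ->
  `|setj y s - x0| <= r.
Proof.
move=> yr sr; have r0 : 0 <= r by exact: le_trans sr.
apply/(rV_norm_le _ r0) => l; move/(rV_norm_le _ r0)/(_ l): yr.
have [->|lj] := eqVneq l j; rewrite [X in `|X|]mxE [X in `|_ + X|]mxE => h.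
  by rewrite [X in `|X|]mxE [X in `|_ + X|]mxE setj_j.
by rewrite [X in `|X|]mxE [X in `|_ + X|]mxE setj_l // -(setj_l y (x0 0 j) lj).
Qed.

Lemma smooth_setj (A : set V) (k : V -> R) : open A ->
  smooth_on A k -> smooth_on A (fun y => setj y (k y)).
Proof.
move=> oA sk; apply: smooth_mx => // a l; rewrite (ord1 a).
have sid i : smooth_on A (fun y : V => y 0 i) by apply: smooth_entry => //; exact: smooth_id.
under eq_fun do rewrite !mxE; apply: smoothD => //; apply: smoothM => //; last exact: smooth_cst.
exact: smoothB.
Qed.

Lemma setj_continuous s : continuous (setj ^~ s).
Proof.
by move=> y; apply: (smooth_continuous (A := setT)) => //; apply: smooth_setj;
   [exact: openT|exact: smooth_cst].
Qed.

Lemma derive_setj (k : V -> R) (y v : V) : differentiable k y ->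
  differentiable (fun x => setj x (k x)) y ->
  'D_v (fun x => setj x (k x)) y = setj v ('D_v k y).
Proof.
move=> dk dT; have dc l : is_derive y v (fun x : V => x 0 l) (v 0 l).
  have di : differentiable (@id V) y by exact: (smooth_differentiable (@smooth_id _ _ setT)).
  apply: DeriveDef; first by apply: diff_derivable; exact: differentiable_entry di.
  by rewrite -(derive_entry _ _ _ di) derive_id.
have hk : is_derive y v k ('D_v k y) by apply: derivableP; exact: diff_derivable.
apply/rowP => l; rewrite derive_entry //.
move: ('D_v k y) hk => k' hk; apply: derive_val.
have -> : (fun x => setj x (k x) 0 l) = (fun x : V => x 0 l + (delta_mx 0 j : V) 0 l * (k x - x 0 j)).
  by apply/funext => x; rewrite !mxE mulrC.
have -> : setj v k' 0 l = v 0 l + (delta_mx 0 j : V) 0 l * (k' - v 0 j) by rewrite !mxE mulrC.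
by apply: is_deriveD; apply: is_deriveZ; apply: is_deriveB.
Qed.

Variables (B : set V) (h : V -> R) (x0 : V).
Hypotheses (oB : open B) (Bx0 : B x0) (sh : smooth_on B h) (hx0 : h x0 = 0).
Hypothesis dh : 0 < partial j h x0.

Lemma line_increasing r y s t : (forall z, `|z - x0| <= r -> B z /\ 0 < partial j h z) ->
  `|setj y (x0 0 j) - x0| <= r -> `|s - x0 0 j| <= r -> `|t - x0 0 j| <= r -> s < t ->
  h (setj y s) < h (setj y t).
Proof.
move=> rB yr sr tr st.
have str a : s <= a <= t -> `|a - x0 0 j| <= r.
  move=> /andP[sa at_]; move: sr tr; rewrite !ler_norml => /andP[s1 s2] /andP[t1 t2].
  by apply/andP; split; lra.
have df a : 0 <= a <= t - s -> differentiable h (setj y s + a *: delta_mx 0 j).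
  move=> /andP[a0 ats]; rewrite -setj_line; apply: smooth_differentiable sh _.
  by have [] := rB (setj y (s + a)) (setj_norm yr (str _ _)) => //; rewrite lerDl a0 /= -lerBrDl.
have ts0 : 0 < t - s by rewrite subr_gt0.
have [a a01] := @MVT_smooth R (fun a => h (setj y s + a *: delta_mx 0 j)) _ (t - s) ts0
  (fun a a01 => is_derive_line (df a a01)).
have tE : s + (t - s) = t by rewrite addrC subrK.
rewrite scale0r addr0 -setj_line tE => hE; rewrite -subr_gt0 hE mulr_gt0 //.
rewrite -setj_line; move: a01 => /andP[a0 ats].
by have [] := rB (setj y (s + a)) (setj_norm yr (str _ _)) => //; rewrite lerDl a0 /= -lerBrDl.
Qed.

(** Prepares the intermediate value theorem: [h] increases in direction [j] in the box, and the gap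
    [m] at the two ends of the line through [x0] persists on lines over base points within [rho]. *)
Lemma slice_box : exists r rho m : R, [/\ 0 < r, 0 < rho <= r, 0 < m,
  (forall y, `|y - x0| <= r -> B y /\ 0 < partial j h y) &
  forall z, `|setj z (x0 0 j) - x0| < rho ->
    h (setj z (x0 0 j - r)) < - m /\ m < h (setj z (x0 0 j + r))].
Proof.
have n1 : \forall y \near x0, B y by exact: open_nbhs_nbhs.
have n2 : \forall y \near x0, 0 < partial j h y.
  have : {for x0, continuous (partial j h)}.
    exact: smooth_continuous (smooth_partial j sh) Bx0.
  by move=> /cvgrPdist_lt/(_ _ dh); apply: filterS => y; rewrite ltr_norml => /andP[_]; rewrite ltrBlDr ltrDl.
have n3 : \forall y \near x0, B y /\ 0 < partial j h y by near=> y; split; near: y.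
have /nbhs_ballP[e /= e0 eB] := n3.
pose r := e / 2; have r0 : 0 < r by rewrite divr_gt0.
have rB y : `|y - x0| <= r -> B y /\ 0 < partial j h y.
  move=> yr; apply: eB; rewrite -ball_normE /= distrC (le_lt_trans yr) //.
  by rewrite ltr_pdivrMr // ltr_pMr // ltr1n.
have x0s : `|setj x0 (x0 0 j) - x0| <= r by rewrite setj_id subrr normr0 ltW.
have rr : `|x0 0 j - r - x0 0 j| <= r by rewrite addrAC subrr add0r normrN gtr0_norm.
have rr' : `|x0 0 j + r - x0 0 j| <= r by rewrite addrAC subrr add0r gtr0_norm.
have r00 : `|x0 0 j - x0 0 j| <= r by rewrite subrr normr0 ltW.
have lo0 : h (setj x0 (x0 0 j - r)) < 0.
  by rewrite -hx0 -{3}(setj_id x0); apply: line_increasing rB _ _ _ _ => //; rewrite ltrBlDr ltrDl.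
have hi0 : 0 < h (setj x0 (x0 0 j + r)).
  by rewrite -hx0 -{1}(setj_id x0); apply: line_increasing rB _ _ _ _ => //; rewrite ltrDl.
pose m := Num.min (- h (setj x0 (x0 0 j - r))) (h (setj x0 (x0 0 j + r))) / 2.
have m0 : 0 < m by rewrite divr_gt0 // lt_min oppr_gt0 lo0.
have mlo : h (setj x0 (x0 0 j - r)) < - m.
  rewrite ltrNr /m ltr_pdivrMr // gt_min; apply/orP; left.
  by rewrite ltr_pMr ?ltr1n // oppr_gt0.
have mhi : m < h (setj x0 (x0 0 j + r)).
  by rewrite /m ltr_pdivrMr // gt_min ltr_pMr ?ltr1n ?orbT.
have ch s : `|s - x0 0 j| <= r -> {for x0, continuous (fun z => h (setj z s))}.
  move=> sr; apply: (@continuous_comp _ _ _ (setj ^~ s) h); first exact: setj_continuous.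
  apply: smooth_continuous sh _.
  by have [] := rB _ (setj_norm x0s sr).
have nlo : \forall z \near x0, h (setj z (x0 0 j - r)) < - m.
  by apply: (cvgr_lt _ (ch _ rr)).
have nhi : \forall z \near x0, m < h (setj z (x0 0 j + r)).
  by apply: (cvgr_gt _ (ch _ rr')).
have nlh : \forall z \near x0, h (setj z (x0 0 j - r)) < - m /\ m < h (setj z (x0 0 j + r)).
  by near=> z; split; near: z.
have /nbhs_ballP[t /= t0 tB] := nlh.
exists r, (Num.min r t), m; split => //; first by rewrite lt_min r0 t0 ge_min lexx.
move=> z; rewrite lt_min => /andP[_ zt].
have := tB (setj z (x0 0 j)); rewrite !setjK; apply.
by rewrite -ball_normE /= distrC.
Unshelve. all: by end_near. Qed.

(** [h] replaces the [j]-th coordinate. The inverse is found on each line in direction [j] by the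
    intermediate value theorem and monotonicity; this makes the image [W] an explicit box, whose
    convexity is needed for the segments in [zero_set_closure]. *)
Lemma slice_coordinates : exists (N W : set V) (Ps : V -> V),
  let Th := fun y => setj y (h y) in
  [/\ open N, open W, N x0 & N `<=` B] /\
  [/\ (forall y, N y -> W (Th y) /\ Ps (Th y) = y),
      (forall z, W z -> N (Ps z) /\ Th (Ps z) = z),
      smooth_on N Th, smooth_on W Ps &
      forall z z' t, W z -> W z' -> 0 <= t <= 1 -> W (z + t *: (z' - z))].
Proof.
have [r [rho [m [r0 /andP[rho0 rhor] m0 rB lohi]]]] := slice_box.
pose c := x0 0 j; pose Th y := setj y (h y).
(* Only the coordinates other than [j] are constrained, so motion in direction [j] never leaves
   [Q]. *)
pose Q := [set z | `|setj z c - x0| < rho].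
have Qr z : Q z -> `|setj z c - x0| <= r by move=> /ltW/le_trans; apply.
pose W := Q `&` [set z | `|z 0 j| < m].
pose N0 := Q `&` [set y | `|y 0 j - c| < r].
pose N := N0 `&` h @^-1` [set a | `|a| < m].
have coordc : continuous (fun z : V => z 0 j) by exact: coord_continuous.
have oabs (e a : R) : open [set s : R | `|s - a| < e].
  rewrite (_ : [set s : R | _] = ball a e); first exact: ball_open.
  by apply/seteqP; split => s; rewrite -ball_normE /= distrC.
have oQ : open Q.
  rewrite (_ : Q = (setj ^~ c) @^-1` ball x0 rho).
    by apply: open_comp => [z _|]; [exact: setj_continuous|exact: ball_open].
  by apply/seteqP; split => z; rewrite /Q /= -ball_normE /= distrC.
have oabs0 (e : R) : open [set s : R | `|s| < e].
  by have := oabs e 0; under [X in open X -> _]eq_set do rewrite subr0.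
have oW : open W.
  apply: openI => //.
  by apply: (open_comp (f := fun z : V => z 0 j)) (oabs0 m) => z _; exact: coordc.
have oN0 : open N0.
  apply: openI => //.
  by apply: (open_comp (f := fun z : V => z 0 j)) (oabs r c) => z _; exact: coordc.
have N0r y : N0 y -> `|y - x0| <= r.
  by move=> [Qy /ltW yr]; rewrite -(setj_id y); apply: setj_norm => //; exact: Qr.
have N0B : N0 `<=` B by move=> y /N0r/rB[].
have oN : open N.
  apply: open_preimageI => //.
  by move=> y /N0B; exact: smooth_continuous sh.
have Qset z s : Q z -> Q (setj z s) by rewrite /Q /= setjK.
have incr z s t : Q z -> `|s - c| <= r -> `|t - c| <= r -> s < t -> h (setj z s) < h (setj z t).
  by move=> /Qr Qz; exact: line_increasing rB Qz.
have inj z s t : Q z -> `|s - c| <= r -> `|t - c| <= r -> h (setj z s) = h (setj z t) -> s = t.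
  move=> Qz sr tr hst; have [st|ts|//] := ltgtP s t.
    by have := incr _ _ _ Qz sr tr st; rewrite hst ltxx.
  by have := incr _ _ _ Qz tr sr ts; rewrite hst ltxx.
(* The implication under the existential lets [choice] return a total function; outside [W] the
   value is arbitrary. *)
have sol z : exists s, W z -> `|s - c| < r /\ h (setj z s) = z 0 j.
  have [[Qz zm]|] := pselect (W z); last by exists 0.
  have [lo hi] := lohi z Qz; move: zm; rewrite /= ltr_norml => /andP[zm1 zm2].
  have [|||s] := @IVT R (fun s => h (setj z s)) (c - r) (c + r) (z 0 j).
  - by rewrite lerBlDr -addrA lerDl addr_ge0 // ltW.
  - apply: continuous_in_subspaceT => s; rewrite inE /= in_itv /= => /andP[s1 s2].
    apply: (@continuous_comp _ _ _ (setj z) h).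
      apply: cvgD; first exact: cvg_cst.
      by apply: cvgZr_tmp; apply: cvgB; [exact: cvg_id|exact: cvg_cst].
    apply: smooth_continuous sh _; have [] // := rB (setj z s).
    apply: setj_norm; first exact: Qr.
    by rewrite ler_norml lerBrDl s1 /= lerBlDl.
  - rewrite ge_min le_max; apply/andP; split; apply/orP.
      by left; rewrite (ltW (lt_trans lo zm1)).
    by right; rewrite (ltW (lt_trans zm2 hi)).
  rewrite in_itv /= => /andP[s1 s2] hs; exists s => _; split => //.
  have s1' : c - r < s.
    rewrite lt_neqAle s1 andbT; apply/eqP => sE.
    by move: lo; rewrite -/c sE hs => /(lt_trans zm1); rewrite ltxx.
  have s2' : s < c + r.
    rewrite lt_neqAle s2 andbT; apply/eqP => sE.
    by move: hi; rewrite -/c -sE hs => /(lt_trans zm2); rewrite ltxx.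
  by rewrite ltr_norml; apply/andP; split; lra.
have [s sE] := choice sol; pose Ps z := setj z (s z).
have PN z : W z -> N (Ps z).
  move=> Wz; have [sr hs] := sE z Wz; have [Qz zm] := Wz.
  by split; [split; [exact: Qset|rewrite /= setj_j]|rewrite /= hs].
have TP z : W z -> Th (Ps z) = z.
  by move=> Wz; have [sr hs] := sE z Wz; rewrite /Th /Ps setjK hs setj_id.
have TW y : N y -> W (Th y).
  by move=> [[Qy yr] hm]; split; [exact: Qset|rewrite /= setj_j].
have PT y : N y -> Ps (Th y) = y.
  move=> Ny; have [sr hE] := sE _ (TW y Ny); have [[Qy yr] hm] := Ny.
  have TE u : setj (Th y) u = setj y u by exact: setjK.
  have Tj : Th y 0 j = h y by exact: setj_j.
  rewrite TE Tj in hE; rewrite /Ps TE -[RHS]setj_id; congr (setj y _).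
  by apply: (inj y); rewrite // ?setj_id //; exact: ltW.
have sTh : smooth_on N Th.
  by apply: smooth_setj => //; apply: smooth_sub sh => y [/N0B].
exists N, W, Ps; split; first split => //.
- split; last by rewrite /= hx0 normr0.
  by split; rewrite /Q /= ?setj_id subrr normr0.
- by move=> y [/N0B].
split=> //.
- by move=> y Ny; split; [exact: TW|exact: PT].
- by move=> z Wz; split; [exact: PN|exact: TP].
- have sTh' : smooth_on N Th := sTh.
  apply: (@smooth_inverse _ _ N W Th Ps oN oW sTh'); [by move=> z /PN|by move=> z /TP| |].
  + move=> z0 Wz0.
    have [s0r hs0] := sE z0 Wz0.
    have cs : {for z0, continuous s}.
      apply/(@cvgrPdist_lt _ _ _ (nbhs z0) (nbhs_filter z0)) => e e0.
      (* Small enough that [s z0 - e'] and [s z0 + e'] stay where [h] increases. The strict signs of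
         [h - z_j] at these two heights persist near [z0] and trap [s z] between them. *)
      pose e' := Num.min (e / 2) ((r - `|s z0 - c|) / 2).
      have e'0 : 0 < e' by rewrite lt_min !divr_gt0 // subr_gt0.
      have e'r t : `|t| <= e' -> `|s z0 + t - c| <= r.
        move=> te; rewrite addrAC (le_trans (ler_normD _ _)) //.
        rewrite -lerBrDl (le_trans te) // ge_min; apply/orP; right.
        by rewrite ler_pdivrMr // ler_pMr ?ler1n // subr_gt0.
      have lr : `|s z0 - e' - c| <= r by apply: e'r; rewrite normrN gtr0_norm.
      have hr : `|s z0 + e' - c| <= r by apply: e'r; rewrite gtr0_norm.
      have Qz0 : Q z0 by case: Wz0.
      have chz t : `|t - c| <= r -> {for z0, continuous (fun z => h (setj z t) - z 0 j)}.
        move=> tr; apply: (@cvgB _ _ _ (nbhs z0) _); last exact: coordc.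
        apply: (@continuous_comp _ _ _ (setj ^~ t) h); first exact: setj_continuous.
        by apply: smooth_continuous sh _; have [] := rB _ (setj_norm (Qr _ Qz0) tr).
      have n1 : \forall z \near z0, h (setj z (s z0 - e')) - z 0 j < 0.
        apply: (cvgr_lt _ (chz _ lr)); rewrite subr_lt0 -hs0.
        by apply: incr => //; [exact: ltW|rewrite ltrBlDr ltrDl].
      have n2 : \forall z \near z0, 0 < h (setj z (s z0 + e')) - z 0 j.
        apply: (cvgr_gt _ (chz _ hr)); rewrite subr_gt0 -hs0.
        by apply: incr => //; [exact: ltW|rewrite ltrDl].
      have n3 : \forall z \near z0, W z by exact: open_nbhs_nbhs.
      apply: filterS3 n1 n2 n3 => z; rewrite subr_lt0 subr_gt0 => z1 z2 Wz.
      have [sr hs] := sE z Wz; have [Qz _] := Wz; rewrite -hs in z1 z2.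
      have s1 : s z0 - e' < s z.
        rewrite ltNge; apply/negP; rewrite le_eqVlt => /predU1P[sz|/(incr z _ _ Qz (ltW sr) lr)].
          by move: z1; rewrite sz ltxx.
        by move=> /(lt_trans z1); rewrite ltxx.
      have s2 : s z < s z0 + e'.
        rewrite ltNge; apply/negP; rewrite le_eqVlt => /predU1P[sz|/(incr z _ _ Qz hr (ltW sr))].
          by move: z2; rewrite sz ltxx.
        by move=> /(lt_trans z2); rewrite ltxx.
      have e'e : e' < e by rewrite gt_min (_ : e / 2 < e) // ltr_pdivrMr // ltr_pMr // ltr1n.
      exact: ltr_dist_trans s1 s2 e'e.
    apply: (@cvgD _ _ _ (nbhs z0) _); first exact: cvg_id.
    apply: (@cvgZr_tmp _ _ _ (nbhs z0) _); apply: (@cvgB _ _ _ (nbhs z0) _) => //.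
    exact: coordc.
  (* A vector killed by the Jacobian has zero coordinates except the [j]-th, and that one times the
     positive [partial j h] is zero as well. *)
  + move=> y Ny; rewrite -row_free_unit; apply: inj_row_free => v.
    have dTh : differentiable Th y by exact: smooth_differentiable Ny.
    have By : B y by case: Ny => /N0B.
    have dh' : differentiable h y by exact: smooth_differentiable sh By.
    rewrite -deriveEjacobian // => vE.
    have vl l : ('D_v Th y) 0 l = v 0 l + ('D_v h y - v 0 j) * (l == j)%:R.
      by rewrite derive_setj // !mxE eqxx.
    have v0 l : l != j -> v 0 l = 0.
      by move=> lj; have := vl l; rewrite vE mxE (negPf lj) mulr0 addr0.
    have hv : 'D_v h y = 0.
      by have := vl j; rewrite vE mxE eqxx mulr1 addrC subrK.
    apply: setj_eq => [l lj|]; first by rewrite v0 // mxE.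
    move: hv; rewrite derive_drow // (bigD1 j) //= big1 => [|l lj]; last by rewrite v0 // mul0r.
    rewrite addr0 [drow _ _ _ _]mxE mxE => /eqP; rewrite mulf_eq0 => /orP[/eqP//|].
    by have [_] := rB y (N0r _ Ny.1) => /gt_eqF ->.
move=> z z' t [Qz zm] [Qz' zm'] /andP[t0 t1]; split.
  rewrite /Q /=.
  have -> : setj (z + t *: (z' - z)) c - x0 = (1 - t) *: (setj z c - x0) + t *: (setj z' c - x0).
    by apply/rowP => l; rewrite !mxE; ring.
  rewrite (le_lt_trans (ler_normD _ _)) // !normrZ ger0_norm ?subr_ge0 // ger0_norm //.
  exact: convex_lt.
rewrite /= (_ : _ 0 j = (1 - t) * z 0 j + t * z' 0 j); last by rewrite !mxE; ring.
rewrite (le_lt_trans (ler_normD _ _)) // !normrM ger0_norm ?subr_ge0 // [`|t|]ger0_norm //.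
exact: convex_lt.
Qed.

End Slice.

(** * The boundary hypersurface *)

Section Boundary.
Context {R : realType} {d p q : nat} {M : manifold R d}.
Local Notation V := 'rV[R]_d.
Variables (g : metric M p q) (f : M -> R) (U : set M).
Hypotheses (sf : smooth_fun f) (oU : open U).
Hypothesis fU : forall x, U x -> f x != 0.
Hypothesis fS : forall x, closure U x -> ~ U x -> f x = 0.

Local Notation S := (boundary_points U).
Local Notation lf := (local_fun f).

Definition grad_norm b x : R := gradsq (lf b) (local_metric g b) (phi b x).

Lemma boundaryE x : S x <-> closure U x /\ ~ U x.
Proof. by rewrite /boundary_points (interior_id U).1. Qed.

Lemma boundary_zero x : S x -> f x = 0.
Proof. by move=> /boundaryE[]; exact: fS. Qed.

Lemma local_fun_phi b x : dom b x -> lf b (phi b x) = f x.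
Proof. by move=> bx; rewrite /local_fun /= phiK. Qed.

Lemma smooth_gradsq b : smooth_on (img b) (gradsq (lf b) (local_metric g b)).
Proof.
have sd := smooth_drow (@img_open _ _ _ b) (local_fun_smooth sf b).
apply: smooth_entry; first exact: img_open.
apply: smooth_mulmx; first exact: img_open.
  apply: smooth_mulmx => //; first exact: img_open.
  apply: smooth_invmx; [exact: img_open|exact: local_metric_unit|exact: local_metric_smooth].
apply: smooth_mx; first exact: img_open.
move=> k l; under eq_fun do rewrite mxE.
by apply: smooth_entry => //; exact: img_open.
Qed.

(** An arbitrary closed [P] lets one limit argument serve both for the bound away from zero and for
    the two signs. [F] is the continuous extension of the curvature across the zeros of [f]. *)
Lemma boundary_curvature (P : set R) : closed P ->
  (forall b x, U x -> dom b x -> P (scal (local_scaled g f b) (phi b x))) ->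
  forall b x, S x -> dom b x -> P (- (d%:R * (d%:R - 1) * grad_norm b x)).
Proof.
move=> cP PU b x Sx bx; have /boundaryE[cx _] := Sx.
have [Q sQ QE] := scal_rescale (@img_open _ _ _ b) (local_fun_smooth sf b)
  (@local_metric_smooth _ _ _ _ _ g b) (@local_metric_sym _ _ _ _ _ g b)
  (@local_metric_unit _ _ _ _ _ g b).
pose F y := lf b y * Q y - d%:R * (d%:R - 1) * gradsq (lf b) (local_metric g b) y.
have -> : - (d%:R * (d%:R - 1) * grad_norm b x) = (F \o phi b) x.
  by rewrite /F /= local_fun_phi // boundary_zero // mul0r add0r.
have sF : smooth_on (img b) F.
  apply: smoothB; first exact: img_open.
    by apply: smoothM => //; [exact: img_open|exact: local_fun_smooth].
  by apply: smoothM; [exact: img_open|exact: smooth_cst|exact: smooth_gradsq].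
have cF : {for x, continuous (F \o phi b)}.
  apply: continuous_comp; first exact: phi_continuous.
  by apply: smooth_continuous sF _; exact: img_phi.
apply/cP => B /cF nB.
have nb : nbhs x (dom b) by apply: open_nbhs_nbhs; split=> //; exact: dom_open.
have [y [Uy [by_ By]]] := cx _ (filterI nb nB).
exists (F (phi b y)); split=> //.
rewrite /F -QE; [exact: PU|exact: img_phi|by rewrite local_fun_phi //; exact: fU].
Qed.

Hypothesis grad0 : forall b x, S x -> dom b x -> grad_norm b x != 0.

Lemma boundary_partial b x : S x -> dom b x ->
  exists j, partial j (lf b) (phi b x) != 0.
Proof.
move=> Sx bx; apply: contrapT => nj; have /eqP := grad0 Sx bx; apply.
rewrite /grad_norm /gradsq (_ : drow _ _ = 0) ?mul0mx ?mxE //.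
apply/rowP => j; rewrite [LHS]mxE [RHS]mxE; apply/eqP/negPn/negP => pj; apply: nj.
by exists j.
Qed.

Section Slice.
Variables (b : midx M) (x : M) (j : 'I_d) (N W : set V) (Th Ps : V -> V).
Hypotheses (oN : open N) (oW : open W) (Nb : N `<=` img b).
Hypotheses (ThN : forall y, N y -> W (Th y) /\ Ps (Th y) = y).
Hypotheses (PsW : forall z, W z -> N (Ps z) /\ Th (Ps z) = z).
Hypotheses (sTh : smooth_on N Th) (sPs : smooth_on W Ps).

Let D := dom b `&` phi b @^-1` N.

Let oD : open D.
Proof. exact: open_preimageI (@dom_open _ _ _ b) (@phi_continuous _ _ _ b) oN. Qed.

Let imgD : (Th \o phi b) @` D = W.
Proof.
apply/seteqP; split=> [z [y [by_ Ny] <-]|z Wz]; first by have [] := ThN Ny.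
have [Nz zE] := PsW Wz; have bz := Nb Nz.
exists (psi b (Ps z)); rewrite /= ?psiK //.
by split; [exact: psi_dom|rewrite /= psiK].
Qed.

(** Built transparently, since later proofs compute with its domain and its coordinate map. *)
Definition recoordinate : chart R d M.
Proof.
refine (@Chart R d M D (Th \o phi b) (psi b \o Ps) oD _ _ _ _).
- by rewrite imgD.
- by move=> y [by_ Ny] /=; have [_ ->] := ThN Ny; exact: phiK.
- move=> y [by_ Ny]; apply: continuous_comp; first exact: phi_continuous.
  exact: smooth_continuous sTh Ny.
- rewrite imgD => z Wz; have [Nz _] := PsW Wz.
  apply: continuous_comp; first exact: smooth_continuous sPs Wz.
  by apply: psi_continuous; exact: Nb.
Defined.

Lemma recoordinate_img : cphi recoordinate @` cdom recoordinate = W.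
Proof. exact: imgD. Qed.

Lemma recoordinate_compat a : smooth_compat (atlas a) recoordinate.
Proof.
have [sab sba] := atlas_compat (m := M) a b.
split; rewrite /smooth_transition.
  have oA : open (phi a @` (dom a `&` D)) by exact: chart_open_image.
  apply: (smooth_comp_mx (g := Th) (F := phi b \o psi a) oA oN) => //.
    by move=> _ [y [ay [by_ Ny]] <-] /=; rewrite phiK.
  by apply: smooth_sub sab => _ [y [ay [by_ Ny]] <-]; exists y.
have oA : open (cphi recoordinate @` (cdom recoordinate `&` dom a)).
  by apply: chart_open_image; exact: dom_open.
apply: (smooth_comp_mx (g := phi a \o psi b) (F := Ps) oA
  (chart_open_image (k := atlas b) (@dom_open _ _ _ a))) => //.
  move=> _ [y [[by_ Ny] ay] <-] /=; have [_ ->] := ThN Ny.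
  by exists y.
by apply: smooth_sub sPs => _ [y [[by_ Ny] ay] <-] /=; have [] := ThN Ny.
Qed.

End Slice.

(* On the sides of the hypersurface [f] does not vanish, and a segment of the
   slice chart which starts on it stays on one side. *)
Lemma zero_set_closure (k : chart R d M) (j : 'I_d) c0 (W : set V) x : open W ->
  cphi k @` cdom k = W ->
  (forall z z' t, W z -> W z' -> 0 <= t <= 1 -> W (z + t *: (z' - z))) ->
  (forall y, cdom k y -> f y = c0 * cphi k y 0 j) ->
  closure U x -> cdom k x -> forall y, cdom k y -> f y = 0 -> closure U y.
Proof.
move=> oW WE cW fE cx kx y ky fy.
have nk : nbhs x (cdom k) by apply: open_nbhs_nbhs; split=> //; exact: cdom_open.
have [m [Um km]] := cx _ nk.
pose z := cphi k y; pose z' := cphi k m.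
have Wz : W z by rewrite -WE; exists y.
have Wz' : W z' by rewrite -WE; exists m.
pose l (t : R) := z + t *: (z' - z); pose gam := cpsi k \o l.
have Wl t : 0 <= t <= 1 -> W (l t) by exact: cW.
have cl : continuous l.
  move=> t; apply: cvgD; first exact: cvg_cst.
  by apply: cvgZr_tmp; exact: cvg_id.
have cgam t : 0 <= t <= 1 -> {for t, continuous gam}.
  move=> t01; apply: continuous_comp; first exact: cl.
  by apply: cpsi_continuous; rewrite WE; exact: Wl.
have kgam t : 0 <= t <= 1 -> cdom k (gam t) /\ cphi k (gam t) = l t.
  by move=> t01; apply: cpsi_cdom; rewrite WE; exact: Wl.
have z0 : c0 * z 0 j = 0 by rewrite -fE.
have fgam t : 0 <= t <= 1 -> f (gam t) = t * f m.
  move=> /kgam[kt ktE]; rewrite (fE _ kt) (fE _ km) ktE -/z' !mxE.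
  by rewrite mulrDr z0 mulrCA mulrBr z0 subr0 add0r.
pose I := `]0, 1]%classic : set R.
have I01 t : I t -> 0 <= t <= 1 by rewrite /I /= in_itv /= => /andP[/ltW -> ->].
have gam1 : gam 1 = m by rewrite /gam /l /= scale1r addrC subrK cphiK.
(* The half-open segment is connected and meets [U] at [m]. Its part in [U] is relatively open, and
   also relatively closed: a limit point outside [U] would be a zero of [f], while
   [f (gam t) = t * f m] is nonzero for [t > 0]. *)
have gamU : [set gam t | t in I] `&` U = [set gam t | t in I].
  apply: (@connected_continuous_connected _ _ I gam).
  - by apply/connected_intervalP; exact: interval_is_interval.
  - by apply: continuous_in_subspaceT => t; rewrite inE => /I01; exact: cgam.
  - by exists m; split=> //; exists 1 => //; rewrite /I /= in_itv /= ltr01 lexx.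
  - by exists U.
  - exists (closure U); first exact: closed_closure.
    apply/seteqP; split=> w [Iw Uw]; split=> //; first exact: subset_closure.
    have [t It tw] := Iw; apply: contrapT => /(fS Uw); rewrite -tw fgam; last exact: I01.
    move/eqP; rewrite mulf_eq0 (negPf (fU Um)) orbF => /eqP t0.
    by move: It; rewrite /I /= in_itv /= t0 ltxx.
move=> B nB; have gam0 : gam 0 = y by rewrite /gam /l /= scale0r addr0 cphiK.
have : {for 0, continuous gam} by apply: cgam; rewrite lexx ler01.
move=> /(_ B); rewrite gam0 => /(_ nB)/nbhs_ballP[e /= e0 eB].
pose t := Num.min (e / 2) 1.
have t0 : 0 < t by rewrite lt_min divr_gt0 ?ltr01.
have It : I t by rewrite /I /= in_itv /= t0 ge_min lexx orbT.
exists (gam t); split.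
  by have [] : ([set gam t | t in I] `&` U) (gam t) by rewrite gamU; exists t.
apply: eB; rewrite -ball_normE /= sub0r normrN gtr0_norm //.
by rewrite gt_min ltr_pdivrMr // ltr_pMr // ltr1n.
Qed.

Lemma boundary_slice x : S x -> exists (k : chart R d M) (j : 'I_d),
  [/\ (forall a, smooth_compat (atlas a) k), cdom k x &
      forall y, cdom k y -> (S y <-> cphi k y 0 j = 0)].
Proof.
move=> Sx; have [b bx] := atlas_cover x.
have [j pj] := boundary_partial Sx bx; set c0 := partial j _ _ in pj.
(* Division by the partial derivative, whose sign is unknown, makes it 1 at the point, hence
   positive as [slice_coordinates] requires. *)
pose h y := c0^-1 * lf b y.
have slf : smooth_on (img b) (lf b) by exact: local_fun_smooth.
have sh : smooth_on (img b) h.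
  by apply: smoothM => //; [exact: img_open|exact: smooth_cst].
have hx : h (phi b x) = 0 by rewrite /h local_fun_phi // boundary_zero // mulr0.
have dlf : derivable (lf b) (phi b x) (delta_mx 0 j).
  by apply: diff_derivable; apply: smooth_differentiable slf _; exact: img_phi.
have dh : 0 < partial j h (phi b x).
  by rewrite /partial deriveZ // -/(partial _ _ _) -/c0 /GRing.scale /= mulVf ?ltr01.
have [N [W [Ps [[oN oW Nx Nb] [ThN PsW sTh sPs cW]]]]] :=
  slice_coordinates (@img_open _ _ _ b) (img_phi bx) sh hx dh.
pose k := recoordinate oN oW Nb ThN PsW sTh sPs.
have kx : cdom k x by [].
have kE y : cdom k y -> cphi k y 0 j = c0^-1 * f y.
  by move=> [by_ _]; rewrite /= setj_j /h local_fun_phi.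
exists k, j; split=> //; first exact: recoordinate_compat.
move=> y ky; rewrite kE //; split=> [/boundary_zero ->|/eqP]; first by rewrite mulr0.
rewrite mulf_eq0 invr_eq0 (negPf pj) /= => /eqP fy; apply/boundaryE; split.
  have /boundaryE[cx _] := Sx.
  apply: (@zero_set_closure k j c0 W x oW) => //; first exact: recoordinate_img.
  by move=> w kw; rewrite kE // mulrA mulfV // mul1r.
by move=> /fU; rewrite fy eqxx.
Qed.

(** Nonemptiness comes from connectedness: a proper nonempty open set with no boundary point would
    also be closed. *)
Lemma boundary_hypersurface : connected [set: M] -> U !=set0 -> U != setT ->
  embedded_hypersurface S.
Proof.
move=> cM [m Um] UT; split; last by move=> x /boundary_slice.
apply: contrapT => S0; move/eqP: UT; apply.
apply: cM; [by exists m|by exists U; rewrite // setTI|exists U; rewrite ?setTI //].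
move=> x cx; apply: contrapT => nx; apply: S0; exists x; exact/boundaryE.
Qed.

End Boundary.

(** * The gradient as normal field *)

Section Normal.
Context {R : realType} {d p q : nat} {M : manifold R d}.
Local Notation V := 'rV[R]_d.
Variables (g : metric M p q) (f : M -> R) (S : set M).
Hypotheses (sf : smooth_fun f) (fS : forall x, S x -> f x = 0).

Local Notation lf := (local_fun f).
Local Notation lg := (local_metric g).

Definition gradient (a : midx M) (x : M) : V :=
  drow (lf a) (phi a x) *m invmx (lg a (phi a x)).

Let metricE a x : dom a x -> g a x = lg a (phi a x).
Proof. by move=> ax; rewrite /local_metric /= phiK. Qed.

Let lfd a x : dom a x -> differentiable (lf a) (phi a x).
Proof. by move=> ax; apply: smooth_differentiable (sf a) _; exact: img_phi. Qed.

Lemma drow_change a b x : dom a x -> dom b x ->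
  drow (lf a) (phi a x) = drow (lf b) (phi b x) *m (dmap idfun a b x)^T.
Proof.
move=> ax bx; have [sab _] := atlas_compat (m := M) a b.
pose T := phi b \o psi a.
have TE : T (phi a x) = phi b x by rewrite /T /= phiK.
have dT : differentiable T (phi a x).
  by apply: smooth_differentiable sab _; exists x.
have db : differentiable (lf b) (T (phi a x)) by rewrite TE; exact: lfd.
have ab : \forall y \near phi a x, lf a y = (lf b \o T) y.
  apply: (@open_near_eq _ _ _ (phi a @` (dom a `&` dom b))); last by exists x.
    by apply: chart_open_image; exact: dom_open.
  move=> _ /set_mem[y [ay by_] <-].
  by rewrite /local_fun /T /= phiK // phiK // (phiK by_).
apply/rowP => k; rewrite [LHS]mxE /partial (near_eq_derive _ ab).
rewrite derive_comp_rV // [RHS]mxE; apply: eq_bigr => l _.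
rewrite -derive_entry // [drow _ _ _ _]mxE TE mulrC [X in _ = _ * X]mxE.
by rewrite deriveEjacobian // -rowE [X in _ * X]mxE.
Qed.

Lemma gradient_change a b x : dom a x -> dom b x ->
  gradient b x = gradient a x *m dmap idfun a b x.
Proof.
move=> ax bx; rewrite /gradient (drow_change ax bx).
have ga := local_metric_unit g (img_phi ax).
move: ga; rewrite -(metricE ax) -(metricE bx) (mcomp_change g ax bx).
move: (dmap _ _ _ _) (drow _ _) => J D.
rewrite !unitmx_mul unitmx_tr => /andP[/andP[uJ ub] _].
have uG : J *m g b x *m J^T \in unitmx by rewrite !unitmx_mul uJ ub unitmx_tr.
(* A one-sided inverse of a square matrix is two-sided; this moves [J] to the right end, where the
   transformation law wants it. *)
have /mulmx1C JE : J *m (g b x *m J^T *m invmx (J *m g b x *m J^T)) = 1%:M.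
  by rewrite !mulmxA mulmxV.
rewrite -[LHS]mulmx1 -JE -!mulmxA; congr (D *m _).
by rewrite mulKmx.
Qed.

Lemma gradient_along : vector_field_along S gradient.
Proof.
split=> [a b x _|a x Sx ax]; first exact: gradient_change.
exists (dom a), (fun y => drow (lf a) y *m invmx (lg a y)); split=> //; first exact: dom_open.
apply: smooth_mulmx; first exact: img_open.
  exact: smooth_drow (@img_open _ _ _ a) (sf a).
apply: smooth_invmx; [exact: img_open|exact: local_metric_unit|exact: local_metric_smooth].
Qed.

Lemma inner_gradient a x v : dom a x -> inner g a x (gradient a x) v = (drow (lf a) (phi a x) *m v^T) 0 0.
Proof.
move=> ax; rewrite /inner (metricE ax) /gradient mulmxKV //.
by apply: local_metric_unit; exact: img_phi.
Qed.

Lemma inner_gradient2 a x : dom a x -> inner g a x (gradient a x) (gradient a x) = grad_norm g f a x.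
Proof.
move=> ax; rewrite inner_gradient // /grad_norm /gradsq /gradient trmx_mul trmx_inv.
by rewrite local_metric_sym ?mulmxA //; exact: img_phi.
Qed.

(** Derivative at 0 of [f] along the curve, where it is identically zero. *)
Lemma gradient_tangent a x v : S x -> dom a x -> tangent_to S a x v ->
  drow (lf a) (phi a x) *m v^T = 0.
Proof.
move=> Sx ax [e [gam [e0 [gc gs] gx gS <-]]].
pose u := phi a \o gam; pose J := ball (0 : R) e `&` gam @^-1` dom a.
have J0 : J 0 by split; [exact: ballxx|rewrite /= gx].
have oJ : open J by apply: open_preimageI => //; [exact: ball_open|exact: dom_open].
have du : differentiable u 0 by exact: smooth_differentiable (gs a) J0.
have u0 : u 0 = phi a x by rewrite /u /= gx.
have dl : differentiable (lf a) (u 0) by rewrite u0; exact: lfd.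
have z : \forall t \near 0, (lf a \o u) t = 0.
  apply: filterS (open_nbhs_nbhs (conj oJ J0)) => t [tb at_].
  by rewrite /= local_fun_phi // fS //; exact: gS.
have : 'D_1 (lf a \o u) 0 = 0 by rewrite (near_eq_derive _ z) derive_cst.
rewrite derive_comp_rV // => D0; apply/matrixP => k l; rewrite !ord1 [RHS]mxE -[RHS]D0 mxE.
apply: eq_bigr => r _; rewrite [drow _ _ _ _]mxE [X in _ * X]mxE u0 mulrC.
by rewrite -(derive_entry _ _ _ du) derive1E.
Qed.

Lemma inner_rescaled Om g' a x v w : rescaled Om g g' -> dom a x ->
  inner g' a x v w = Om x ^+ 2 * inner g a x v w.
Proof.
by move=> [_ _ E] ax; rewrite /inner (E _ _ ax) -scalemxAr -scalemxAl [LHS]mxE.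
Qed.

Lemma gradient_normal (c : set (metric M p q)) : c = [set g' | exists Om, rescaled Om g g'] ->
  normal_field c S gradient.
Proof.
move=> ->; split; first exact: gradient_along.
move=> g' a x v [Om resc] Sx ax tv.
by rewrite (inner_rescaled _ _ resc ax) inner_gradient // gradient_tangent // mxE mulr0.
Qed.

End Normal.

Theorem theorem6p8 (R : realType) (d p q : nat) (hd : (3 <= d)%N)
    (Mp M : manifold R d) (Mp_nonempty : [set: Mp] !=set0)
    (gp : metric Mp p q) (gp_complete : geodesically_complete gp)
    (M_compact : compact [set: M]) (M_connected : connected [set: M])
    (c : set (metric M p q)) (c_conformal : conformal_class c)
    (i : Mp -> M) (i_embedding : open_embedding i)
    (s : density c 1) (gp_scale : is_scale_metric i gp s)
    (Sc_bounded_away : exists2 eps : R, 0 < eps &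
      forall a x, dom a x -> eps <= `|scalar_curvature gp a x|) :
  range i = [set: M] \/
  [/\ embedded_hypersurface (boundary_points (range i)),
      ((forall a x, dom a x -> 0 < scalar_curvature gp a x) ->
       exists n, normal_field c (boundary_points (range i)) n /\
                 timelike_along c (boundary_points (range i)) n) &
      ((forall a x, dom a x -> scalar_curvature gp a x < 0) ->
       exists n, normal_field c (boundary_points (range i)) n /\
                 spacelike_along c (boundary_points (range i)) n)].
Proof.
have [->|iT] := eqVneq (range i) setT; [by left|right].
have [g cE] := c_conformal; have [eps eps0 Sc_eps] := Sc_bounded_away.
have [m0 _] := Mp_nonempty.
have cg : c g.
  rewrite cE; exists (cst 1); split=> [a|x|a x _] /=; first exact: smooth_cst.
    exact: ltr01.
  by rewrite expr1n scale1r.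
pose f := s g.
have sf : smooth_fun f by exact: dens_smooth.
have f0 m : f (i m) != 0 by have [] := gp_scale g cg m.
have gpE m a b : dom a m -> dom b (i m) ->
    gp a m = dmap i a b m *m ((f (i m)) ^- 2 *: g b (i m)) *m (dmap i a b m)^T.
  by move=> am bm; have [_ /(_ a b am bm)] := gp_scale g cg m.
have oU := range_open i_embedding.
have fU x : range i x -> f x != 0 by move=> [m _ <-].
have fS x : closure (range i) x -> ~ range i x -> f x = 0.
  exact: (closure_range_zero m0 i_embedding gp_complete sf f0 gpE).
have d0 : 0 < d%:R * (d%:R - 1) :> R.
  by rewrite mulr_gt0 // ?subr_gt0 ?ltr0n ?ltr1n (leq_trans _ hd).
(* Closed conditions on the curvature of [gp] pass to the squared norm of [df] at boundary
   points. *)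
have bc (P : set R) : closed P -> (forall a m, dom a m -> P (scalar_curvature gp a m)) ->
    forall b x, boundary_points (range i) x -> dom b x ->
    P (- (d%:R * (d%:R - 1) * grad_norm g f b x)).
  move=> cP Psc; apply: boundary_curvature => // b _ [m _ <-] bm.
  have [a am] := atlas_cover m.
  by rewrite -(scalar_curvature_scaled i_embedding sf f0 gpE am bm); exact: Psc.
have fZ : forall x, boundary_points (range i) x -> f x = 0 by exact: boundary_zero.
split.
- apply: (boundary_hypersurface (g := g) (f := f)) => //; last by exists (i m0), m0.
  move=> b x Sx bx; apply/eqP => g0.
  have : [set t : R | eps <= `|t|] (- (d%:R * (d%:R - 1) * grad_norm g f b x)).
    apply: (bc [set t : R | eps <= `|t|]) => //.
    rewrite (_ : [set _ | _] = (fun t : R => `|t|) @^-1` [set t | eps <= t]) //.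
    by apply: closed_comp => [t _|]; [exact: norm_continuous|exact: closed_ge].
  by rewrite /= g0 mulr0 oppr0 normr0 leNgt eps0.
- move=> Sc0; exists (gradient g f); split; first exact: gradient_normal.
  move=> g' a x; rewrite cE => -[Om resc] Sx ax.
  rewrite (inner_rescaled _ _ resc ax) inner_gradient2 // pmulr_rlt0; last first.
    by rewrite exprn_gt0 //; have [_ + _] := resc; exact.
  (* Positivity alone is not a closed condition; combined with the bound on the absolute value it
     becomes the closed condition [eps <= t], which the limit keeps. *)
  have : [set t : R | eps <= t] (- (d%:R * (d%:R - 1) * grad_norm g f a x)).
    apply: (bc [set t : R | eps <= t]) => //.
    by move=> b m bm /=; rewrite -(gtr0_norm (Sc0 _ _ bm)); exact: Sc_eps.
  by move=> /(lt_le_trans eps0); rewrite oppr_gt0 pmulr_rlt0.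
- move=> Sc0; exists (gradient g f); split; first exact: gradient_normal.
  move=> g' a x; rewrite cE => -[Om resc] Sx ax.
  rewrite (inner_rescaled _ _ resc ax) inner_gradient2 // pmulr_rgt0; last first.
    by rewrite exprn_gt0 //; have [_ + _] := resc; exact.
  have : [set t : R | t <= - eps] (- (d%:R * (d%:R - 1) * grad_norm g f a x)).
    apply: (bc [set t : R | t <= - eps]) => //.
    by move=> b m bm /=; rewrite lerNr -(ltr0_norm (Sc0 _ _ bm)); exact: Sc_eps.
  by rewrite /= lerN2 => /(lt_le_trans eps0); rewrite pmulr_rgt0.
Qed.
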